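(* Let $f:(\mathbb{C}^2,0)\to(\mathbb{C},0)$ be a radially weighted homogeneous mixed polynomial. Then the following properties are equivalent: \begin{itemize} \item $f$ has a weakly isolated singularity at the origin and satisfies the strong Milnor condition; \item $f$ has an isolated singularity at the origin; \item $f$ is strongly partially non-degenerate (SPND); \item $f$ is strongly inner non-degenerate (SIND). \end{itemize}
   Context: A mixed polynomial is a (not identically zero) finite sum $f(z,\bar z)=\sum_{\nu,\mu}c_{\nu,\mu}z^\nu\bar z^\mu$ with $z=(u,v)\in\mathbb{C}^2$, $\bar z=(\bar u,\bar v)$, $z^\nu=u^{\nu_1}v^{\nu_2}$, $\bar z^\mu=\bar u^{\mu_1}\bar v^{\mu_2}$. Its support is $\mathrm{supp}(f)=\{\nu+\mu: c_{\nu,\mu}\neq 0\}\subset\mathbb{N}^2$. $f_u,f_{\bar u},f_v,f_{\bar v}$ denote the (Wirtinger) partial derivatives. $V_f=f^{-1}(0)$. Singular set: put $s_{1,f}=f_u\overline{f_{\bar v}}-\overline{f_{\bar u}}f_v$, $s_{2,f}=|f_u|^2-|f_{\bar u}|^2$, $s_{3,f}=|f_v|^2-|f_{\bar v}|^2$ (these are mixed polynomials). The set of critical (singular) points of $f$ is $\Sigma_f=\{s_{1,f}=s_{2,f}=s_{3,f}=0\}$; it is the set of points where the real Jacobian matrix of $f$ does not have maximal rank. The origin is a weakly isolated singularity if it has an open neighbourhood $U$ with $U\cap V_f\cap\Sigma_f=\{0\}$, and an isolated singularity if it has an open neighbourhood $U$ with $U\cap\Sigma_f=\{0\}$. Strong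 Milnor condition: there is $\rho_0>0$ such that for every $0<\rho\le\rho_0$ the map $f/|f|:S^3_\rho\setminus V_f\to S^1$ is a locally trivial fibration, where $S^3_\rho\subset\mathbb{C}^2$ is the sphere of radius $\rho$ centred at the origin. Face functions: a positive weight vector is $P=(p_1,p_2)$ with $p_1,p_2$ positive integers. The radial degree of a monomial $c_{\nu,\mu}z^\nu\bar z^\mu$ is $p_1(\nu_1+\mu_1)+p_2(\nu_2+\mu_2)$; $d(P;f)$ is the minimal radial degree among the monomials of $f$, and the face function $f_P$ is the sum of the monomials of $f$ of radial degree $d(P;f)$ (for the zero polynomial, the $P$-part is $0$). $f$ is radially weighted homogeneous if $f=f_P$ for some positive weight vector $P$. The Newton boundary $\Gamma_f$ is the union of the compact faces (vertices and 1-dimensional faces, ''1-faces'') of the convex hull of $\bigcup_{\nu+\mu\in\mathrm{supp}(f)}\left(\nu+\mu+\mathbb{R}_{\ge0}^2\right)$. For a compact face $\Delta$, $f_\Delta=\sum_{\nu+\mu\in\Delta}c_{\nu,\mu}z^\nu\bar z^\mu$, and $f_\Gamma=\sum_{\nu+\mu\in\Gamma_f}c_{\nu,\mu}z^\nu\bar z^\mu$. Let $P_1,\dots,P_N$ be the weight vectors (one for each 1-face) such that $f_{P_i}$ is the face function of a compact 1-face, with $P_i=(p_{i,1},p_{i,2})$ and $k_i=p_{i,1}/p_{i,2}$, ordered so that $k_1>k_2>\dots>k_N$. A vertex of $\Gamma_f$ is called extreme if it bounds a unique 1-face, and non-extreme if it bounds two. Convention: only for those $f$ whose Newton boundary has no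 compact 1-face (i.e. is a single vertex, such as $f=u$), ''$f$ has a (weakly) isolated singularity at the origin'' is to be read as ''if $f$ has a singular point at the origin, it is a (weakly) isolated singularity''. SIND: (i) $f_{P_1}$ has no critical points in $\mathbb{C}^2\setminus\{v=0\}$ and $f_{P_N}$ has no critical points in $\mathbb{C}^2\setminus\{u=0\}$; (ii) for each 1-face and each non-extreme vertex $\Delta$, $f_\Delta$ has no critical points in $(\mathbb{C}^* )^2$. If $\Gamma_f$ is a single vertex, $f$ is called SIND if $f_\Gamma$ has no critical points in $\mathbb{C}^2\setminus\{(0,0)\}$. SPND: for every positive weight vector $P$: (i) the system $(s_{1,f}(0,v))_P=(s_{2,f}(0,v))_P=(s_{3,f}(0,v))_P=0$ has no solution in $(\mathbb{C}^* )^2$, and the system $(s_{1,f}(u,0))_P=(s_{2,f}(u,0))_P=(s_{3,f}(u,0))_P=0$ has no solution in $(\mathbb{C}^* )^2$; (ii) the system $(s_{1,f})_P=(s_{2,f})_P=(s_{3,f})_P=0$ has no solution in $(\mathbb{C}^* )^2$. Here $h(0,v)$ and $h(u,0)$ denote the mixed polynomials obtained from $h$ by setting $u=\bar u=0$, respectively $v=\bar v=0$.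
   Formalization: ''(Weakly) isolated singularity'' is read for every f as a condition only when the origin is a singular point, not just for f without compact 1-face (literally, f=u+v^2 is a counterexample); ''locally trivial fibration'' is read as smooth. *)

(* Defs.v *)
(* The field of complex numbers is R[i], for R : realType. *)
From HB Require Import structures.
From mathcomp Require Import all_boot all_order all_algebra.
From mathcomp Require Import complex.
From mathcomp Require Import all_classical all_reals all_analysis.
From mathcomp Require Import -(notations) mpoly.

Set Implicit Arguments.
Unset Strict Implicit.
Unset Printing Implicit Defensive.

Import Order.TTheory GRing.Theory Num.Theory.
Import numFieldNormedType.Exports.

Local Open Scope classical_set_scope.
Local Open Scope ring_scope.

(** * Mixed polynomials *)

(* A mixed polynomial in u, v is a polynomial in four independent variables,
   in the order u, v, ubar, vbar; it is evaluated at (u, v, conj u, conj v), and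
   its Wirtinger derivatives are the formal partial derivatives. *)
Notation mixed R := (mpoly 4 (complex R)).

Definition iu  : 'I_4 := @Ordinal 4 0 isT.
Definition iv  : 'I_4 := @Ordinal 4 1 isT.
Definition iub : 'I_4 := @Ordinal 4 2 isT.
Definition ivb : 'I_4 := @Ordinal 4 3 isT.

Definition mixedX (R : realType) (i : 'I_4) : mixed R :=
  mpolyX R[i] (mnm1 i).

Definition mixed_eval (R : realType) (f : mixed R) (z : R[i] * R[i]) : R[i] :=
  meval (tnth [tuple z.1; z.2; conjc z.1; conjc z.2]) f.

Definition wirtinger (R : realType) (i : 'I_4) (f : mixed R) : mixed R :=
  mderiv i f.

Definition mconj (R : realType) (f : mixed R) : mixed R :=
  comp_mpoly [tuple mixedX R iub; mixedX R ivb; mixedX R iu; mixedX R iv]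
    (map_mpoly (@conjc R) f).

Definition at_u0 (R : realType) (h : mixed R) : mixed R :=
  comp_mpoly [tuple 0; mixedX R iv; 0; mixedX R ivb] h.

Definition at_v0 (R : realType) (h : mixed R) : mixed R :=
  comp_mpoly [tuple mixedX R iu; 0; mixedX R iub; 0] h.

Definition zeros (R : realType) (f : mixed R) : set (R[i] * R[i]) :=
  [set z | mixed_eval f z = 0].

Definition Cstar2 (R : realType) : set (R[i] * R[i]) :=
  [set z | z.1 != 0 /\ z.2 != 0].

(** * Critical points *)

Definition crit_s1 (R : realType) (f : mixed R) : mixed R :=
  wirtinger iu f * mconj (wirtinger ivb f)
  - mconj (wirtinger iub f) * wirtinger iv f.
Definition crit_s2 (R : realType) (f : mixed R) : mixed R :=
  wirtinger iu f * mconj (wirtinger iu f)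
  - wirtinger iub f * mconj (wirtinger iub f).
Definition crit_s3 (R : realType) (f : mixed R) : mixed R :=
  wirtinger iv f * mconj (wirtinger iv f)
  - wirtinger ivb f * mconj (wirtinger ivb f).

Definition crit (R : realType) (f : mixed R) : set (R[i] * R[i]) :=
  zeros (crit_s1 f) `&` zeros (crit_s2 f) `&` zeros (crit_s3 f).

(** * Face functions and the Newton boundary *)

Definition positive_weight (P : nat * nat) : Prop := (0 < P.1)%N /\ (0 < P.2)%N.

Definition rdeg (P : nat * nat) (m : multinom 4) : nat :=
  (P.1 * (m iu + m iub) + P.2 * (m iv + m ivb))%N.

(* f_P; it is 0 when f = 0 *)
Definition face_part (R : realType) (P : nat * nat) (f : mixed R) : mixed R :=
  \sum_(m <- msupp f |
        all (fun m' => (rdeg P m <= rdeg P m')%N) (msupp f))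
     mcoeff m f *: mpolyX R[i] m.

Definition radially_weighted_homogeneous (R : realType) (f : mixed R) : Prop :=
  exists2 P, positive_weight P & f = face_part P f.

(* nu + mu, as a point of the plane *)
Definition expo (R : realType) (m : multinom 4) : 'rV[R]_2 :=
  \row_(i < 2) if i == 0 then (m iu + m iub)%:R else (m iv + m ivb)%:R.

Definition newton_polyhedron (R : realType) (f : mixed R) : set 'rV[R]_2 :=
  smallest (@convex_set R 'rV[R]_2)
    [set x | exists2 m, m \in msupp f &
                        forall i, expo R m 0 i <= x 0 i].

(* Proper faces of a polyhedron: its intersections with supporting lines. *)
Definition polyhedron_face (R : realType) (N F : set 'rV[R]_2) : Prop :=
  F !=set0 /\
  exists2 a : 'rV[R]_2, a != 0 &
    F = [set x | N x /\ forall y, N y ->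
                   \sum_i a 0 i * x 0 i <= \sum_i a 0 i * y 0 i].

Definition compact_face (R : realType) (f : mixed R) (F : set 'rV[R]_2) : Prop :=
  polyhedron_face (newton_polyhedron f) F /\ compact F.

Definition newton_vertex (R : realType) (f : mixed R) (F : set 'rV[R]_2) : Prop :=
  compact_face f F /\ exists x, F = [set x].

Definition one_face (R : realType) (f : mixed R) (F : set 'rV[R]_2) : Prop :=
  compact_face f F /\ exists x y, [/\ F x, F y & x != y].

Definition non_extreme_vertex (R : realType) (f : mixed R)
    (F : set 'rV[R]_2) : Prop :=
  newton_vertex f F /\ exists F1 F2,
    [/\ one_face f F1, one_face f F2, F `<=` F1, F `<=` F2 & F1 <> F2].

Definition newton_boundary (R : realType) (f : mixed R) : set 'rV[R]_2 :=
  [set x | exists2 F, compact_face f F & F x].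

Definition restrict_to (R : realType) (f : mixed R) (F : set 'rV[R]_2) :
    mixed R :=
  \sum_(m <- msupp f | `[< F (expo R m) >])
     mcoeff m f *: mpolyX R[i] m.

Definition single_vertex (R : realType) (f : mixed R) : Prop :=
  exists x, newton_boundary f = [set x].

(* P is a positive multiple of one of the weight vectors P_1, .., P_N *)
Definition one_face_weight (R : realType) (f : mixed R) (P : nat * nat) : Prop :=
  positive_weight P /\ exists2 F, one_face f F & face_part P f = restrict_to f F.

(* P = P_1, i.e. p_1 / p_2 is maximal among the one-face weights *)
Definition first_weight (R : realType) (f : mixed R) (P : nat * nat) : Prop :=
  one_face_weight f P /\
  forall Q, one_face_weight f Q -> (Q.1 * P.2 <= P.1 * Q.2)%N.

(* P = P_N, i.e. p_1 / p_2 is minimal among the one-face weights *)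
Definition last_weight (R : realType) (f : mixed R) (P : nat * nat) : Prop :=
  one_face_weight f P /\
  forall Q, one_face_weight f Q -> (P.1 * Q.2 <= Q.1 * P.2)%N.

(** * Non-degeneracy conditions *)

Definition SIND (R : realType) (f : mixed R) : Prop :=
  (single_vertex f ->
     forall z, z != (0, 0) -> ~ crit (restrict_to f (newton_boundary f)) z) /\
  (~ single_vertex f ->
     [/\ forall P, first_weight f P ->
           forall z, z.2 != 0 -> ~ crit (face_part P f) z,
         forall P, last_weight f P ->
           forall z, z.1 != 0 -> ~ crit (face_part P f) z &
         forall F, one_face f F \/ non_extreme_vertex f F ->
           forall z, Cstar2 z -> ~ crit (restrict_to f F) z]).

Definition no_common_zero (R : realType) (P : nat * nat) (h1 h2 h3 : mixed R) :
    Prop :=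
  forall z, Cstar2 z ->
    ~ (zeros (face_part P h1) `&` zeros (face_part P h2)
         `&` zeros (face_part P h3)) z.

Definition SPND (R : realType) (f : mixed R) : Prop :=
  forall P, positive_weight P ->
    [/\ no_common_zero P (at_u0 (crit_s1 f)) (at_u0 (crit_s2 f))
                          (at_u0 (crit_s3 f)),
        no_common_zero P (at_v0 (crit_s1 f)) (at_v0 (crit_s2 f))
                          (at_v0 (crit_s3 f)) &
        no_common_zero P (crit_s1 f) (crit_s2 f) (crit_s3 f)].

(** * Topology of C^2, in real coordinates *)

Definition toC2 (R : realType) (x : 'rV[R]_4) : R[i] * R[i] :=
  (Complex (x 0 (@Ordinal 4 0 isT)) (x 0 (@Ordinal 4 1 isT)),
   Complex (x 0 (@Ordinal 4 2 isT)) (x 0 (@Ordinal 4 3 isT))).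

Definition ofC (R : realType) (w : R[i]) : 'rV[R]_2 :=
  \row_(i < 2) if i == 0 then complex.Re w else complex.Im w.

(* Both notions only constrain f when the origin is a critical point. For f = u,
   whose Newton boundary is a single vertex, this is the customary convention.
   The f with a compact 1-face need it too: if f is radially weighted
   homogeneous with f(0) = 0 and the origin is not critical, as for
   f = u + v^2, then crit f is empty, so f is SIND and SPND while
   U `&` crit f = [set 0] fails for every U. *)
Definition weakly_isolated_singularity (R : realType) (f : mixed R) : Prop :=
  crit f (0, 0) ->
  exists2 U : set 'rV[R]_4, open U &
    U `&` (@toC2 R @^-1` (zeros f `&` crit f)) = [set 0].

Definition isolated_singularity (R : realType) (f : mixed R) : Prop :=
  crit f (0, 0) ->
  exists2 U : set 'rV[R]_4, open U &
    U `&` (@toC2 R @^-1` crit f) = [set 0].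

(** * Smooth fibrations *)

(* g is of class C^k on the open set U; V is meant to be finite-dimensional. *)
Fixpoint Ck_on (R : realType) (V W : normedModType R) (k : nat)
    (U : set V) (g : V -> W) : Prop :=
  (forall x, U x -> {for x, continuous g}) /\
  match k with
  | 0%N => True
  | k'.+1 => forall v, (forall x, U x -> derivable g x v) /\
                       Ck_on k' U (fun x => 'D_v g x)
  end.

(* Smoothness on an arbitrary subset of a Euclidean space: local extendability
   to smooth maps on open sets.  On an embedded submanifold it is the usual
   notion. *)
Definition smooth_on (R : realType) (V W : normedModType R)
    (A : set V) (g : V -> W) : Prop :=
  forall x, A x -> exists (U : set V) (G : V -> W),
    [/\ open U, U x, forall k, Ck_on k U G &
        forall y, A y -> U y -> G y = g y].

(* phi : A -> B is a diffeomorphism with inverse psi *)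
Definition diffeo_on (R : realType) (V W : normedModType R)
    (A : set V) (B : set W) (phi : V -> W) (psi : W -> V) : Prop :=
  [/\ smooth_on A phi, smooth_on B psi,
      forall x, A x -> B (phi x) /\ psi (phi x) = x &
      forall y, B y -> A (psi y) /\ phi (psi y) = y].

(* p : E -> B is a (smooth) locally trivial fibration: over a neighbourhood
   B `&` O of any b it is diffeomorphic to the projection from the product with
   the fibre over b.  A merely topological trivialization would not do: with
   h = u^2 ubar + u^3 / 3, the map f / |f| of f = h + v^2 is a topological
   fibration on every sphere around 0, and crit f meets zeros f only at 0, but
   crit f contains points outside zeros f arbitrarily close to 0. *)
Definition locally_trivial_fibration (R : realType) (V W : normedModType R)
    (E : set V) (B : set W) (p : V -> W) : Prop :=
  (forall x, E x -> B (p x)) /\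
  forall b, B b -> exists O : set W, [/\ open O, O b &
    exists (phi : V -> (W * V)%type) (psi : (W * V)%type -> V),
      diffeo_on (E `&` (p @^-1` O))
                ((B `&` O) `*` (E `&` (p @^-1` [set b]))) phi psi /\
      forall x, E x -> O (p x) -> (phi x).1 = p x].

(* Euclidean sphere; the norm of 'rV[R]_4 is the sup norm. *)
Definition euclidean_sphere (R : realType) (n : nat) (rho : R) : set 'rV[R]_n :=
  [set x | \sum_i x 0 i ^+ 2 = rho ^+ 2].

Definition milnor_map (R : realType) (f : mixed R) (x : 'rV[R]_4) : 'rV[R]_2 :=
  ofC (mixed_eval f (toC2 x) / `|mixed_eval f (toC2 x)|).

Definition strong_milnor (R : realType) (f : mixed R) : Prop :=
  exists2 rho0 : R, 0 < rho0 &
    forall rho : R, 0 < rho <= rho0 ->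
      locally_trivial_fibration
        (@euclidean_sphere R 4 rho `\` (@toC2 R @^-1` zeros f))
        (@euclidean_sphere R 2 1) (milnor_map f).

(* Main.v *)
From HB Require Import structures.
Require Import Defs.
From mathcomp Require Import all_boot all_order all_algebra complex.
From mathcomp Require Import all_classical all_reals all_analysis.
From mathcomp Require Import ring lra zify.
From mathcomp Require Import -(notations) mpoly.

Set Implicit Arguments.
Unset Strict Implicit.
Unset Printing Implicit Defensive.

Import Order.TTheory GRing.Theory Num.Theory.
Import numFieldNormedType.Exports.

Local Open Scope classical_set_scope.
Local Open Scope ring_scope.

(** Let [P] be the weight and [d] the radial degree of [f].  The radial action
t.(u, v) = (t^p1 u, t^p2 v) satisfies f(t.z) = t^d f(z), and it preserves the
zeros and the critical points of [f], because the equations s1, s2, s3 of the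
critical set are radially homogeneous as well.  Each of the four properties is
shown to be equivalent to the absence of critical points outside the origin,
called regularity below.

For isolated singularities this is immediate: orbits of the action accumulate
at the origin, so a critical point outside the origin entails others arbitrarily close
to it ([regular_of_isolated]).  The same argument shows that
if the singularity is weakly isolated, then [f] does not vanish at a critical
point z outside the origin ([regular_on_zeros]).

Suppose that moreover the strong Milnor condition holds.  At such a point z the
real differential of [f] has rank at most one, and by Euler's identity it maps
the radial direction to d f(z), which is not zero; hence its image is the real
line through f(z), and the argument of [f] is stationary at z.  A smooth
local trivialization of f/|f| provides points at distance O(t) from z at which
the argument has moved by an amount of order t: a contradiction
([regular_of_strong_milnor]).

Conversely a regular [f] satisfies the strong Milnor condition.  One has to move
the points of a sphere so that the argument of [f] turns at a given speed.
Milnor integrates a vector field; here the motion [y] of [x] in time [t] is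
defined by one implicit polynomial equation q (y - x) = t N, where [q] and
[N] are polynomials in x, y and t built from difference quotients of [f].
They are chosen so that each solution satisfies |y| = |x| and
f(y) (1 - i t) = s f(x) (1 + i t) with s > 0 exactly: the argument increases
by twice the arctangent of [t] ([field_step], [field_step_eval]).  They are
unchanged when [x] and [y] are exchanged and [t] is replaced by [- t], so the
motion in time [- t] is the inverse of that in time [t] ([field_sym]).
Regularity of [f] makes [q] invertible on the sphere at y = x, t = 0; a
contraction argument and compactness then give solutions for all small t at
once, and differentiating the implicit equation shows that they are smooth
([near_identity_family], [rotation_family]).  Moving the points into the fibre
over a given argument trivializes f/|f| ([strong_milnor_of_regular]).

For the non-degeneracy conditions let h be radially homogeneous for [P].  Its
face function for a weight [Q] is h if [Q] is proportional to [P]; otherwise it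
consists of the monomials of least degree in one of the variables, and vanishes
only where h(0, v), respectively h(u, 0), does.  Applied to s1, s2, s3 this turns
SPND into the absence of critical points on the torus and on the two axes
([spnd_of_regular], [regular_of_spnd]).  Finally the exponents of [f] lie on one
line of negative slope, so the only compact faces of its Newton polyhedron are
one segment, which contains all the exponents, and its ends
([compact_face_cases]).  All the face functions in the definition of SIND are
then [f] itself ([sind_of_regular], [regular_of_sind]). *)

(** * Polynomial functions *)

(** An inductive closure rather than a type of multivariate polynomials: one
predicate then covers functions of a point, of two points and of a time, and
substitution is a mere change of generators. *)
Inductive polyfun (R : realType) (T : Type) (C : set (T -> R)) :
    (T -> R) -> Prop :=
| polyfun_cst c : polyfun C (fun=> c)
| polyfun_gen g : C g -> polyfun C g
| polyfun_add F G : polyfun C F -> polyfun C G ->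
    polyfun C (fun x => F x + G x)
| polyfun_mul F G : polyfun C F -> polyfun C G ->
    polyfun C (fun x => F x * G x).

Section Polyfun.
Variables (R : realType) (T : Type) (C : set (T -> R)).
Implicit Types F G : T -> R.

Lemma polyfun_opp F : polyfun C F -> polyfun C (fun x => - F x).
Proof.
move=> hF; rewrite (_ : (fun _ => _) = fun x => -1 * F x).
  exact: polyfun_mul (polyfun_cst _ _) hF.
by apply/funext => x; rewrite mulN1r.
Qed.

Lemma polyfun_sub F G :
  polyfun C F -> polyfun C G -> polyfun C (fun x => F x - G x).
Proof. by move=> hF /polyfun_opp; exact: polyfun_add. Qed.

Lemma polyfun_sum (I : Type) (r : seq I) (P : pred I) (F : I -> T -> R) :
  (forall i, polyfun C (F i)) ->
  polyfun C (fun x => \sum_(i <- r | P i) F i x).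
Proof.
move=> hF; elim: r => [|i r IH].
  rewrite (_ : (fun _ => _) = fun=> 0); first exact: polyfun_cst.
  by apply/funext => x; rewrite big_nil.
rewrite (_ : (fun _ => _) = fun x =>
   (if P i then F i x else 0) + \sum_(j <- r | P j) F j x); last first.
  by apply/funext => x; rewrite big_cons; case: ifP => // _; rewrite add0r.
by apply: polyfun_add => //; case: (P i) => //; exact: polyfun_cst.
Qed.

Lemma polyfun_subst (S : Type) (D : set (S -> R)) (h : S -> T) F :
  (forall g, C g -> polyfun D (g \o h)) -> polyfun C F -> polyfun D (F \o h).
Proof.
move=> hC; elim=> {F} [c|g /hC //|F G _ IF _ IG|F G _ IF _ IG].
- exact: polyfun_cst.
- exact: polyfun_add.
- exact: polyfun_mul.
Qed.

End Polyfun.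

Lemma polyfun_continuous (R : realType) (T : topologicalType)
    (C : set (T -> R)) (F : T -> R) (x : T) :
  (forall g, C g -> {for x, continuous g}) -> polyfun C F ->
  {for x, continuous F}.
Proof.
move=> hC; elim=> {F} [c|g /hC //|F G _ IF _ IG|F G _ IF _ IG].
- exact: cst_continuous.
- exact: continuousD.
- exact: continuousM.
Qed.

Definition coords (R : realType) (n : nat) : set ('rV[R]_n -> R) :=
  [set g | exists i, g = fun x : 'rV[R]_n => x 0 i].

Definition coords2 (R : realType) (n : nat) : set ('rV[R]_n * 'rV[R]_n -> R) :=
  [set g | exists i, 
    g = (fun z : 'rV[R]_n * 'rV[R]_n => z.1 0 i) \/
    g = (fun z : 'rV[R]_n * 'rV[R]_n => z.2 0 i)].

(** Difference quotients play the part of partial derivatives.  The product rule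
F(y) G(y) - F(x) G(x) = (F(y) - F(x)) G(y) + F(x) (G(y) - G(x)) keeps them
polynomial. *)
Lemma polyfun_slopes (R : realType) (n : nat) (F : 'rV[R]_n -> R) :
  polyfun (@coords R n) F ->
  exists2 A : 'I_n -> 'rV[R]_n * 'rV[R]_n -> R,
    forall i, polyfun (@coords2 R n) (A i) &
    forall x y, F y - F x = \sum_i (y 0 i - x 0 i) * A i (x, y).
Proof.
have hC i : polyfun (@coords2 R n) (fun z : 'rV[R]_n * 'rV[R]_n => z.1 0 i).
  by apply: polyfun_gen; exists i; left.
have hC' i : polyfun (@coords2 R n) (fun z : 'rV[R]_n * 'rV[R]_n => z.2 0 i).
  by apply: polyfun_gen; exists i; right.
have h1 G : polyfun (@coords R n) G -> polyfun (@coords2 R n) (G \o fst).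
  by apply: polyfun_subst => g [i ->]; exact: hC.
have h2 G : polyfun (@coords R n) G -> polyfun (@coords2 R n) (G \o snd).
  by apply: polyfun_subst => g [i ->]; exact: hC'.
elim=> {F} [c|g [i ->]|F G hF [A hA eA] hG [B hB eB]|F G hF [A hA eA] hG [B hB eB]].
- exists (fun _ _ => 0) => [i|x y]; first exact: polyfun_cst.
  by rewrite subrr big1 // => i _; rewrite mulr0.
- exists (fun j _ => (i == j)%:R) => [j|x y]; first exact: polyfun_cst.
  rewrite (bigD1 i) //= eqxx mulr1 big1 ?addr0 // => j /negbTE ji.
  by rewrite eq_sym ji mulr0.
- exists (fun i z => A i z + B i z) => [i|x y]; first exact: polyfun_add.
  rewrite [RHS](_ : _ = (F y - F x) + (G y - G x)); first by ring.
  by rewrite eA eB -big_split; apply: eq_bigr => i _; rewrite mulrDr.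
- exists (fun i z => A i z * (G \o snd) z + (F \o fst) z * B i z) => [i|x y].
    by apply: polyfun_add; apply: polyfun_mul => //; [exact: h2|exact: h1].
  transitivity ((F y - F x) * G y + F x * (G y - G x)); first by ring.
  rewrite eA eB mulr_suml mulr_sumr -big_split; apply: eq_bigr => i _ /=.
  by ring.
Qed.

(** * Calculus of C^k functions *)

Section CkCalculus.
Variables (R : realType) (V : normedModType R).
Implicit Types (U : set V) (k : nat).

Lemma Ck_onW (W : normedModType R) k U (g : V -> W) :
  Ck_on k.+1 U g -> Ck_on k U g.
Proof.
elim: k g => [|k IH] g [cg Dg]; first by split.
by split=> // v; have [dv Dv] := Dg v; split=> //; apply: IH.
Qed.

Lemma Ck_on_continuous (W : normedModType R) k U (g : V -> W) :
  Ck_on k U g -> forall x, U x -> {for x, continuous g}.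
Proof. by case: k => [|k] []. Qed.

Lemma Ck_on_sub (W : normedModType R) k U U' (g : V -> W) :
  U' `<=` U -> Ck_on k U g -> Ck_on k U' g.
Proof.
move=> sU; elim: k g => [|k IH] g [cg Dg]; split => //; try by move=> x /sU/cg.
by move=> v; have [dv Dv] := Dg v; split=> [x /sU/dv//|]; apply: IH.
Qed.

Lemma open_near_eq (W : Type) U (f g : V -> W) x :
  open U -> (forall y, U y -> f y = g y) -> U x -> \near x, f x = g x.
Proof.
by move=> oU e Ux; near do apply: e; exact: open_nbhs_nbhs.
Unshelve. all: by end_near. Qed.

Lemma near_eq_continuous (W : topologicalType) U (f g : V -> W) x :
  open U -> (forall y, U y -> f y = g y) -> U x ->
  {for x, continuous f} -> {for x, continuous g}.
Proof.
move=> oU e Ux; rewrite /prop_for /continuous_at (e x Ux) => c.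
by apply: cvg_trans c; apply: near_eq_cvg; apply: open_near_eq e Ux.
Qed.

Lemma Ck_on_ext (W : normedModType R) k U (f g : V -> W) :
  open U -> (forall y, U y -> f y = g y) -> Ck_on k U f -> Ck_on k U g.
Proof.
move=> oU; elim: k f g => [|k IH] f g e [cf Df].
  by split=> // x Ux; exact: (near_eq_continuous oU e Ux (cf x Ux)).
split=> [x Ux|v]; first exact: (near_eq_continuous oU e Ux (cf x Ux)).
have [dv Dv] := Df v.
split=> [x Ux|].
  exact: (near_eq_derivable (open_near_eq oU e Ux) (dv x Ux)).
by apply: IH Dv => y Uy; apply/near_eq_derive; exact: (open_near_eq oU e).
Qed.

Lemma Ck_on_cst (W : normedModType R) k U (c : W) : Ck_on k U (fun=> c).
Proof.
have cc : forall x, U x -> {for x, continuous (fun=> c : W)}.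
  by move=> x _; exact: cst_continuous.
elim: k c cc => [|k IH] c cc; split=> // v.
split=> [x _|]; first exact: derivable_cst.
have -> : (fun x => 'D_v (fun=> c : W) x) = (fun=> 0) :> (V -> W).
  by apply/funext => x; exact: (derive_cst c).
by apply: IH => x _; exact: cst_continuous.
Qed.

Lemma Ck_on_add (W : normedModType R) k U (f g : V -> W) : open U ->
  Ck_on k U f -> Ck_on k U g -> Ck_on k U (fun x => f x + g x).
Proof.
move=> oU; elim: k f g => [|k IH] f g [cf Df] [cg Dg].
  by split=> // x Ux; apply: continuousD; [exact: cf|exact: cg].
split=> [x Ux|v]; first by apply: continuousD; [exact: cf|exact: cg].
have [df Df'] := Df v; have [dg Dg'] := Dg v.
split=> [x Ux|]; first by apply: derivableD; [exact: df|exact: dg].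
apply: Ck_on_ext (IH _ _ Df' Dg') => // x Ux.
by rewrite -deriveD //; [exact: df|exact: dg].
Qed.

Lemma Ck_on_mul k U (f g : V -> R) : open U ->
  Ck_on k U f -> Ck_on k U g -> Ck_on k U (fun x => f x * g x).
Proof.
move=> oU; elim: k f g => [|k IH] f g hf hg.
  split=> // x Ux; apply: continuousM; [case: hf|case: hg] => h _; exact: h.
have [cf Df] := hf; have [cg Dg] := hg.
split=> [x Ux|v]; first by apply: continuousM; [exact: cf|exact: cg].
have [df Df'] := Df v; have [dg Dg'] := Dg v.
split=> [x Ux|]; first by apply: derivableM; [exact: df|exact: dg].
have := Ck_on_add oU (IH _ _ (Ck_onW hf) Dg') (IH _ _ (Ck_onW hg) Df').
apply: Ck_on_ext => // x Ux.
by rewrite deriveM //; [exact: df|exact: dg].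
Qed.

(** The derivative - D f / f^2 contains 1 / f again, at one order of smoothness
less; hence the induction. *)
Lemma Ck_on_inv k U (f : V -> R) : open U -> (forall x, U x -> f x != 0) ->
  Ck_on k U f -> Ck_on k U (fun x => (f x)^-1).
Proof.
move=> oU f0; elim: k => [|k IH] hf.
  split=> // x Ux; apply: continuousV; first exact: f0.
  exact: (Ck_on_continuous hf).
have [cf Df] := hf.
split=> [x Ux|v]; first by apply: continuousV; [exact: f0|exact: cf].
have [df Df'] := Df v.
split=> [x Ux|]; first by apply: derivableV; [exact: f0|exact: df].
have hi := IH (Ck_onW hf).
have := Ck_on_mul oU (@Ck_on_cst R k U (-1)) (Ck_on_mul oU (Ck_on_mul oU hi hi) Df').
apply: Ck_on_ext => // x Ux.
rewrite deriveV; [|exact: f0|exact: df].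
by rewrite mulN1r -mulrA /GRing.scale /= !exprS expr0 mulr1 invfM mulNr -mulrA.
Qed.

Lemma Ck_on_polyfun k U (C : set (V -> R)) (F : V -> R) : open U ->
  (forall g, C g -> Ck_on k U g) -> polyfun C F -> Ck_on k U F.
Proof.
move=> oU hC; elim=> {F} [c|g /hC //|F G _ IF _ IG|F G _ IF _ IG].
- exact: Ck_on_cst.
- exact: Ck_on_add.
- exact: Ck_on_mul.
Qed.

Lemma Ck_on_linear (W : normedModType R) k U (L : V -> W) :
  (forall (a : R) u v, L (a *: u + v) = a *: L u + L v) -> continuous L ->
  Ck_on k U L.
Proof.
move=> lL cL.
have cc : forall x, U x -> {for x, continuous L} by move=> x _; exact: cL.
case: k => [|k]; split=> // v.
have e x : h^-1 *: (L (h *: v + x) - L x) @[h --> (0 : R)^'] --> L v.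
  apply: cvg_near_cst; near=> h.
  rewrite lL addrK scalerA mulVf ?scale1r //.
  by near: h; exact: nbhs_dnbhs_neq.
have dL x : is_derive x v L (L v).
  by apply: DeriveDef; [apply/cvg_ex; eexists; exact: e|apply/cvg_lim => //; exact: e].
split=> [x _|]; first by have [] := dL x.
have -> : (fun x => 'D_v L x) = fun=> L v.
  by apply/funext => x; have [_ ->] := dL x.
exact: Ck_on_cst.
Unshelve. all: by end_near. Qed.

Lemma cvg_line (W : topologicalType) (g : V -> W) (x v : V) :
  {for x, continuous g} -> g (h *: v + x) @[h --> (0 : R)^'] --> g x.
Proof.
move=> cg; apply: (@cvg_comp _ _ _ (fun h : R => h *: v + x) g _ (nbhs x)) => //.
apply: (@cvg_within_filter _ _ _ (nbhs (0:R))).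
have e : h *: v + x @[h --> (0 : R)] --> (0 : R) *: v + x.
  apply: cvgD; last exact: cvg_cst.
  by apply: cvgZr_tmp; exact: cvg_id.
by rewrite scale0r add0r in e.
Qed.

Lemma coord_cvg_rV (T : topologicalType) (F : set_system T) (FF : Filter F)
    n (g : T -> 'rV[R]_n) (l : 'rV[R]_n) :
  (forall i, g x 0 i @[x --> F] --> l 0 i) -> g @ F --> l.
Proof.
move=> h; apply/cvgrPdist_le => /= e e0; near=> x.
rewrite [leLHS]/Num.Def.normr/= mx_normrE (bigmax_le _ (ltW e0))//= => -[i j] _.
rewrite !mxE /= (ord1 i).
move: j; near: x; apply: filter_forall => j.
exact: (cvgrPdist_le _ _).1 (h j) _ e0.
Unshelve. all: by end_near. Qed.

Lemma Ck_on_rV k U n (g : V -> 'rV[R]_n) : open U ->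
  (forall i, Ck_on k U (fun x => g x 0 i)) -> Ck_on k U g.
Proof.
move=> oU; elim: k g => [|k IH] g hg.
  split=> // x Ux; apply: coord_cvg_rV => i.
  exact: (Ck_on_continuous (hg i)).
split=> [x Ux|v].
  apply: coord_cvg_rV => i; exact: (Ck_on_continuous (hg i)).
have dg x : U x -> derivable g x v.
  by move=> Ux; apply/derivable_mxP => i j; rewrite (ord1 i);
     have [_ /(_ v)[d _]] := hg j; exact: d.
split => //; apply: IH => i; have [_ /(_ v)[_ D]] := hg i.
apply: Ck_on_ext D => // x Ux; rewrite derive_mx; last exact: dg.
by rewrite mxE.
Qed.

Lemma Ck_on_pair (W W' : normedModType R) k U (f : V -> W) (g : V -> W') :
  open U -> Ck_on k U f -> Ck_on k U g -> Ck_on k U (fun x => (f x, g x)).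
Proof.
move=> oU; elim: k f g => [|k IH] f g hf hg.
  by split=> // x Ux; apply: cvg_pair; 
    [exact: (Ck_on_continuous hf)|exact: (Ck_on_continuous hg)].
have [cf Df] := hf; have [cg Dg] := hg.
split=> [x Ux|v].
  by apply: cvg_pair; [exact: cf|exact: cg].
have [df Df'] := Df v; have [dg Dg'] := Dg v.
have D x : U x -> is_derive x v (fun x => (f x, g x)) ('D_v f x, 'D_v g x).
  move=> Ux; have e := cvg_pair (df x Ux) (dg x Ux).
  have {}e : h^-1 *: ((f (h *: v + x), g (h *: v + x)) - (f x, g x)) @[h --> 0^'] --> ('D_v f x, 'D_v g x) by exact: e.
  by apply: DeriveDef; [apply/cvg_ex; eexists; exact: e|apply/cvg_lim => //; exact: e].
split=> [x /D[]//|].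
by apply: Ck_on_ext (IH _ _ Df' Dg') => // x /D[].
Qed.

(** The difference quotient of sqrt f is that of f divided by a sum of two
square roots; the derivative contains 1 / sqrt f, which is smooth to one order
less by induction. *)
Lemma Ck_on_sqrt k U (f : V -> R) : open U -> (forall x, U x -> 0 < f x) ->
  Ck_on k U f -> Ck_on k U (fun x => Num.sqrt (f x)).
Proof.
move=> oU f0; elim: k => [|k IH] hf.
  split=> // x Ux; apply: continuous_comp; first exact: (Ck_on_continuous hf).
  exact: sqrt_continuous.
have [cf Df] := hf.
have cs := Ck_on_continuous (IH (Ck_onW hf)).
split=> // v.
have [df Df'] := Df v.
have D x : U x -> is_derive x v (fun x => Num.sqrt (f x)) ('D_v f x * (2 * Num.sqrt (f x))^-1).
  move=> Ux.
  have e : h^-1 *: (Num.sqrt (f (h *: v + x)) - Num.sqrt (f x)) @[h --> 0^'] -->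
      'D_v f x * (2 * Num.sqrt (f x))^-1.
    have c1 : Num.sqrt (f (h *: v + x)) @[h --> (0:R)^'] --> Num.sqrt (f x).
      exact: (cvg_line v (cs x Ux)).
    have c2 : (Num.sqrt (f (h *: v + x)) + Num.sqrt (f x))^-1 @[h --> 0^'] -->
        (2 * Num.sqrt (f x))^-1.
      rewrite mulr_natl mulr2n; apply: cvgV.
        by rewrite gt_eqF // addr_gt0 // sqrtr_gt0 f0.
      by apply: cvgD => //; exact: cvg_cst.
    apply: cvg_trans (cvgM (df x Ux) c2); apply: near_eq_cvg.
    have nf : \forall h \near (0 : R)^', 0 < f (h *: v + x).
      exact: (cvgr_gt _ (cvg_line v (cf x Ux)) _ (f0 x Ux)).
    near=> h.
    have fh : 0 < f (h *: v + x) by near: h.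
    have sh : 0 < Num.sqrt (f (h *: v + x)) by rewrite sqrtr_gt0.
    have sx : 0 < Num.sqrt (f x) by rewrite sqrtr_gt0 f0.
    rewrite /GRing.scale /=.
    have -> : f (h *: v + x) - f x = (Num.sqrt (f (h *: v + x)) - Num.sqrt (f x)) *
        (Num.sqrt (f (h *: v + x)) + Num.sqrt (f x)).
      by rewrite -subr_sqr !sqr_sqrtr // ltW // f0.
    have aux (a A B : R) : A + B != 0 ->
        (a * ((A - B) * (A + B))) * (A + B)^-1 = a * (A - B).
      by move=> AB; rewrite mulrA mulfK.
    by apply: aux; rewrite gt_eqF // addr_gt0.
  by apply: DeriveDef; [apply/cvg_ex; eexists; exact: e|apply/cvg_lim => //; exact: e].
split=> [x /D[]//|].
apply: (@Ck_on_ext _ _ _ (fun x => 'D_v f x * (2 * Num.sqrt (f x))^-1)) => //.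
  by move=> x /D[].
apply: Ck_on_mul => //; apply: Ck_on_inv => //.
  by move=> x /f0 h; rewrite mulf_neq0 ?pnatr_eq0 // gt_eqF // sqrtr_gt0.
by apply: Ck_on_mul => //; [exact: Ck_on_cst|exact: IH (Ck_onW hf)].
Unshelve. all: by end_near. Qed.

End CkCalculus.

(** * Implicit functions defined by polynomial equations *)

(** Combines the completeness and the norm of spaces of matrices, as
Banach's fixed point theorem requires. *)
HB.instance Definition _ (R : realType) (m n : nat) :=
  Uniform_isComplete.Build 'M[R]_(m, n) cauchy_cvg.

Section PolyfunMatrix.
Variables (R : realType) (T : Type) (C : set (T -> R)).

Lemma polyfun_prod (I : Type) (r : seq I) (F : I -> T -> R) :
  (forall i, polyfun C (F i)) ->
  polyfun C (fun x => \prod_(i <- r) F i x).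
Proof.
move=> hF; elim: r => [|i r IH].
  have -> : (fun x => \prod_(i <- [::]) F i x) = fun=> 1.
    by apply/funext => x; rewrite big_nil.
  exact: polyfun_cst.
have -> : (fun x => \prod_(j <- i :: r) F j x) =
    fun x => F i x * \prod_(j <- r) F j x.
  by apply/funext => x; rewrite big_cons.
exact: polyfun_mul.
Qed.

Lemma polyfun_mulmx m n p (A : T -> 'M[R]_(m, n)) (B : T -> 'M[R]_(n, p)) :
  (forall i j, polyfun C (fun x => A x i j)) ->
  (forall i j, polyfun C (fun x => B x i j)) ->
  forall i j, polyfun C (fun x => (A x *m B x) i j).
Proof.
move=> hA hB i j.
have -> : (fun x => (A x *m B x) i j) = fun x => \sum_k A x i k * B x k j.
  by apply/funext => x; rewrite mxE.
by apply: polyfun_sum => k; exact: polyfun_mul.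
Qed.

Lemma polyfun_det n (A : T -> 'M[R]_n) :
  (forall i j, polyfun C (fun x => A x i j)) ->
  polyfun C (fun x => \det (A x)).
Proof.
move=> hA; rewrite /determinant; apply: polyfun_sum => s.
by apply: polyfun_mul; [exact: polyfun_cst|exact: polyfun_prod].
Qed.

Lemma polyfun_adj n (A : T -> 'M[R]_n) :
  (forall i j, polyfun C (fun x => A x i j)) ->
  forall i j, polyfun C (fun x => (\adj (A x)) i j).
Proof.
move=> hA i j.
have -> : (fun x => (\adj (A x)) i j) = fun x => cofactor (A x) j i.
  by apply/funext => x; rewrite mxE.
apply: polyfun_mul; first exact: polyfun_cst.
apply: polyfun_det => k l.
have -> : (fun x => (row' j (col' i (A x))) k l) =
    fun x => A x (lift j k) (lift i l).
  by apply/funext => x; rewrite !mxE.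
exact: hA.
Qed.

End PolyfunMatrix.

Lemma polyfun_slopes_mx (R : realType) (N n : nat) (Phi : 'rV[R]_N -> 'rV[R]_n) :
  (forall j, polyfun (@coords R N) (fun z => Phi z 0 j)) ->
  exists2 M : 'rV[R]_N * 'rV[R]_N -> 'M[R]_(N, n),
    forall i j, polyfun (@coords2 R N) (fun zz => M zz i j) &
    forall x y, Phi y - Phi x = (y - x) *m M (x, y).
Proof.
move=> hPhi; pose A j := sval (cid2 (polyfun_slopes (hPhi j))).
exists (fun zz => \matrix_(i, j) A j i zz) => [i j|x y].
  have -> : (fun zz => (\matrix_(i, j) A j i zz) i j) = A j i.
    by apply/funext => zz; rewrite mxE.
  by rewrite /A; case: cid2.
apply/rowP => j; rewrite !mxE.
transitivity (\sum_i (y 0 i - x 0 i) * A j i (x, y)).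
  by rewrite /A; case: cid2 => /= B _ ->.
by apply: eq_bigr => i _; rewrite !mxE.
Qed.

Lemma coords2_continuous (R : realType) N g (z : 'rV[R]_N * 'rV[R]_N) :
  coords2 g -> {for z, continuous g}.
Proof.
move=> [i [->|->]].
  by apply: (@continuous_comp _ _ _ fst (fun z : 'rV[R]_N => z 0 i));
    [exact: cvg_fst|exact: coord_continuous].
by apply: (@continuous_comp _ _ _ snd (fun z : 'rV[R]_N => z 0 i));
  [exact: cvg_snd|exact: coord_continuous].
Qed.

Lemma polyfun2_continuous (R : realType) N g :
  polyfun (@coords2 R N) g -> continuous g.
Proof.
by move=> hg z; apply: polyfun_continuous hg => g'; exact: coords2_continuous.
Qed.

Lemma polyfun2_cvg (R : realType) N g (T : Type) (F : set_system T)
    (FF : Filter F) (u w : T -> 'rV[R]_N) a b :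
  polyfun (@coords2 R N) g -> u @ F --> a -> w @ F --> b ->
  g (u t, w t) @[t --> F] --> g (a, b).
Proof.
move=> hg ua wb.
apply: (@continuous_cvg _ _ _ _ _ (fun t => (u t, w t)) g (a, b)).
  exact: polyfun2_continuous.
exact: (cvg_pair ua wb).
Qed.

Lemma polyfun1_continuous (R : realType) N g :
  polyfun (@coords R N) g -> continuous g.
Proof.
move=> hg z; apply: polyfun_continuous hg => _ [i ->]; exact: coord_continuous.
Qed.

Lemma Ck_on_sum (R : realType) (V : normedModType R) k (U : set V) (I : Type)
    (r : seq I) (F : I -> V -> R) : open U ->
  (forall i, Ck_on k U (F i)) -> Ck_on k U (fun x => \sum_(i <- r) F i x).
Proof.
move=> oU hF; pose C := [set g | exists i, g = F i].
apply: (@Ck_on_polyfun _ _ k U C) => //; first by move=> _ [i ->].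
by apply: polyfun_sum => i; apply: polyfun_gen; exists i.
Qed.

(** Write [M] in two blocks, L for the parameters and J for the unknown.  For two
solutions the slope identity reads (a' - a) L + (Y' - Y) J = 0, so the adjugate of J expresses the increment of [Y] by that of [a], with coefficients
polynomial in both solutions.  In the limit this gives the derivative of [Y] in
terms of that of [a] and of [Y] itself: smoothness follows by induction, from
mere continuity. *)
Lemma implicit_Ck (R : realType) (m n : nat) (V : normedModType R) (U : set V)
    (Phi : 'rV[R]_(m + n) -> 'rV[R]_n)
    (M : 'rV[R]_(m + n) * 'rV[R]_(m + n) -> 'M[R]_(m + n, n))
    (a : V -> 'rV[R]_m) (Y : V -> 'rV[R]_n) :
  (forall i j, polyfun (@coords2 R (m + n)) (fun zz => M zz i j)) ->
  (forall x y, Phi y - Phi x = (y - x) *m M (x, y)) ->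
  open U ->
  (forall k i, Ck_on k U (fun x => a x 0 i)) ->
  (forall x, U x -> {for x, continuous Y}) ->
  (forall x, U x -> Phi (row_mx (a x) (Y x)) = 0) ->
  (forall x, U x -> let z := row_mx (a x) (Y x) in
     \det (dsubmx (M (z, z))) != 0) ->
  forall k i, Ck_on k U (fun x => Y x 0 i).
Proof.
move=> hM eM oU ha cY eY dJ.
pose Z x : 'rV[R]_(m + n) := row_mx (a x) (Y x).
pose W zz := usubmx (M zz) *m \adj (dsubmx (M zz)).
pose Q zz := \det (dsubmx (M zz)).
have hJ i j : polyfun (@coords2 R (m + n)) (fun zz => dsubmx (M zz) i j).
  have -> : (fun zz => dsubmx (M zz) i j) = fun zz => M zz (rshift m i) j.
    by apply/funext => zz; rewrite mxE.
  exact: hM.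
have hW i j : polyfun (@coords2 R (m + n)) (fun zz => W zz i j).
  apply: polyfun_mulmx; last exact: polyfun_adj.
  move=> i' j'.
  have -> : (fun zz => usubmx (M zz) i' j') = fun zz => M zz (lshift n i') j'.
    by apply/funext => zz; rewrite mxE.
  exact: hM.
have hQ : polyfun (@coords2 R (m + n)) Q by exact: polyfun_det.
have ca x : U x -> {for x, continuous a}.
  move=> Ux; apply: coord_cvg_rV => i; exact: (Ck_on_continuous (ha 0%N i)).
have cZ x : U x -> {for x, continuous Z}.
  move=> Ux; apply: coord_cvg_rV => i.
  rewrite /Z; case: (split_ordP i) => j ->.
    rewrite row_mxEl.
    have -> : (fun y => row_mx (a y) (Y y) 0 (lshift n j)) = fun y => a y 0 j.
      by apply/funext => y; rewrite row_mxEl.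
    exact: (Ck_on_continuous (ha 0%N j)).
  rewrite row_mxEr.
  have -> : (fun y => row_mx (a y) (Y y) 0 (rshift m j)) = fun y => Y y 0 j.
    by apply/funext => y; rewrite row_mxEr.
  apply: (@continuous_comp _ _ _ Y (fun z : 'rV[R]_n => z 0 j)).
    exact: cY.
  exact: coord_continuous.
(* Cramer's rule applied to the slope identity between two solutions *)
have eS x y : U x -> U y -> forall j,
    (Y y 0 j - Y x 0 j) * Q (Z x, Z y) =
    - \sum_i (a y 0 i - a x 0 i) * W (Z x, Z y) i j.
  move=> Ux Uy j.
  have := eM (Z x) (Z y); rewrite /Z !eY // subrr opp_row_mx add_row_mx.
  rewrite -[M _]vsubmxK mul_row_col => /(congr1 (fun v => v *m \adj (dsubmx (M (Z x, Z y))))).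
  rewrite mul0mx mulmxDl -!mulmxA mul_mx_adj mul_mx_scalar -/(W _) -/(Q _).
  move=> /esym/eqP; rewrite addrC addr_eq0 => /eqP/(congr1 (fun v : 'rV_n => v 0 j)).
  rewrite !mxE mulrC => ->; congr (- _); apply: eq_bigr => i _.
  by rewrite !mxE.
pose D v j x := - \sum_i 'D_v (fun x => a x 0 i) x * W (Z x, Z x) i j / Q (Z x, Z x).
have cG (G : 'rV[R]_(m + n) * 'rV[R]_(m + n) -> R) x v :
    polyfun (@coords2 R (m + n)) G -> U x ->
    G (Z x, Z (h *: v + x)) @[h --> (0 : R)^'] --> G (Z x, Z x).
  move=> hG Ux.
  apply: polyfun2_cvg => //; first exact: cvg_cst.
  exact: (cvg_line v (cZ x Ux)).
have hD x v j : U x -> is_derive x v (fun x => Y x 0 j) (D v j x).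
  move=> Ux.
  have e : h^-1 *: (Y (h *: v + x) 0 j - Y x 0 j) @[h --> (0 : R)^'] --> D v j x.
    have c1 : (- \sum_i h^-1 *: (a (h *: v + x) 0 i - a x 0 i) *
        W (Z x, Z (h *: v + x)) i j / Q (Z x, Z (h *: v + x)))
        @[h --> (0 : R)^'] --> D v j x.
      apply: cvgN; apply: cvg_big => [|i _]; first exact: add_continuous.
      apply: cvgM; last by apply: cvgV; [exact: dJ|exact: cG].
      apply: cvgM; last exact: (cG (fun zz => W zz i j)).
      by have [_ /(_ v) [+ _]] := ha 1%N i; exact.
    apply: cvg_trans c1; apply: near_eq_cvg.
    near=> h.
    have Uh : U (h *: v + x).
      near: h.
      exact: (@cvg_line _ _ _ id x v (@cvg_id _ _) _ (open_nbhs_nbhs (conj oU Ux))).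
    have Qh : Q (Z x, Z (h *: v + x)) != 0.
      by near: h; apply: cvgr_neq0 (dJ x Ux); exact: cG.
    rewrite -[Y _ _ _ - _](mulfK Qh) eS //= !mulNr scalerN; congr (- _).
    rewrite mulr_suml scaler_sumr; apply: eq_bigr => i _.
    by rewrite !scalerAl.
  by apply: DeriveDef; [apply/cvg_ex; eexists; exact: e|apply/cvg_lim => //; exact: e].
elim=> [|k IH] j.
  split=> // x Ux; apply: (@continuous_comp _ _ _ Y (fun z : 'rV[R]_n => z 0 j)).
    exact: cY.
  exact: coord_continuous.
split=> [|v]; first exact: (Ck_on_continuous (IH j)).
split=> [x /(hD x v j)[]//|].
have hZ G : polyfun (@coords2 R (m + n)) G -> Ck_on k U (fun x => G (Z x, Z x)).
  move=> hG; pose C := [set g | exists i, g = fun x => Z x 0 i].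
  apply: (@Ck_on_polyfun _ _ k U C) => //.
    move=> _ [i ->]; rewrite /Z; case: (split_ordP i) => l ->.
      have -> : (fun y => row_mx (a y) (Y y) 0 (lshift n l)) = fun y => a y 0 l.
        by apply/funext => y; rewrite row_mxEl.
      exact: ha.
    have -> : (fun y => row_mx (a y) (Y y) 0 (rshift m l)) = fun y => Y y 0 l.
      by apply/funext => y; rewrite row_mxEr.
    exact: IH.
  apply: (polyfun_subst (h := fun x => (Z x, Z x)) _ hG) => _ [i [->|->]];
    by apply: polyfun_gen; exists i.
apply: (@Ck_on_ext _ _ _ k U (D v j)) => //.
  by move=> x /(hD x v j)[_ ->].
have -> : D v j = fun x => -1 * \sum_i
    ('D_v (fun x => a x 0 i) x * W (Z x, Z x) i j * (Q (Z x, Z x))^-1).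
  by apply/funext => x; rewrite mulN1r.
apply: Ck_on_mul => //; first exact: Ck_on_cst.
apply: Ck_on_sum => // i; apply: Ck_on_mul => //; last first.
  by apply: Ck_on_inv => //; exact: hZ.
apply: Ck_on_mul => //; last exact: (hZ (fun zz => W zz i j)).
by have [_ /(_ v) [_]] := ha k.+1 i.
Unshelve. all: by end_near. Qed.

(** * Local solutions of polynomial equations *)

Section NormRow.
Variable R : realType.

Lemma norm_rV_coord n (x : 'rV[R]_n) i : `|x 0 i| <= `|x|.
Proof.
rewrite [leRHS]/Num.Def.normr /= mx_normrE.
exact: (le_bigmax _ (fun ij => `|x ij.1 ij.2|) (0, i)).
Qed.

Lemma norm_rV_le n (x : 'rV[R]_n) e :
  0 <= e -> (forall i, `|x 0 i| <= e) -> `|x| <= e.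
Proof.
move=> e0 h; rewrite [leLHS]/Num.Def.normr /= mx_normrE.
by apply: bigmax_le => //= -[i j] _; rewrite (ord1 i) /=.
Qed.

Lemma norm_rV_lt n (x : 'rV[R]_n) e :
  0 < e -> (forall i, `|x 0 i| < e) -> `|x| < e.
Proof.
move=> e0 h; rewrite [ltLHS]/Num.Def.normr /= mx_normrE.
by apply: bigmax_lt => //= -[i j] _; rewrite (ord1 i) /=.
Qed.

Lemma norm_row_mx_lt m n (a : 'rV[R]_m) (y : 'rV[R]_n) e :
  `|a| < e -> `|y| < e -> `|row_mx a y| < e.
Proof.
move=> ha hy; apply: norm_rV_lt => [|i]; first exact: le_lt_trans ha.
case: (split_ordP i) => j ->; rewrite ?row_mxEl ?row_mxEr;
  exact: le_lt_trans (norm_rV_coord _ _) _.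
Qed.

Lemma norm_rV_mulmx_le n p (v : 'rV[R]_n) (K : 'M[R]_(n, p)) c :
  0 <= c -> (forall i j, `|K i j| <= c) -> `|v *m K| <= n%:R * c * `|v|.
Proof.
move=> c0 hK; apply: norm_rV_le => [|j]; first by rewrite !mulr_ge0.
rewrite mxE (le_trans (ler_norm_sum _ _ _)) //.
apply: (@le_trans _ _ (\sum_(i < n) c * `|v|)); last first.
  by rewrite sumr_const card_ord -mulrA mulr_natl.
apply: ler_sum => i _; rewrite normrM mulrC ler_pM //.
exact: norm_rV_coord.
Qed.

Lemma near_norm (V : normedModType R) (x0 : V) (P : V -> Prop) :
  (\forall x \near x0, P x) ->
  exists2 r, 0 < r & forall x, `|x - x0| < r -> P x.
Proof.
move=> /nbhs_normP[r /= r0 h]; exists r => // x xr; apply: h.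
by rewrite /ball_ /= distrC.
Qed.

Lemma near_norm2 (V W : normedModType R) (x0 : V) (y0 : W) (P : V * W -> Prop) :
  (\forall z \near (x0, y0), P z) ->
  exists2 r, 0 < r & forall x y, `|x - x0| < r -> `|y - y0| < r -> P (x, y).
Proof.
move=> /near_norm[r r0 h]; exists r => // x y hx hy; apply: h.
by rewrite prod_normE /= gt_max hx hy.
Qed.

End NormRow.

(** Newton's iteration with the slope matrix frozen at the base point, y - Phi J0^-1,
is a contraction: between two points its slope is 1 - J J0^-1, which vanishes
at the base point.  Its fixed points are the solutions.  The Lipschitz estimate
between solutions comes from Cramer's rule; for a = a' it says that the solution
is unique. *)
Lemma implicit_local (R : realType) (m n : nat)
    (Phi : 'rV[R]_(m + n) -> 'rV[R]_n)
    (M : 'rV[R]_(m + n) * 'rV[R]_(m + n) -> 'M[R]_(m + n, n))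
    (a0 : 'rV[R]_m) (y0 : 'rV[R]_n) :
  (forall j, polyfun (@coords R (m + n)) (fun z => Phi z 0 j)) ->
  (forall i j, polyfun (@coords2 R (m + n)) (fun zz => M zz i j)) ->
  (forall x y, Phi y - Phi x = (y - x) *m M (x, y)) ->
  let z0 := row_mx a0 y0 in
  Phi z0 = 0 -> dsubmx (M (z0, z0)) \in unitmx ->
  exists rho C, [/\ 0 < rho, 0 <= C,
    forall a a' y y', `|a - a0| < rho -> `|a' - a0| < rho ->
      `|y - y0| < rho -> `|y' - y0| < rho ->
      Phi (row_mx a y) = 0 -> Phi (row_mx a' y') = 0 ->
      `|y' - y| <= C * `|a' - a|,
    forall a y, `|a - a0| < rho -> `|y - y0| < rho ->
      let z := row_mx a y in \det (dsubmx (M (z, z))) != 0 &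
    forall eta, 0 < eta -> exists2 r, 0 < r & forall a, `|a - a0| < r ->
      exists2 y, `|y - y0| < eta & Phi (row_mx a y) = 0].
Proof.
move=> hPhi hM eM z0 Phi0 J0u.
pose J0 := dsubmx (M (z0, z0)).
pose Q zz := \det (dsubmx (M zz)).
pose W zz := usubmx (M zz) *m \adj (dsubmx (M zz)).
pose K zz : 'M[R]_n := 1%:M - dsubmx (M zz) *m invmx J0.
have hJ i j : polyfun (@coords2 R (m + n)) (fun zz => dsubmx (M zz) i j).
  have -> : (fun zz => dsubmx (M zz) i j) = fun zz => M zz (rshift m i) j.
    by apply/funext => zz; rewrite mxE.
  exact: hM.
have hW i j : polyfun (@coords2 R (m + n)) (fun zz => W zz i j).
  apply: polyfun_mulmx; last exact: polyfun_adj.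
  move=> i' j'.
  have -> : (fun zz => usubmx (M zz) i' j') = fun zz => M zz (lshift n i') j'.
    by apply/funext => zz; rewrite mxE.
  exact: hM.
have hQ : polyfun (@coords2 R (m + n)) Q by exact: polyfun_det.
have hK i j : polyfun (@coords2 R (m + n)) (fun zz => K zz i j).
  have -> : (fun zz => K zz i j) = fun zz =>
      (1%:M : 'M[R]_n) i j - (dsubmx (M zz) *m invmx J0) i j.
    by apply/funext => zz; rewrite !mxE.
  apply: polyfun_sub; first exact: polyfun_cst.
  by apply: polyfun_mulmx => // *; exact: polyfun_cst.
have Q0 : Q (z0, z0) != 0 by move: J0u; rewrite unitmxE unitfE.
(* Entries of [K] below [c] make the iteration contract by 1/2 in the sup norm
   of R^n; [B] bounds the entries of W J^-1 near the base point. *)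
pose c : R := (2 * n.+1%:R)^-1.
have c0 : 0 < c by rewrite invr_gt0 mulr_gt0.
pose B := 1 + \sum_i \sum_j `|W (z0, z0) i j / Q (z0, z0)|.
have B0 : 0 < B.
  by rewrite ltr_pwDl // sumr_ge0 // => i _; rewrite sumr_ge0.
pose zz0 : 'rV[R]_(m + n) * 'rV[R]_(m + n) := (z0, z0).
have : \forall zz \near zz0, [/\ Q zz != 0,
    forall i j, `|W zz i j / Q zz| < B & forall i j, `|K zz i j| < c].
  have FF : Filter (nbhs zz0) by exact: nbhs_filter.
  have n1 : \forall zz \near zz0, Q zz != 0.
    exact: (@cvgr_neq0 _ _ _ _ FF _ _ (@polyfun2_continuous _ _ _ hQ zz0) Q0).
  have n2 : \forall zz \near zz0, forall i j, `|W zz i j / Q zz| < B.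
    apply: (@filter_forall _ _ _ _ FF) => i.
    apply: (@filter_forall _ _ _ _ FF) => j.
    apply: (@cvgr_norm_lt _ _ _ _ FF _ (W (z0, z0) i j / Q (z0, z0))).
      apply: cvgM; first exact: (@polyfun2_continuous _ _ _ (hW i j) zz0).
      by apply: cvgV => //; exact: (@polyfun2_continuous _ _ _ hQ zz0).
    rewrite /B (bigD1 i) //= (bigD1 j) //= addrA addrA [1 + _]addrC -!addrA.
    rewrite ltrDl ltr_pwDl // addr_ge0 ?sumr_ge0 // => k _.
    by rewrite sumr_ge0.
  have n3 : \forall zz \near zz0, forall i j, `|K zz i j| < c.
    apply: (@filter_forall _ _ _ _ FF) => i.
    apply: (@filter_forall _ _ _ _ FF) => j.
    apply: (@cvgr_norm_lt _ _ _ _ FF _ (K (z0, z0) i j)).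
      exact: (@polyfun2_continuous _ _ _ (hK i j) zz0).
    by rewrite /K mulmxV // subrr mxE normr0.
  by near=> zz; split; near: zz.
move=> /near_norm2[rho rho0 near_rho].
have row_near a y : `|a - a0| < rho -> `|y - y0| < rho ->
    `|row_mx a y - z0| < rho.
  by move=> ha hy; rewrite /z0 opp_row_mx add_row_mx norm_row_mx_lt.
exists rho, (m%:R * B); split => //.
- by rewrite mulr_ge0 // ltW.
- move=> a a' y y' ha ha' hy hy' eP eP'.
  have [Qz Wz _] := near_rho _ _ (row_near _ _ ha hy) (row_near _ _ ha' hy').
  set zz := (row_mx a y, row_mx a' y') in Qz Wz.
  have -> : y' - y = (a - a') *m ((Q zz)^-1 *: W zz).
    have := eM (row_mx a y) (row_mx a' y').
    rewrite eP eP' subrr opp_row_mx add_row_mx -/zz -[M zz]vsubmxK mul_row_col.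
    move=> /(congr1 (fun v => v *m \adj (dsubmx (M zz)))).
    rewrite mul0mx mulmxDl -!mulmxA mul_mx_adj mul_mx_scalar -/(W _) -/(Q _).
    move=> /esym/eqP; rewrite addrC addr_eq0 => /eqP e.
    by rewrite -scalemxAr -[a - a']opprB mulNmx -e scalerA mulVf ?scale1r.
  rewrite -(distrC a); apply: norm_rV_mulmx_le; first exact: ltW.
  by move=> i j; rewrite mxE mulrC ltW.
- by move=> a y ha hy; have [] := near_rho _ _ (row_near _ _ ha hy) (row_near _ _ ha hy).
move=> eta eta0.
pose e := Num.min eta rho / 2.
have min0 : 0 < Num.min eta rho by rewrite lt_min eta0.
have min_eta : Num.min eta rho <= eta by rewrite ge_min lexx.
have min_rho : Num.min eta rho <= rho by rewrite ge_min lexx orbT.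
have e0 : 0 < e by rewrite /e; lra.
have e_eta : e < eta by rewrite /e; lra.
have e_rho : e < rho by rewrite /e; lra.
have : \forall z \near z0, `|Phi z *m invmx J0| < e / 2.
  have FF : Filter (nbhs z0) by exact: nbhs_filter.
  have n4 : \forall z \near z0, forall j, `|(Phi z *m invmx J0) 0 j| < e / 2.
    apply: (@filter_forall _ _ _ _ FF) => j.
    apply: (@cvgr_norm_lt _ _ _ _ FF _ ((Phi z0 *m invmx J0) 0 j)).
      apply: (@polyfun1_continuous _ _ (fun z => (Phi z *m invmx J0) 0 j)).
      by apply: polyfun_mulmx => [i k|*]; [rewrite (ord1 i)|exact: polyfun_cst].
    by rewrite Phi0 mul0mx mxE normr0 divr_gt0.
  by apply: filterS n4 => z; apply: norm_rV_lt; rewrite divr_gt0.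
move=> /near_norm[r r0 near_r].
exists (Num.min r rho); first by rewrite lt_min r0.
move=> a; rewrite lt_min => /andP[ar arho].
pose T (y : 'rV[R]_n) := y - Phi (row_mx a y) *m invmx J0.
pose D : set 'rV[R]_n := closed_ball_ Num.Def.normr y0 e.
have hD y : D y -> `|y - y0| < rho.
  by rewrite /D /closed_ball_ /= distrC => /le_lt_trans; apply.
have Tdist y y' : D y -> D y' -> `|T y - T y'| <= 2^-1 * `|y - y'|.
  move=> /hD hy /hD hy'.
  have -> : T y - T y' = (y - y') *m K (row_mx a y', row_mx a y).
    have := eM (row_mx a y') (row_mx a y).
    rewrite opp_row_mx add_row_mx subrr -[M _]vsubmxK mul_row_col mul0mx add0r.
    move=> e1; rewrite /K mulmxBr mulmx1 mulmxA -e1 mulmxBl /T.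
    rewrite !opprB [X in _ + X = _]addrC addrACA; congr (_ + _); exact: addrC.
  have [_ _ Kz] := near_rho _ _ (row_near _ _ arho hy') (row_near _ _ arho hy).
  have := @norm_rV_mulmx_le _ _ _ (y - y') _ _ (ltW c0) (fun i j => ltW (Kz i j)).
  move=> /le_trans; apply; rewrite ler_wpM2r //.
  rewrite /c invfM mulrCA ler_piMr // ler_pdivrMr // mul1r ler_nat //.
have D0 : D y0 by rewrite /D /closed_ball_ /= subrr normr0 ltW.
have TD : {homo T : y / D y >-> D y}.
  move=> y Dy; rewrite /D /closed_ball_ /= distrC.
  have -> : T y - y0 = (T y - T y0) + (T y0 - y0) by rewrite addrA subrK.
  rewrite (le_trans (ler_normD _ _)) // [leRHS](splitr e) lerD //.
    apply: le_trans (Tdist _ _ Dy D0) _.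
    by rewrite mulrC ler_pM2r // distrC.
  rewrite /T addrAC subrr add0r normrN ltW // near_r //.
  by rewrite opp_row_mx add_row_mx subrr norm_row_mx_lt // normr0.
have [|||p Dp ep] := @banach_fixed_point R _ D (mkfun_fun TD).
- exists (2^-1)%:nng; split => /=; first by rewrite invf_lt1 // ltr1n.
  by move=> [y y'] /= [Dy Dy']; exact: Tdist.
- exact: closed_closed_ball_.
- by exists y0.
exists p.
  by move: Dp; rewrite /D /closed_ball_ /= distrC => /le_lt_trans; apply.
move: ep; rewrite /= /mkfun /T => /eqP.
rewrite eq_sym -subr_eq0 addrAC subrr add0r oppr_eq0 => /eqP.
move=> /(congr1 (fun v => v *m J0)); rewrite mul0mx -mulmxA mulVmx //.
by rewrite mulmx1.
Unshelve. all: by end_near. Qed.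

(** * A one-parameter family of maps close to the identity *)

(** By compactness: the radius found at a point serves all its neighbours, and
finitely many neighbourhoods cover [K]. *)
Lemma compact_uniform (R : realType) (V : normedModType R) (K : set V)
    (P : R -> V -> Prop) :
  compact K ->
  (forall r r' x, 0 < r -> r <= r' -> P r' x -> P r x) ->
  (forall x, K x -> exists2 rho, 0 < rho &
     forall x', `|x' - x| < rho -> P rho x') ->
  exists2 r, 0 < r & forall x, K x -> P r x.
Proof.
move=> cK mono loc.
have nK : near_covering K by apply/compact_near_coveringP.
have : \forall r \near (0 : R)^'+, K `<=` P r.
  apply: nK => x Kx; have [rho rho0 h] := loc x Kx.
  exists ([set x' | `|x' - x| < rho], [set r | 0 < r < rho]) => /=.
    split; first by apply/nbhs_normP; exists rho => //= y; rewrite /ball_ /= distrC.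
    near=> r; apply/andP; split.
      by near: r; exact: nbhs_right_gt.
    by near: r; exact: nbhs_right_lt.
  move=> [x' r] /= [hx /andP[r0 rrho]].
  by apply: mono (h x' hx) => //; exact: ltW.
move=> nP; near (0 : R)^'+ => r; exists r; first by [].
by near: r.
Unshelve. all: by end_near. Qed.

(** Slopes are obtained through a division by the increment; this gives their
values where the increment vanishes. *)
Lemma continuous_zero (R : realType) (d : R -> R) :
  {for 0, continuous d} -> (forall h, h != 0 -> d h = 0) -> d 0 = 0.
Proof.
move=> cd d0.
have c1 : d @ (0 : R)^' --> d 0 by apply: (@cvg_within_filter _ _ _ (nbhs (0 : R))); exact: cd.
have c2 : d @ (0 : R)^' --> (0 : R).
  apply: cvg_near_cst; near=> h; apply: d0; near: h; exact: nbhs_dnbhs_neq.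
exact: (cvg_unique _ c1 c2).
Unshelve. all: by end_near. Qed.

Section NearIdentity.
Variables (R : realType) (n : nat).

Definition xty (x : 'rV[R]_n) (t : R) (y : 'rV[R]_n) : 'rV[R]_((n + 1) + n) :=
  row_mx (row_mx x (const_mx t)) y.

Definition xpart (z : 'rV[R]_((n + 1) + n)) := lsubmx (lsubmx z).
Definition tpart (z : 'rV[R]_((n + 1) + n)) := rsubmx (lsubmx z) 0 0.
Definition ypart (z : 'rV[R]_((n + 1) + n)) := rsubmx z.

Lemma xpartE x t y : xpart (xty x t y) = x.
Proof. by rewrite /xpart /xty !row_mxKl. Qed.
Lemma tpartE x t y : tpart (xty x t y) = t.
Proof. by rewrite /tpart /xty row_mxKl row_mxKr mxE. Qed.
Lemma ypartE x t y : ypart (xty x t y) = y.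
Proof. by rewrite /ypart /xty row_mxKr. Qed.

Lemma polyfun_xpart i : polyfun (@coords R _) (fun z => xpart z 0 i).
Proof.
apply: polyfun_gen; exists (lshift n (lshift 1 i)).
by apply/funext => z; rewrite !mxE.
Qed.

Lemma polyfun_tpart : polyfun (@coords R _) tpart.
Proof.
apply: polyfun_gen; exists (lshift n (rshift n 0)).
by apply/funext => z; rewrite /tpart !mxE.
Qed.

Lemma polyfun_ypart i : polyfun (@coords R _) (fun z => ypart z 0 i).
Proof.
apply: polyfun_gen; exists (rshift (n + 1) i).
by apply/funext => z; rewrite !mxE.
Qed.

Variables (q : 'rV[R]_((n + 1) + n) -> R).
Variables (N : 'rV[R]_((n + 1) + n) -> 'rV[R]_n).
Hypothesis hq : polyfun (@coords R _) q.
Hypothesis hN : forall i, polyfun (@coords R _) (fun z => N z 0 i).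

(** To be solved for [y].  At time zero the equation is q (y - x) = 0, which has
the solution y = x. *)
Definition displacement (z : 'rV[R]_((n + 1) + n)) : 'rV[R]_n :=
  q z *: (ypart z - xpart z) - tpart z *: N z.

Lemma polyfun_displacement j :
  polyfun (@coords R _) (fun z => displacement z 0 j).
Proof.
have -> : (fun z => displacement z 0 j) = fun z =>
    q z * (ypart z 0 j - xpart z 0 j) - tpart z * N z 0 j.
  by apply/funext => z; rewrite !mxE.
apply: polyfun_sub; apply: polyfun_mul => //; last exact: polyfun_tpart.
by apply: polyfun_sub; [exact: polyfun_ypart|exact: polyfun_xpart].
Qed.

Section Slopes.
Variable M : 'rV[R]_((n + 1) + n) * 'rV[R]_((n + 1) + n) -> 'M[R]_((n + 1) + n, n).
Hypothesis hM : forall i j, polyfun (@coords2 R _) (fun zz => M zz i j).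
Hypothesis eM : forall x y, displacement y - displacement x = (y - x) *m M (x, y).

(** The slope identity determines [M] only in the direction of the increment.
For the increment h e_i of [y] it reads h M_i = h q e_i, and the value at h = 0
follows by continuity. *)
Lemma displacement_slope x : let z := xty x 0 x in
  dsubmx (M (z, z)) = (q z)%:M.
Proof.
move=> z; apply/matrixP => i j; rewrite !mxE.
pose w (h : R) := xty x 0 (x + h *: delta_mx 0 i).
have w0 : w 0 = z by rewrite /w scale0r addr0.
pose d h := dsubmx (M (z, w h)) i j - q (w h) * (i == j)%:R.
suff /eqP : d 0 = 0.
  by rewrite /d w0 subr_eq0 mxE => /eqP ->; rewrite mulr_natr.
have cw : {for 0, continuous w}.
  apply: coord_cvg_rV => k; rewrite /w /xty.
  case: (split_ordP k) => l ->.
    rewrite row_mxEl; have -> : (fun h : R => row_mx (row_mx x (const_mx 0)) (x + h *: delta_mx 0 i) 0 (lshift n l)) = fun=> row_mx x (const_mx 0) 0 l.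
      by apply/funext => h; rewrite row_mxEl.
    exact: cvg_cst.
  rewrite row_mxEr; have -> : (fun h : R => row_mx (row_mx x (const_mx 0)) (x + h *: delta_mx 0 i) 0 (rshift (n + 1) l)) = fun h => x 0 l + h * (delta_mx 0 i : 'rV[R]_n) 0 l.
    by apply/funext => h; rewrite row_mxEr !mxE.
  rewrite !mxE; apply: cvgD; first exact: cvg_cst.
  by apply: cvgM; [exact: cvg_id|exact: cvg_cst].
apply: continuous_zero => [|h h0]; rewrite /d.
  apply: cvgB.
    apply: (@polyfun2_cvg _ _ (fun zz => dsubmx (M zz) i j)) => //; last exact: cvg_cst.
    have -> : (fun zz => dsubmx (M zz) i j) = fun zz => M zz (rshift (n + 1) i) j.
      by apply/funext => zz; rewrite mxE.
    exact: hM.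
  apply: cvgM; last exact: cvg_cst.
  apply: (continuous_cvg _ _ cw); exact: polyfun1_continuous.
have := eM z (w h); rewrite /displacement !ypartE !xpartE !tpartE.
rewrite !scale0r !subr0 subrr scaler0 subr0 addrAC subrr add0r.
have -> : w h - z = row_mx 0 (h *: delta_mx 0 i).
  by rewrite /w /z /xty opp_row_mx add_row_mx subrr addrAC subrr add0r.
rewrite -[M _]vsubmxK mul_row_col mul0mx add0r.
move=> /(congr1 (fun v : 'rV_n => h^-1 * v 0 j)).
rewrite -scalemxAl -rowE vsubmxK !mxE eqxx /= !mulrA mulVf // mul1r => <-.
rewrite [h^-1 * _]mulrC -(mulrA _ h^-1) mulVf // mulr1 eq_sym.
by rewrite subrr.
Qed.
End Slopes.

Variables (K : set 'rV[R]_n) (G : 'rV[R]_((n + 1) + n) -> Prop).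
Hypothesis compactK : compact K.
Hypothesis qK : forall x, K x -> q (xty x 0 x) != 0.
Hypothesis nearG : forall x, K x -> \forall z \near xty x 0 x, G z.

Lemma norm_xt (x x' : 'rV[R]_n) (t t' e : R) : `|x - x'| < e -> `|t - t'| < e ->
  `|row_mx x (const_mx t : 'rV[R]_1) - row_mx x' (const_mx t' : 'rV[R]_1)| < e.
Proof.
move=> hx ht; rewrite opp_row_mx add_row_mx; apply: norm_row_mx_lt => //.
apply: norm_rV_lt => [|i]; first exact: le_lt_trans ht.
by rewrite !mxE.
Qed.

(** Where [q] is invertible, y = x is a nondegenerate solution at time zero, so
[implicit_local] solves the equation near every point of [K], and by
compactness in a time that is uniform on [K].  Nearby solutions are unique;
this yields continuity, hence smoothness by [implicit_Ck], and it identifies the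
solution starting from Y x t in time [- t] with [x] as soon as [x] solves the
corresponding equation.  [G] is any condition that holds near time zero. *)
Theorem near_identity_family : exists r (Y : 'rV[R]_n -> R -> 'rV[R]_n),
  [/\ 0 < r,
    forall x t, (exists2 x0, K x0 & `|x - x0| < r) -> `|t| < r ->
      let z := xty x t (Y x t) in [/\ displacement z = 0, q z != 0 & G z],
    forall x t, K x -> `|t| < r -> K (Y x t) ->
      displacement (xty (Y x t) (- t) x) = 0 -> Y (Y x t) (- t) = x &
    forall (V : normedModType R) (U : set V) (a : V -> 'rV[R]_n) (t : V -> R),
      open U -> (forall k i, Ck_on k U (fun p => a p 0 i)) ->
      (forall k, Ck_on k U t) ->
      (forall p, U p -> exists2 x0, K x0 & `|a p - x0| < r) ->
      (forall p, U p -> `|t p| < r) ->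
      forall k i, Ck_on k U (fun p => Y (a p) (t p) 0 i)].
Proof.
have [M hM eM] := polyfun_slopes_mx polyfun_displacement.
pose Sol x t y := displacement (xty x t y) = 0.
pose at0 (x : 'rV[R]_n) := row_mx x (const_mx 0 : 'rV[R]_1).
have loc x : K x -> exists rho C, [/\ 0 < rho, 0 <= C,
    forall (a a' : 'rV[R]_(n + 1)) (y y' : 'rV[R]_n), `|a - at0 x| < rho -> `|a' - at0 x| < rho ->
      `|y - x| < rho -> `|y' - x| < rho ->
      displacement (row_mx a y) = 0 -> displacement (row_mx a' y') = 0 ->
      `|y' - y| <= C * `|a' - a|,
    forall (a : 'rV[R]_(n + 1)) (y : 'rV[R]_n), `|a - at0 x| < rho -> `|y - x| < rho ->
      let z := row_mx a y in \det (dsubmx (M (z, z))) != 0 &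
    forall eta, 0 < eta -> exists2 r, 0 < r & forall a : 'rV[R]_(n + 1), `|a - at0 x| < r ->
      exists2 y, `|y - x| < eta & displacement (row_mx a y) = 0].
  move=> Kx; apply: (implicit_local polyfun_displacement hM eM).
    by rewrite -/(xty x 0 x) /displacement ypartE xpartE tpartE subrr scaler0
      scale0r subrr.
  by rewrite (displacement_slope hM eM) unitmxE det_scalar unitrX // unitfE qK.
have at0_near (x x' : 'rV[R]_n) e : `|x' - x| < e -> `|at0 x' - at0 x| < e.
  move=> h; apply: norm_xt => //; rewrite subrr normr0; exact: le_lt_trans h.
pose P rho x := (exists2 C, 0 <= C & forall (a a' : 'rV[R]_(n + 1)) (y y' : 'rV[R]_n),
      `|a - at0 x| < rho -> `|a' - at0 x| < rho ->
      `|y - x| < rho -> `|y' - x| < rho ->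
      displacement (row_mx a y) = 0 -> displacement (row_mx a' y') = 0 ->
      `|y' - y| <= C * `|a' - a|) /\
    (forall (a : 'rV[R]_(n + 1)) (y : 'rV[R]_n), `|a - at0 x| < rho -> `|y - x| < rho ->
      let z := row_mx a y in
      [/\ \det (dsubmx (M (z, z))) != 0, q z != 0 & G z]).
have [rho rho0 Prho] : exists2 r, 0 < r & forall x, K x -> P r x.
  apply: compact_uniform => // [r r' x r0 rr' [[C C0 h] h']|x Kx].
    have w z : z < r -> z < r' by move=> /lt_le_trans; apply.
    split; first by exists C => // a a' y y' /w ? /w ? /w ? /w ?; exact: h.
    by move=> a y /w ? /w ?; exact: h'.
  have [rho1 [C [r0 C0 hL hdet _]]] := loc x Kx.
  have nq : \forall z \near xty x 0 x, q z != 0.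
    have FF : Filter (nbhs (xty x 0 x)) by exact: nbhs_filter.
    exact: (@cvgr_neq0 _ _ _ _ FF _ _ (@polyfun1_continuous _ _ _ hq _) (qK Kx)).
  have [r2 r20 h2] := near_norm nq.
  have [r3 r30 h3] := near_norm (nearG Kx).
  pose e := Num.min rho1 (Num.min r2 r3).
  have e0 : 0 < e by rewrite /e !lt_min r0 r20.
  have [ee ee2 ee3] : [/\ e <= rho1, e <= r2 & e <= r3].
    by rewrite /e !ge_min !lexx ?orbT.
  exists (e / 2); first by rewrite divr_gt0.
  move=> x' hx'.
  have wa a : `|a - at0 x'| < e / 2 -> `|a - at0 x| < e.
    move=> ha; rewrite -(subrKA (at0 x')) (le_lt_trans (ler_normD _ _)) //.
    by rewrite [ltRHS](splitr e) ltrD // at0_near.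
  have wy y : `|y - x'| < e / 2 -> `|y - x| < e.
    move=> ha; rewrite -(subrKA x') (le_lt_trans (ler_normD _ _)) //.
    by rewrite [ltRHS](splitr e) ltrD.
  split.
    exists C => // a a' y y' /wa ha /wa ha' /wy hy /wy hy'.
    by apply: hL; [apply: lt_le_trans ha _|apply: lt_le_trans ha' _
      |apply: lt_le_trans hy _|apply: lt_le_trans hy' _].
  move=> a y /wa ha /wy hy z.
  have hz : `|z - xty x 0 x| < e.
    by rewrite /z /xty opp_row_mx add_row_mx; apply: norm_row_mx_lt.
  split.
  - by apply: hdet; [apply: lt_le_trans ha _|apply: lt_le_trans hy _].
  - by apply: h2; apply: lt_le_trans hz _.
  - by apply: h3; apply: lt_le_trans hz _.
(* Solutions exist at distance rho / 4 from a base point [x0] of [K], and they are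
   unique at distance rho; a starting point [x] at distance rho / 4 of [x0] thus has
   exactly one solution at distance rho / 2 from itself. *)
pose E r x := forall a : 'rV[R]_(n + 1), `|a - at0 x| < r ->
  exists2 y, `|y - x| < rho / 4 & displacement (row_mx a y) = 0.
have [r1 r10 Er1] : exists2 r, 0 < r & forall x, K x -> E r x.
  apply: compact_uniform => // [r r' x r0 rr' h a ha|x Kx].
    by apply: h; apply: lt_le_trans ha _.
  have [_ [_ [_ _ _ _ hex]]] := loc x Kx.
  have rho8 : 0 < rho / 8 by rewrite divr_gt0.
  have [r r0 hr] := hex _ rho8.
  pose e := Num.min r (rho / 8).
  have e0 : 0 < e by rewrite lt_min r0.
  have [er er8] : e <= r /\ e <= rho / 8 by rewrite /e !ge_min !lexx ?orbT.
  exists (e / 2); first by rewrite divr_gt0.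
  move=> x' hx' a ha.
  have [|y hy ey] := hr a.
    rewrite -(subrKA (at0 x')) (le_lt_trans (ler_normD _ _)) //.
    apply: lt_le_trans er; rewrite [ltRHS](splitr e) ltrD // at0_near //.
  exists y => //; rewrite -(subrKA x) (le_lt_trans (ler_normD _ _)) //.
  by rewrite distrC in hx'; lra.
pose r := Num.min r1 (rho / 4).
have r0 : 0 < r by rewrite lt_min r10 divr_gt0.
have [rr1 rr4] : r <= r1 /\ r <= rho / 4 by rewrite /r !ge_min !lexx ?orbT.
pose Y x t := xget x [set y | Sol x t y /\ `|y - x| < rho / 2].
have nxt x0 x t : `|x - x0| < r -> `|t| < r ->
    `|row_mx x (const_mx t : 'rV[R]_1) - at0 x0| < r.
  by move=> hx ht; apply: norm_xt; rewrite ?subr0.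
have hY x t : (exists2 x0, K x0 & `|x - x0| < r) -> `|t| < r ->
    Sol x t (Y x t) /\ `|Y x t - x| < rho / 2.
  move=> [x0 Kx0 hx] ht; rewrite /Y; case: xgetP => // /(_ _) none.
  have [|y hy ey] := Er1 _ Kx0 (row_mx x (const_mx t)).
    by apply: lt_le_trans rr1; exact: nxt.
  have := none y; case; split => //.
  rewrite -(subrKA x0) (le_lt_trans (ler_normD _ _)) //.
  by rewrite distrC in hx; lra.
have close x0 x y : `|x - x0| < r -> `|y - x| < rho / 2 -> `|y - x0| < rho.
  move=> hx hy; rewrite -(subrKA x) (le_lt_trans (ler_normD _ _)) //; lra.
have inN (x x0 : 'rV[R]_n) : K x0 -> `|x - x0| < r ->
    exists2 x0, K x0 & `|x - x0| < r by exists x0.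
have r_rho : r < rho by lra.
exists r, Y; split => //.
- move=> x t [x0 Kx0 hx] ht z.
  have [s1 s2] := hY x t (inN _ _ Kx0 hx) ht.
  have [_ /(_ (row_mx x (const_mx t)) (Y x t))] := Prho _ Kx0.
  by case=> //; [exact: lt_trans (nxt _ _ _ hx ht) _|exact: close hx s2].
- move=> x t Kx ht KY Sx; set y := Y x t in KY Sx *.
  have hN' : `|- t| < r by rewrite normrN.
  have yy : `|y - y| < r by rewrite subrr normr0.
  have xx : `|x - x| < r by rewrite subrr normr0.
  have [_ yx] := hY x t (inN _ _ Kx xx) ht.
  have [s1 s2] := hY y (- t) (inN _ _ KY yy) hN'.
  have [[C C0 /(_ (row_mx y (const_mx (- t))) (row_mx y (const_mx (- t))) x (Y y (- t))) h] _] := Prho _ KY.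
  have na : `|row_mx y (const_mx (- t)) - at0 y| < rho.
    exact: lt_trans (nxt _ _ _ yy hN') _.
  move: h; rewrite subrr normr0 mulr0 => h.
  apply/eqP; rewrite -subr_eq0 -normr_le0; apply: h => //.
    rewrite distrC; apply: lt_trans yx _; lra.
  apply: lt_trans s2 _; lra.
move=> V U a t oU ha ht Ua Ut.
have cC F : (forall k, Ck_on k U F) -> forall p, U p -> {for p, continuous F}.
  by move=> h p; exact: (Ck_on_continuous (h 0%N)).
pose b p := row_mx (a p) (const_mx (t p) : 'rV[R]_1).
have hb k i : Ck_on k U (fun p => b p 0 i).
  rewrite /b; case: (split_ordP i) => l ->.
    have -> : (fun p => row_mx (a p) (const_mx (t p) : 'rV[R]_1) 0 (lshift 1 l)) = fun p => a p 0 l.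
      by apply/funext => p; rewrite row_mxEl.
    exact: ha.
  have -> : (fun p => row_mx (a p) (const_mx (t p) : 'rV[R]_1) 0 (rshift n l)) = t.
    by apply/funext => p; rewrite row_mxEr mxE.
  exact: ht.
have ca p : U p -> {for p, continuous a}.
  by move=> Up; apply: coord_cvg_rV => i; exact: (Ck_on_continuous (ha 0%N i)).
have cb p : U p -> {for p, continuous b}.
  by move=> Up; apply: coord_cvg_rV => i; exact: (Ck_on_continuous (hb 0%N i)).
apply: (implicit_Ck hM eM oU hb (Y := fun p => Y (a p) (t p))).
- move=> p Up; have [x0 Kx0 hx] := Ua p Up.
  have [[C C0 hC] _] := Prho _ Kx0.
  have [s1 s2] := hY _ _ (Ua p Up) (Ut p Up).
  apply/cvgrPdist_le => /= e e0.
  have nU : \forall p' \near p, U p' by exact: open_nbhs_nbhs.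
  have na : \forall p' \near p, `|a p' - x0| < r.
    have h : (fun p' => a p' - x0) @ p --> a p - x0.
      by apply: cvgB; [exact: ca|exact: cvg_cst].
    exact: (cvgr_norm_lt _ h _ hx).
  have C1 : 0 < C + 1 by rewrite ltr_pwDr.
  have nb : \forall p' \near p, `|b p - b p'| <= e / (C + 1).
    by have /cvgrPdist_le := cb p Up; apply; rewrite divr_gt0.
  near=> p'.
  have Up' : U p' by near: p'.
  have hp' : `|a p' - x0| < r by near: p'.
  have [s1' s2'] := hY _ _ (Ua p' Up') (Ut p' Up').
  have hb' : `|b p - b p'| <= e / (C + 1) by near: p'.
  have := hC (b p') (b p) (Y (a p') (t p')) (Y (a p) (t p)).
  move=> /(_ _ _ _ _ s1' s1) h.
  apply: le_trans (h _ _ _ _) _.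
  + by apply: lt_trans (nxt _ _ _ hp' (Ut _ Up')) _.
  + by apply: lt_trans (nxt _ _ _ hx (Ut _ Up)) _.
  + exact: close hp' s2'.
  + exact: close hx s2.
  apply: (@le_trans _ _ (C * (e / (C + 1)))); first by rewrite ler_wpM2l.
  rewrite mulrCA; apply: ler_piMr; first exact: ltW.
  by rewrite ler_pdivrMr // mul1r lerDl.
- by move=> p Up; have [] := hY _ _ (Ua p Up) (Ut p Up).
- move=> p Up; have [x0 Kx0 hx] := Ua p Up.
  have [s1 s2] := hY _ _ (Ua p Up) (Ut p Up).
  have [_ /(_ (b p) (Y (a p) (t p)))] := Prho _ Kx0.
  case=> //; [exact: lt_trans (nxt _ _ _ hx (Ut _ Up)) _|exact: close hx s2].
Unshelve. all: by end_near. Qed.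

End NearIdentity.

(** * Difference quotients of a mixed polynomial *)

Section ComplexParts.
Variable R : realType.
Implicit Types x y : R[i].

Lemma cReD x y : complex.Re (x + y) = complex.Re x + complex.Re y.
Proof. by case: x; case: y. Qed.
Lemma cImD x y : complex.Im (x + y) = complex.Im x + complex.Im y.
Proof. by case: x; case: y. Qed.
Lemma cReN x : complex.Re (- x) = - complex.Re x. Proof. by case: x. Qed.
Lemma cImN x : complex.Im (- x) = - complex.Im x. Proof. by case: x. Qed.
Lemma cReM x y : complex.Re (x * y) =
  complex.Re x * complex.Re y - complex.Im x * complex.Im y.
Proof. by case: x; case: y. Qed.
Lemma cImM x y : complex.Im (x * y) =
  complex.Re x * complex.Im y + complex.Im x * complex.Re y.
Proof. by case: x; case: y. Qed.
Lemma cReconj x : complex.Re (conjc x) = complex.Re x. Proof. by case: x. Qed.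
Lemma cImconj x : complex.Im (conjc x) = - complex.Im x. Proof. by case: x. Qed.

Lemma complex_ext x y :
  complex.Re x = complex.Re y -> complex.Im x = complex.Im y -> x = y.
Proof. by case: x; case: y => /= ? ? ? ? -> ->. Qed.

Definition ReImE := (cReD, cImD, cReN, cImN, cReM, cImM, cReconj, cImconj).

End ComplexParts.

Lemma mpoly_gen_ind (K : comNzRingType) n (P : mpoly n K -> Prop) :
  (forall c, P (mpolyC n c)) -> (forall i, P (mpolyX K (mnm1 i))) ->
  (forall p q, P p -> P q -> P (p + q)) ->
  (forall p q, P p -> P q -> P (p * q)) -> forall p, P p.
Proof.
move=> PC PX PD PM p; rewrite (mpolyE p).
apply: (big_ind P) => // [|m _]; first by rewrite -mpolyC0.
rewrite -mul_mpolyC; apply: (PM) => //; rewrite mpolyXE_id.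
have P1 : P 1 by rewrite -mpolyC1.
apply: (big_ind P) => // i _.
by elim: (m i) => [|k IH]; rewrite ?expr0 // exprS; apply: PM.
Qed.

Section ComplexPolyfun.
Variables (R : realType) (T : Type) (C : set (T -> R)).

Definition cpolyfun (F : T -> R[i]) :=
  polyfun C (fun x => complex.Re (F x)) /\ polyfun C (fun x => complex.Im (F x)).

Lemma cpolyfun_cst c : cpolyfun (fun=> c).
Proof. by split; exact: polyfun_cst. Qed.

Lemma cpolyfun_add F G :
  cpolyfun F -> cpolyfun G -> cpolyfun (fun x => F x + G x).
Proof.
move=> [F1 F2] [G1 G2]; split.
  rewrite (_ : (fun _ => _) = fun x => complex.Re (F x) + complex.Re (G x)).
    exact: polyfun_add.
  by apply/funext => x; rewrite cReD.
rewrite (_ : (fun _ => _) = fun x => complex.Im (F x) + complex.Im (G x)).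
  exact: polyfun_add.
by apply/funext => x; rewrite cImD.
Qed.

Lemma cpolyfun_mul F G :
  cpolyfun F -> cpolyfun G -> cpolyfun (fun x => F x * G x).
Proof.
move=> [F1 F2] [G1 G2]; split.
  rewrite (_ : (fun _ => _) = fun x => complex.Re (F x) * complex.Re (G x)
      - complex.Im (F x) * complex.Im (G x)).
    by apply: polyfun_sub; exact: polyfun_mul.
  by apply/funext => x; rewrite cReM.
rewrite (_ : (fun _ => _) = fun x => complex.Re (F x) * complex.Im (G x)
    + complex.Im (F x) * complex.Re (G x)).
  by apply: polyfun_add; exact: polyfun_mul.
by apply/funext => x; rewrite cImM.
Qed.

Lemma cpolyfun_conj F : cpolyfun F -> cpolyfun (fun x => conjc (F x)).
Proof.
move=> [F1 F2]; split.
  rewrite (_ : (fun _ => _) = fun x => complex.Re (F x)) //.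
  by apply/funext => x; rewrite cReconj.
rewrite (_ : (fun _ => _) = fun x => - complex.Im (F x)).
  exact: polyfun_opp.
by apply/funext => x; rewrite cImconj.
Qed.

End ComplexPolyfun.

Section MixedSlopes.
Variable R : realType.
Implicit Types (f : mixed R) (x y : 'rV[R]_4).

(** The values of the four formal variables of a mixed polynomial. *)
Definition zeta (z : R[i] * R[i]) : 'I_4 -> R[i] :=
  tnth [tuple z.1; z.2; conjc z.1; conjc z.2].

Definition evalR f x : R[i] := mixed_eval f (toC2 x).

Lemma cpolyfun_zeta (T : Type) (C : set (T -> R)) (h : T -> 'rV[R]_4) i :
  (forall j, polyfun C (fun t => h t 0 j)) ->
  cpolyfun C (fun t => zeta (toC2 (h t)) i).
Proof.
move=> hC.
have hu : cpolyfun C (fun t => (toC2 (h t)).1) by split; exact: hC.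
have hv : cpolyfun C (fun t => (toC2 (h t)).2) by split; exact: hC.
by case: i => [[|[|[|[|//]]]] lt4];
  [exact: hu|exact: hv|exact: (cpolyfun_conj hu)|exact: (cpolyfun_conj hv)].
Qed.

Lemma cpolyfun_evalR (T : Type) (C : set (T -> R)) (h : T -> 'rV[R]_4) f :
  (forall j, polyfun C (fun t => h t 0 j)) -> cpolyfun C (fun t => evalR f (h t)).
Proof.
move=> hC; rewrite /evalR /mixed_eval.
elim/mpoly_gen_ind: f => [c|i|f g IF IG|f g IF IG].
- have -> : (fun t => meval (zeta (toC2 (h t))) (mpolyC 4 c)) = fun=> c.
    by apply/funext => t; rewrite mevalC.
  exact: cpolyfun_cst.
- have -> : (fun t => meval (zeta (toC2 (h t))) (mpolyX R[i] (mnm1 i))) =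
      fun t => zeta (toC2 (h t)) i.
    by apply/funext => t; rewrite mevalXU.
  exact: cpolyfun_zeta.
- have -> : (fun t => meval (zeta (toC2 (h t))) (f + g)) = fun t =>
      meval (zeta (toC2 (h t))) f + meval (zeta (toC2 (h t))) g.
    by apply/funext => t; rewrite mevalD.
  exact: cpolyfun_add.
- have -> : (fun t => meval (zeta (toC2 (h t))) (f * g)) = fun t =>
      meval (zeta (toC2 (h t))) f * meval (zeta (toC2 (h t))) g.
    by apply/funext => t; rewrite mevalM.
  exact: cpolyfun_mul.
Qed.

Let p1 (T := ('rV[R]_4 * 'rV[R]_4)%type) j :
  polyfun (@coords2 R 4) (fun t => t.1 0 j).
Proof. by apply: polyfun_gen; exists j; left. Qed.
Let p2 (T := ('rV[R]_4 * 'rV[R]_4)%type) j :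
  polyfun (@coords2 R 4) (fun t => t.2 0 j).
Proof. by apply: polyfun_gen; exists j; right. Qed.

(** The four variables are treated as independent; the product rule then gives
polynomial slopes whose diagonal values are the Wirtinger derivatives. *)
Lemma mixed_slopes f : exists B : 'I_4 -> 'rV[R]_4 * 'rV[R]_4 -> R[i],
  [/\ forall i, cpolyfun (@coords2 R 4) (B i),
      forall x y, evalR f y - evalR f x =
        \sum_i (zeta (toC2 y) i - zeta (toC2 x) i) * B i (x, y) &
      forall i x, B i (x, x) = evalR (wirtinger i f) x].
Proof.
rewrite /evalR /mixed_eval /wirtinger.
elim/mpoly_gen_ind: f => [c|j|f g|f g].
- exists (fun _ _ => 0); split => [i|x y|i x]; first exact: cpolyfun_cst.
    by rewrite !mevalC subrr big1 // => i _; rewrite mulr0.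
  by rewrite mderivC meval0.
- exists (fun i _ => (i == j)%:R); split => [i|x y|i x]; first exact: cpolyfun_cst.
    rewrite !mevalXU.
    change (zeta (toC2 y) j - zeta (toC2 x) j = 
      \sum_i (zeta (toC2 y) i - zeta (toC2 x) i) * (i == j)%:R).
    move: (zeta (toC2 y)) (zeta (toC2 x)) => a b.
    rewrite (bigD1 j) //= eqxx mulr1 big1 ?addr0 // => i /negbTE ->.
    by rewrite mulr0.
  rewrite mderivX mevalZ mnmE eq_sym.
  have [->|_] := eqVneq j i; last by rewrite mul0r.
  rewrite mul1r (_ : mnm_sub _ _ = mnm0) ?mpolyX0 ?meval1 //.
  by apply/mnmP => k; rewrite mnmBE mnm0E subnn.
- move=> [A [hA eA dA]] [B [hB eB dB]].
  exists (fun i z => A i z + B i z); split => [i|x y|i x].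
  + exact: cpolyfun_add.
  + rewrite !mevalD opprD addrACA eA eB -big_split; apply: eq_bigr => i _ /=.
    by rewrite mulrDr.
  + by rewrite mderivD mevalD dA dB.
- move=> [A [hA eA dA]] [B [hB eB dB]].
  exists (fun i z => A i z * evalR g z.2 + evalR f z.1 * B i z).
  split => [i|x y|i x].
  + apply: cpolyfun_add; apply: cpolyfun_mul => //; exact: cpolyfun_evalR.
  + rewrite !mevalM.
    transitivity ((meval (zeta (toC2 y)) f - meval (zeta (toC2 x)) f)
      * evalR g y + evalR f x *
      (meval (zeta (toC2 y)) g - meval (zeta (toC2 x)) g)).
      by rewrite /evalR /mixed_eval -/(zeta _) -/(zeta _); ring.
    rewrite eA eB mulr_suml mulr_sumr -big_split; apply: eq_bigr => i _ /=.
    by ring.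
  + by rewrite mderivM mevalD !mevalM dA dB.
Qed.

End MixedSlopes.

(** * Homogeneity and the critical set *)

(** For [h] the conjugation and [lq] the exchange of variables with their
conjugates this is the evaluation rule of [mconj]. *)
Lemma meval_comp_map (K : comNzRingType) n (h : {rmorphism K -> K})
    (lq : n.-tuple (mpoly n K)) (v : 'I_n -> K) :
  (forall i, meval v (tnth lq i) = h (v i)) ->
  forall f, meval v (comp_mpoly lq (map_mpoly h f)) = h (meval v f).
Proof.
move=> hv; elim/mpoly_gen_ind => [c|i|f g IF IG|f g IF IG].
- by rewrite map_mpolyC comp_mpolyC !mevalC.
- by rewrite map_mpolyX comp_mpolyXU mevalXU -tnth_nth hv.
- by rewrite !rmorphD /= IF IG.
- by rewrite !rmorphM /= IF IG.
Qed.

Section Homogeneous.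
Variable R : realType.
Implicit Types (f g : mixed R) (x y : 'rV[R]_4) (t : R).

Definition radially_homogeneous (P : nat * nat) (d : nat) f :=
  forall m, m \in msupp f -> rdeg P m = d.

(** The radial action on C^2; [rscale] is the same action in real coordinates,
with weights [wt]. *)
Definition cscale (P : nat * nat) t (z : R[i] * R[i]) : R[i] * R[i] :=
  ((t ^+ P.1)%:C * z.1, (t ^+ P.2)%:C * z.2)%C.

Definition wt (P : nat * nat) (i : 'I_4) : nat := if (i < 2)%N then P.1 else P.2.

Definition rscale (P : nat * nat) t x : 'rV[R]_4 :=
  \row_i (t ^+ wt P i * x 0 i).

Lemma toC2_rscale P t x : toC2 (rscale P t x) = cscale P t (toC2 x).
Proof.
by rewrite /toC2 /rscale /cscale /=; congr (_, _); apply: complex_ext;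
  rewrite ?ReImE /= !mxE /= mul0r ?subr0 ?addr0.
Qed.

Lemma conj_real_mul (a : R) (w : R[i]) : (conjc (a%:C * w) = a%:C * conjc w)%C.
Proof. by apply: complex_ext; rewrite !ReImE /= ?ReImE; ring. Qed.

Lemma big_ord4 (S : Type) (idx : S) (op : Monoid.law idx) (F : 'I_4 -> S) :
  \big[op/idx]_(i < 4) F i = op (F iu) (op (F iv) (op (F iub) (F ivb))).
Proof.
rewrite !big_ord_recl big_ord0 Monoid.mulm1.
have e (i j : 'I_4) : val i = val j -> F i = F j by move=> /val_inj ->.
congr (op _ (op _ (op _ _))). all: by apply: e; exact: erefl.
Qed.

Lemma mixed_eval_cscale P d f t z : radially_homogeneous P d f ->
  mixed_eval f (cscale P t z) = ((t ^+ d)%:C * mixed_eval f z)%C.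
Proof.
move=> hf; rewrite /mixed_eval !mevalE mulr_sumr.
rewrite big_seq [RHS]big_seq; apply: eq_bigr => m hm.
rewrite mulrCA; congr (_ * _).
rewrite !big_ord4 /= /tnth /= !conj_real_mul !exprMn -(hf m hm) /rdeg.
have e (k l : nat) : (((t ^+ k)%:C) ^+ l = (t ^+ (k * l))%:C :> R[i])%C.
  by rewrite exprM [RHS]rmorphXn.
rewrite !e !mulnDr !exprD !rmorphM /=; ring.
Qed.

Lemma mixed_evalB f g z : mixed_eval (f - g) z = mixed_eval f z - mixed_eval g z.
Proof. exact: mevalB. Qed.
Lemma mixed_evalM f g z : mixed_eval (f * g) z = mixed_eval f z * mixed_eval g z.
Proof. exact: mevalM. Qed.

Lemma mixed_eval_mconj f z : mixed_eval (mconj f) z = conjc (mixed_eval f z).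
Proof.
rewrite /mixed_eval /mconj.
apply: (@meval_comp_map _ _ (@conjc R)) => i.
by case: i => [[|[|[|[|//]]]] lt4]; rewrite /mixedX mevalXU /tnth //= ?conjcK.
Qed.

Lemma mixed_eval_crit1 (a b c d : mixed R) z :
  mixed_eval (a * mconj d - mconj b * c) z =
  mixed_eval a z * conjc (mixed_eval d z) - conjc (mixed_eval b z) * mixed_eval c z.
Proof.
rewrite -(mixed_eval_mconj d) -(mixed_eval_mconj b).
by move: (mconj d) (mconj b) => d' b'; rewrite mixed_evalB !mixed_evalM.
Qed.

Lemma mixed_eval_crit2 (a b : mixed R) z :
  mixed_eval (a * mconj a - b * mconj b) z =
  mixed_eval a z * conjc (mixed_eval a z) - mixed_eval b z * conjc (mixed_eval b z).
Proof.
rewrite -(mixed_eval_mconj a) -(mixed_eval_mconj b).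
by move: (mconj a) (mconj b) => a' b'; rewrite mixed_evalB !mixed_evalM.
Qed.

(** The equations s1 = s2 = s3 = 0 as a condition on the values of the Wirtinger
derivatives.  Handling values instead of polynomials keeps [mconj] out of the
computations. *)
Definition crit_eqs (g : 'I_4 -> R[i]) : Prop :=
  [/\ g iu * conjc (g ivb) = conjc (g iub) * g iv,
      g iu * conjc (g iu) = g iub * conjc (g iub) &
      g iv * conjc (g iv) = g ivb * conjc (g ivb)].

Lemma critP f z : crit f z <-> crit_eqs (fun i => mixed_eval (wirtinger i f) z).
Proof.
rewrite /crit_eqs /crit /zeros /= /crit_s1 /crit_s2 /crit_s3.
move: (wirtinger iu f) (wirtinger iub f) (wirtinger iv f) (wirtinger ivb f).
move=> a b c d.
have E1 := mixed_eval_crit1 a b c d z.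
have E2 := mixed_eval_crit2 a b z.
have E3 := mixed_eval_crit2 c d z.
split=> [[[h1 h2] h3]|[h1 h2 h3]].
  split; first exact: subr0_eq (etrans (esym E1) h1).
    exact: subr0_eq (etrans (esym E2) h2).
  exact: subr0_eq (etrans (esym E3) h3).
split; first split.
- by apply: (etrans E1); apply/eqP; rewrite subr_eq0; apply/eqP.
- by apply: (etrans E2); apply/eqP; rewrite subr_eq0; apply/eqP.
- by apply: (etrans E3); apply/eqP; rewrite subr_eq0; apply/eqP.
Qed.

Definition dot n (u v : 'rV[R]_n) : R := \sum_i u 0 i * v 0 i.

(** The partial derivatives along Re u, Im u, Re v, Im v when [a], [b], [c], [d]
are the derivatives along u, ubar, v, vbar. *)
Definition real_partials (a b c d : R[i]) : 'I_4 -> R[i] :=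
  tnth [tuple a + b; 'i%C * (a - b); c + d; 'i%C * (c - d)].

Lemma zeta_sub x y i : zeta (toC2 y) i - zeta (toC2 x) i = zeta (toC2 (y - x)) i.
Proof.
by case: i => [[|[|[|[|//]]]] lt4]; rewrite /zeta /tnth /toC2 /=;
  apply: complex_ext; rewrite ?ReImE /= !mxE //; ring.
Qed.

Lemma real_partials_sum x (a b c d : R[i]) :
  let p := real_partials a b c d in
  zeta (toC2 x) iu * a + (zeta (toC2 x) iv * c +
    (zeta (toC2 x) iub * b + zeta (toC2 x) ivb * d)) =
  ((x 0 iu * complex.Re (p iu) + (x 0 iv * complex.Re (p iv) +
    (x 0 iub * complex.Re (p iub) + x 0 ivb * complex.Re (p ivb)))) +i*
   (x 0 iu * complex.Im (p iu) + (x 0 iv * complex.Im (p iv) +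
    (x 0 iub * complex.Im (p iub) + x 0 ivb * complex.Im (p ivb)))))%C.
Proof.
rewrite /zeta /toC2 /real_partials /tnth /= -/iu -/iv -/iub -/ivb.
move: (x 0 iu) (x 0 iv) (x 0 iub) (x 0 ivb) => x0 x1 x2 x3.
case: a b c d => [a1 a2] [b1 b2] [c1 c2] [d1 d2].
by apply: complex_ext; rewrite !ReImE /=; ring.
Qed.

(** The slopes of [mixed_slopes] in real coordinates, made symmetric in the two
points by averaging.  The symmetry is what makes the motion along spheres
reversible in time. *)
Lemma real_slopes f : exists A1 A2 : 'rV[R]_4 * 'rV[R]_4 -> 'rV[R]_4,
  [/\ forall i, polyfun (@coords2 R 4) (fun z => A1 z 0 i) /\
                polyfun (@coords2 R 4) (fun z => A2 z 0 i),
      forall x y, A1 (x, y) = A1 (y, x) /\ A2 (x, y) = A2 (y, x),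
      forall x y, evalR f y - evalR f x =
        (dot (y - x) (A1 (x, y)) +i* dot (y - x) (A2 (x, y)))%C &
      forall x i, (A1 (x, x) 0 i +i* A2 (x, x) 0 i)%C =
        real_partials (evalR (wirtinger iu f) x) (evalR (wirtinger iub f) x)
          (evalR (wirtinger iv f) x) (evalR (wirtinger ivb f) x) i].
Proof.
have [B [hB eB dB]] := mixed_slopes f.
pose B' i (z : 'rV[R]_4 * 'rV[R]_4) := (B i z + B i (z.2, z.1)) / 2.
have hB' i : cpolyfun (@coords2 R 4) (B' i).
  have hs : cpolyfun (@coords2 R 4) (fun z => B i (z.2, z.1)).
    have [h1 h2] := hB i; split.
      apply: (polyfun_subst (h := fun z => (z.2, z.1)) _ h1) => _ [j [->|->]];
        apply: polyfun_gen; exists j; by [right|left].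
    apply: (polyfun_subst (h := fun z => (z.2, z.1)) _ h2) => _ [j [->|->]];
      apply: polyfun_gen; exists j; by [right|left].
  apply: cpolyfun_mul; last exact: cpolyfun_cst.
  exact: cpolyfun_add.
have sB' i x y : B' i (x, y) = B' i (y, x) by rewrite /B' /= addrC.
have eB' x y : evalR f y - evalR f x =
    \sum_i (zeta (toC2 y) i - zeta (toC2 x) i) * B' i (x, y).
  have e2 : evalR f y - evalR f x =
      ((evalR f y - evalR f x) - (evalR f x - evalR f y)) / 2 by field.
  rewrite e2 (eB x y) (eB y x) -sumrB mulr_suml; apply: eq_bigr => i _.
  by rewrite /B' /=; ring.
have dB' i x : B' i (x, x) = evalR (wirtinger i f) x.
  by rewrite /B' /= dB; field.
pose c z := real_partials (B' iu z) (B' iub z) (B' iv z) (B' ivb z).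
have hc i : cpolyfun (@coords2 R 4) (c^~ i).
  have hm (G : 'rV[R]_4 * 'rV[R]_4 -> R[i]) : cpolyfun (@coords2 R 4) G ->
      cpolyfun (@coords2 R 4) (fun z => - G z).
    move=> hg.
    have -> : (fun z => - G z) = fun z => (-1) * G z.
      by apply/funext => z; rewrite mulN1r.
    by apply: cpolyfun_mul => //; exact: cpolyfun_cst.
  by case: i => [[|[|[|[|//]]]] lt4]; rewrite /c /real_partials /tnth /=;
    do ?[apply: cpolyfun_mul; first exact: cpolyfun_cst];
    apply: cpolyfun_add => //; exact: hm.
exists (fun z => \row_i complex.Re (c z i)), (fun z => \row_i complex.Im (c z i)).
split=> [i|x y|x y|x i].
- have [h1 h2] := hc i; split.
    have -> : (fun z => (\row_i complex.Re (c z i)) 0 i) = fun z => complex.Re (c z i).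
      by apply/funext => z; rewrite mxE.
    exact: h1.
  have -> : (fun z => (\row_i complex.Im (c z i)) 0 i) = fun z => complex.Im (c z i).
    by apply/funext => z; rewrite mxE.
  exact: h2.
- by split; apply/rowP => i; rewrite !mxE /c !(sB' _ x y).
- rewrite eB' /dot !big_ord4 /= !zeta_sub real_partials_sum.
  by rewrite !mxE.
- by rewrite !mxE /c !dB'; case: (real_partials _ _ _ _ i).
Qed.

(** Lagrange's identity: the Gram determinant of the gradients of Re f and Im f is
the sum of the squares of the 2 x 2 minors of the Jacobian matrix of [f].  Up to
linear combinations s1, s2, s3 are among these minors. *)
Lemma gram_eq0 (a b c d : R[i]) :
  let g11 := \sum_i complex.Re (real_partials a b c d i) ^+ 2 in
  let g12 := \sum_i complex.Re (real_partials a b c d i) *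
                    complex.Im (real_partials a b c d i) in
  let g22 := \sum_i complex.Im (real_partials a b c d i) ^+ 2 in
  g11 * g22 - g12 ^+ 2 = 0 ->
  [/\ a * conjc d = conjc b * c, a * conjc a = b * conjc b &
      c * conjc c = d * conjc d].
Proof.
rewrite /= !big_ord4 /real_partials /tnth /= !ReImE /=.
case: a b c d => [a1 a2] [b1 b2] [c1 c2] [d1 d2] /=.
set G := (X in X = 0 -> _).
pose m01 := (a1 ^+ 2 + a2 ^+ 2) - (b1 ^+ 2 + b2 ^+ 2).
pose m23 := (c1 ^+ 2 + c2 ^+ 2) - (d1 ^+ 2 + d2 ^+ 2).
pose m02 := (a1 + b1) * (c2 + d2) - (a2 + b2) * (c1 + d1).
pose m03 := (a1 + b1) * (c1 - d1) + (a2 + b2) * (c2 - d2).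
pose m12 := - (a2 - b2) * (c2 + d2) - (a1 - b1) * (c1 + d1).
pose m13 := - (a2 - b2) * (c1 - d1) + (a1 - b1) * (c2 - d2).
have -> : G = m01 ^+ 2 + (m23 ^+ 2 + (m02 ^+ 2 + (m03 ^+ 2 + (m12 ^+ 2 + m13 ^+ 2)))).
  by rewrite /G /m01 /m23 /m02 /m03 /m12 /m13; ring.
have h (u v : R) : 0 <= u -> 0 <= v -> u + v = 0 -> u = 0 /\ v = 0.
  by move=> u0 v0 /eqP; rewrite paddr_eq0 // => /andP[/eqP ? /eqP ?].
case/h => [||/eqP + ]; rewrite ?sqr_ge0 ?addr_ge0 ?sqr_ge0 //.
rewrite sqrf_eq0 => /eqP z01.
case/h => [||/eqP + ]; rewrite ?sqr_ge0 ?addr_ge0 ?sqr_ge0 //.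
rewrite sqrf_eq0 => /eqP z23.
case/h => [||/eqP + ]; rewrite ?sqr_ge0 ?addr_ge0 ?sqr_ge0 //.
rewrite sqrf_eq0 => /eqP z02.
case/h => [||/eqP + ]; rewrite ?sqr_ge0 ?addr_ge0 ?sqr_ge0 //.
rewrite sqrf_eq0 => /eqP z03.
case/h => [||/eqP + /eqP]; rewrite ?sqr_ge0 //.
rewrite !sqrf_eq0 => /eqP z12 /eqP z13.
by split; apply: complex_ext; rewrite !ReImE /=;
  move: z01 z23 z02 z03 z12 z13; rewrite /m01 /m23 /m02 /m03 /m12 /m13; lra.
Qed.

Lemma polyfun_exp (T : Type) (C : set (T -> R)) (F : T -> R) k :
  polyfun C F -> polyfun C (fun p => F p ^+ k).
Proof.
move=> hF; elim: k => [|k IH]; first exact: polyfun_cst.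
have -> : (fun p => F p ^+ k.+1) = fun p => F p * F p ^+ k.
  by apply/funext => p; rewrite exprS.
exact: polyfun_mul.
Qed.

Definition euler_field (P : nat * nat) x : 'rV[R]_4 := \row_i ((wt P i)%:R * x 0 i).

(** Euler's identity by division: for t = 1 + h the slope identity from x to t.x
and the expansion of t^d - 1 are both divisible by h, and the quotients agree
at h = 0 by continuity. *)
Lemma euler_slopes P d (F : 'rV[R]_4 -> R) (A : 'rV[R]_4 * 'rV[R]_4 -> 'rV[R]_4) x :
  (forall i, polyfun (@coords2 R 4) (fun z => A z 0 i)) ->
  (forall y, F y - F x = dot (y - x) (A (x, y))) ->
  (forall t, F (rscale P t x) = t ^+ d * F x) ->
  dot (euler_field P x) (A (x, x)) = d%:R * F x.
Proof.
move=> hA eA hF.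
pose C : set (R -> R) := [set id].
(* the difference of the two expressions of F(t.x) - F(x), divided by [h] *)
pose D h := \sum_i (\sum_(j < wt P i) (1 + h) ^+ j) * x 0 i *
    A (x, rscale P (1 + h) x) 0 i - (\sum_(j < d) (1 + h) ^+ j) * F x.
have h1 : polyfun C (fun h => 1 + h).
  by apply: polyfun_add; [exact: polyfun_cst|exact: polyfun_gen].
have hD : polyfun C D.
  apply: polyfun_sub.
    apply: polyfun_sum => i; apply: polyfun_mul; last first.
      apply: (polyfun_subst (h := fun h => (x, rscale P (1 + h) x)) _ (hA i)).
      move=> _ [j [->|->]]; first exact: polyfun_cst.
      have -> : (fun z : 'rV[R]_4 * 'rV[R]_4 => z.2 0 j) \o (fun h => (x, rscale P (1 + h) x))
          = fun h => (1 + h) ^+ wt P j * x 0 j.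
        by apply/funext => h; rewrite /= mxE.
      by apply: polyfun_mul; [exact: polyfun_exp|exact: polyfun_cst].
    apply: polyfun_mul; last exact: polyfun_cst.
    by apply: polyfun_sum => j; exact: polyfun_exp.
  apply: polyfun_mul; last exact: polyfun_cst.
  by apply: polyfun_sum => j; exact: polyfun_exp.
have D0 : D 0 = 0.
  apply: continuous_zero => [|h h0].
    apply: polyfun_continuous hD => g /= ->; exact: cvg_id.
  apply: (mulfI h0); rewrite mulr0 /D mulrBr mulrA.
  have e k : h * \sum_(j < k) (1 + h) ^+ j = (1 + h) ^+ k - 1.
    by rewrite subrX1 [1 + h]addrC addrK.
  rewrite e mulrBl mul1r -hF eA /dot mulr_sumr -sumrB big1 // => i _.
  by rewrite !mulrA e !mxE; ring.
move: D0; rewrite /D addr0 => /eqP; rewrite subr_eq0 => /eqP.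
have r1 : rscale P 1 x = x by apply/rowP => i; rewrite mxE expr1n mul1r.
have s1 k : \sum_(j < k) (1 : R) ^+ j = k%:R.
  under eq_bigr do rewrite expr1n.
  by rewrite sumr_const card_ord.
rewrite r1 s1 => <-; apply: eq_bigr => i _.
by rewrite s1 mxE.
Qed.

Lemma euler_evalR P d f (A1 A2 : 'rV[R]_4 * 'rV[R]_4 -> 'rV[R]_4) x :
  (forall i, polyfun (@coords2 R 4) (fun z => A1 z 0 i) /\
             polyfun (@coords2 R 4) (fun z => A2 z 0 i)) ->
  (forall x y, evalR f y - evalR f x =
     (dot (y - x) (A1 (x, y)) +i* dot (y - x) (A2 (x, y)))%C) ->
  radially_homogeneous P d f ->
  dot (euler_field P x) (A1 (x, x)) = d%:R * complex.Re (evalR f x) /\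
  dot (euler_field P x) (A2 (x, x)) = d%:R * complex.Im (evalR f x).
Proof.
move=> hA eA fP.
have es t : evalR f (rscale P t x) = ((t ^+ d)%:C * evalR f x)%C.
  by rewrite /evalR toC2_rscale (mixed_eval_cscale _ _ fP).
split.
  apply: (@euler_slopes P d (fun y => complex.Re (evalR f y)) A1 x).
  - by move=> i; have [] := hA i.
  - by move=> y; have /(congr1 (@complex.Re R)) := eA x y; rewrite /= cReD cReN => ->.
  - by move=> t; rewrite es cReM /= mul0r subr0.
apply: (@euler_slopes P d (fun y => complex.Im (evalR f y)) A2 x).
- by move=> i; have [] := hA i.
- by move=> y; have /(congr1 (@complex.Im R)) := eA x y; rewrite /= cImD cImN => ->.
- by move=> t; rewrite es cImM /= mul0r addr0.
Qed.

End Homogeneous.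

(** * The discrete Milnor vector field *)

Section Dot.
Variables (R : realType) (n : nat).
Implicit Types u v w : 'rV[R]_n.

Lemma dotC u v : dot u v = dot v u.
Proof. by apply: eq_bigr => i _; rewrite mulrC. Qed.
Lemma dotDl u v w : dot (u + v) w = dot u w + dot v w.
Proof. by rewrite /dot -big_split; apply: eq_bigr => i _; rewrite mxE mulrDl. Qed.
Lemma dotZl a u w : dot (a *: u) w = a * dot u w.
Proof. by rewrite /dot mulr_sumr; apply: eq_bigr => i _; rewrite mxE mulrA. Qed.
Lemma dotNl u w : dot (- u) w = - dot u w.
Proof. by rewrite -scaleN1r dotZl mulN1r. Qed.
Lemma dotBl u v w : dot (u - v) w = dot u w - dot v w.
Proof. by rewrite dotDl dotNl. Qed.
Lemma dotDr u v w : dot w (u + v) = dot w u + dot w v.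
Proof. by rewrite dotC dotDl !(dotC w). Qed.
Lemma dotZr a u w : dot w (a *: u) = a * dot w u.
Proof. by rewrite dotC dotZl (dotC w). Qed.
Lemma dotBr u v w : dot w (u - v) = dot w u - dot w v.
Proof. by rewrite dotC dotBl !(dotC w). Qed.

Lemma dotNr u w : dot w (- u) = - dot w u.
Proof. by rewrite dotC dotNl (dotC w). Qed.

Definition dotE := (dotDl, dotDr, dotNl, dotNr, dotZl, dotZr).

Lemma polyfun_dot (T : Type) (C : set (T -> R)) (F G : T -> 'rV[R]_n) :
  (forall i, polyfun C (fun t => F t 0 i)) ->
  (forall i, polyfun C (fun t => G t 0 i)) ->
  polyfun C (fun t => dot (F t) (G t)).
Proof. by move=> hF hG; apply: polyfun_sum => i; exact: polyfun_mul. Qed.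

End Dot.

Section Field.
Variables (R : realType) (f : mixed R) (P : nat * nat) (d : nat).
Variables (A1 A2 : 'rV[R]_4 * 'rV[R]_4 -> 'rV[R]_4).
Implicit Types (x y : 'rV[R]_4) (t : R).

Hypothesis hA : forall i, polyfun (@coords2 R 4) (fun z => A1 z 0 i) /\
                          polyfun (@coords2 R 4) (fun z => A2 z 0 i).
Hypothesis sA : forall x y, A1 (x, y) = A1 (y, x) /\ A2 (x, y) = A2 (y, x).
Hypothesis eA : forall x y, evalR f y - evalR f x =
  (dot (y - x) (A1 (x, y)) +i* dot (y - x) (A2 (x, y)))%C.

Let F1 x := complex.Re (evalR f x).
Let F2 x := complex.Im (evalR f x).

Let eA1 x y : dot (y - x) (A1 (x, y)) = F1 y - F1 x.
Proof. by have /(congr1 (@complex.Re R)) := eA x y; rewrite /= cReD cReN => <-. Qed.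
Let eA2 x y : dot (y - x) (A2 (x, y)) = F2 y - F2 x.
Proof. by have /(congr1 (@complex.Im R)) := eA x y; rewrite /= cImD cImN => <-. Qed.

(** Not zero exactly where the two real slope vectors are independent; on the diagonal
this means that the point is not critical. *)
Definition gram x y : R :=
  dot (A1 (x, y)) (A1 (x, y)) * dot (A2 (x, y)) (A2 (x, y)) -
  dot (A1 (x, y)) (A2 (x, y)) ^+ 2.

(** The combination of A1 and A2 whose products with A1 and A2 are s1 and s2 times
the Gram determinant.  The factor avoids a division and keeps all the ingredients
polynomial. *)
Definition lift_slopes x y (s1 s2 : R) : 'rV[R]_4 :=
  (dot (A2 (x, y)) (A2 (x, y)) * s1 - dot (A1 (x, y)) (A2 (x, y)) * s2)
    *: A1 (x, y) +
  (dot (A1 (x, y)) (A1 (x, y)) * s2 - dot (A1 (x, y)) (A2 (x, y)) * s1)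
    *: A2 (x, y).

Lemma dot_lift1 x y s1 s2 : dot (A1 (x, y)) (lift_slopes x y s1 s2) = gram x y * s1.
Proof. by rewrite /lift_slopes /gram !dotE; ring. Qed.
Lemma dot_lift2 x y s1 s2 : dot (A2 (x, y)) (lift_slopes x y s1 s2) = gram x y * s2.
Proof. by rewrite /lift_slopes /gram !dotE (dotC (A2 _) (A1 _)); ring. Qed.

(** Its slopes are those of i (f(x) + f(y)): a step along it turns the value of [f]. *)
Definition rotating x y := lift_slopes x y (- (F2 x + F2 y)) (F1 x + F1 y).

(** Real and imaginary parts of g = f(x) + f(y) + i t (f(x) - f(y)).  With this g,
f(y) - f(x) = t (i (f(x) + f(y)) + s g) is equivalent to
f(y) (1 - i t) (1 - t s) = f(x) (1 + i t) (1 + t s). *)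
Definition mean1 x y t := (F1 x + F1 y) - t * (F2 x - F2 y).
Definition mean2 x y t := (F2 x + F2 y) + t * (F1 x - F1 y).

(** Twice the mean of the Euler fields, the directions in which the radial action
moves the two points. *)
Definition radial x y := euler_field P x + euler_field P y.

(** The radial direction, corrected so that its slopes are exactly those of d g.  The
correction vanishes for x = y and t = 0, by Euler's identity. *)
Definition correction x y t := gram x y *: radial x y +
  lift_slopes x y (d%:R * mean1 x y t - dot (A1 (x, y)) (radial x y))
                  (d%:R * mean2 x y t - dot (A2 (x, y)) (radial x y)).

Definition cor_dot x y t := dot (x + y) (correction x y t).
Definition rot_dot x y := dot (x + y) (rotating x y).

(** [rotating] made orthogonal to x + y by a multiple of [correction].  Since
<x + y, y - x> = |y|^2 - |x|^2, a step along it stays on the sphere; the multiple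
of [correction] changes the value of [f] by a positive factor only. *)
Definition field_num x y t : 'rV[R]_4 :=
  cor_dot x y t *: rotating x y - rot_dot x y *: correction x y t.
Definition field_den x y t : R := gram x y * cor_dot x y t.

Lemma dot_correction1 x y t :
  dot (A1 (x, y)) (correction x y t) = gram x y * (d%:R * mean1 x y t).
Proof. by rewrite /correction dotDr dot_lift1 dotZr; ring. Qed.
Lemma dot_correction2 x y t :
  dot (A2 (x, y)) (correction x y t) = gram x y * (d%:R * mean2 x y t).
Proof. by rewrite /correction dotDr dot_lift2 dotZr; ring. Qed.

(** The slopes, the sum of the Euler fields and g are unchanged when both ends are
exchanged and time is reversed. *)
Lemma field_sym x y t :
  field_num y x (- t) = field_num x y t /\ field_den y x (- t) = field_den x y t.
Proof.
have [s1 s2] := sA x y.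
have eg : gram y x = gram x y by rewrite /gram s1 s2.
have el a b : lift_slopes y x a b = lift_slopes x y a b.
  by rewrite /lift_slopes s1 s2.
have er : rotating y x = rotating x y.
  by rewrite /rotating el ![F2 y + _]addrC ![F1 y + _]addrC.
have ec : correction y x (- t) = correction x y t.
  have em1 : mean1 y x (- t) = mean1 x y t by rewrite /mean1; ring.
  have em2 : mean2 y x (- t) = mean2 x y t by rewrite /mean2; ring.
  by rewrite /correction eg el em1 em2 s1 s2 /radial [euler_field P y + _]addrC.
by rewrite /field_num /field_den /cor_dot /rot_dot er ec eg ![y + x]addrC.
Qed.

(** The coefficient s of g in f(y) - f(x) = t (i (f(x) + f(y)) + s g). *)
Definition slack x y t : R := - (rot_dot x y / cor_dot x y t) * d%:R.

Lemma field_step x y t : field_den x y t != 0 ->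
  field_den x y t *: (y - x) = t *: field_num x y t ->
  [/\ dot y y = dot x x,
      F1 y - F1 x = t * (- (F2 x + F2 y) + slack x y t * mean1 x y t) &
      F2 y - F2 x = t * ((F1 x + F1 y) + slack x y t * mean2 x y t)].
Proof.
move=> q0 e; have := q0; rewrite /field_den mulf_eq0 negb_or => /andP[g0 c0].
split.
- have : field_den x y t * dot (x + y) (y - x) = 0.
    rewrite -dotZr e dotZr /field_num dotBr !dotZr -/(cor_dot _ _ _) -/(rot_dot _ _).
    by ring.
  move=> /eqP; rewrite mulf_eq0 (negbTE q0) /= !dotE; rewrite (dotC y x) => /eqP h.
  by apply/eqP; rewrite -subr_eq0 -h; apply/eqP; ring.
- apply: (mulfI q0); rewrite -eA1 dotC -dotZr e dotZr /field_num dotBr !dotZr.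
  rewrite dot_correction1 dot_lift1 /slack /field_den.
  by field.
- apply: (mulfI q0); rewrite -eA2 dotC -dotZr e dotZr /field_num dotBr !dotZr.
  rewrite dot_correction2 dot_lift2 /slack /field_den.
  by field.
Qed.

(** The factorization that dictated the choice of g: the two values differ by the
rotation (1 + i t) / (1 - i t) and the real factor (1 + t s) / (1 - t s). *)
Lemma field_step_eval x y t : field_den x y t != 0 ->
  field_den x y t *: (y - x) = t *: field_num x y t ->
  (evalR f y * ((1 -i* t) * (1 - t * slack x y t)%:C) =
   evalR f x * ((1 +i* t) * (1 + t * slack x y t)%:C))%C.
Proof.
move=> q0 e; have [_ e1 e2] := field_step q0 e.
move: e1 e2; rewrite /mean1 /mean2; set s := slack x y t => e1 e2.
apply: complex_ext; rewrite !ReImE /= -/(F1 x) -/(F1 y) -/(F2 x) -/(F2 y); lra.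
Qed.

End Field.

Section PolyfunRow.
Variables (R : realType) (T : Type) (C : set (T -> R)) (n : nat).
Definition rpolyfun (F : T -> 'rV[R]_n) := forall i, polyfun C (fun t => F t 0 i).

Lemma rpolyfun_add F G : rpolyfun F -> rpolyfun G -> rpolyfun (fun t => F t + G t).
Proof.
move=> hF hG i; have -> : (fun t => (F t + G t) 0 i) = fun t => F t 0 i + G t 0 i.
  by apply/funext => t; rewrite mxE.
exact: polyfun_add.
Qed.

Lemma rpolyfun_scale (a : T -> R) F :
  polyfun C a -> rpolyfun F -> rpolyfun (fun t => a t *: F t).
Proof.
move=> ha hF i; have -> : (fun t => (a t *: F t) 0 i) = fun t => a t * F t 0 i.
  by apply/funext => t; rewrite mxE.
exact: polyfun_mul.
Qed.

Lemma rpolyfun_sub F G : rpolyfun F -> rpolyfun G -> rpolyfun (fun t => F t - G t).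
Proof.
move=> hF hG i; have -> : (fun t => (F t - G t) 0 i) = fun t => F t 0 i - G t 0 i.
  by apply/funext => t; rewrite !mxE.
exact: polyfun_sub.
Qed.
End PolyfunRow.

Section FieldPolyfun.
Variables (R : realType) (f : mixed R) (P : nat * nat) (d : nat).
Variables (A1 A2 : 'rV[R]_4 * 'rV[R]_4 -> 'rV[R]_4).
Hypothesis hA : forall i, polyfun (@coords2 R 4) (fun z => A1 z 0 i) /\
                          polyfun (@coords2 R 4) (fun z => A2 z 0 i).
Variables (T : Type) (C : set (T -> R)) (X Y : T -> 'rV[R]_4) (t : T -> R).
Hypothesis hX : rpolyfun C X.
Hypothesis hY : rpolyfun C Y.
Hypothesis ht : polyfun C t.

Let pA1 : rpolyfun C (fun z => A1 (X z, Y z)).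
Proof.
move=> i; have [h _] := hA i.
by apply: (polyfun_subst (h := fun z => (X z, Y z)) _ h) => _ [j [->|->]];
  [exact: hX|exact: hY].
Qed.

Let pA2 : rpolyfun C (fun z => A2 (X z, Y z)).
Proof.
move=> i; have [_ h] := hA i.
by apply: (polyfun_subst (h := fun z => (X z, Y z)) _ h) => _ [j [->|->]];
  [exact: hX|exact: hY].
Qed.

Let pF Z : rpolyfun C Z -> polyfun C (fun z => complex.Re (evalR f (Z z))) /\
  polyfun C (fun z => complex.Im (evalR f (Z z))).
Proof. exact: cpolyfun_evalR. Qed.

Let pE Z : rpolyfun C Z -> rpolyfun C (fun z => euler_field P (Z z)).
Proof.
move=> hZ i; have -> : (fun z => euler_field P (Z z) 0 i) =
    fun z => (wt P i)%:R * Z z 0 i by apply/funext => z; rewrite mxE.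
by apply: polyfun_mul; [exact: polyfun_cst|exact: hZ].
Qed.

Let pG : polyfun C (fun z => gram A1 A2 (X z) (Y z)).
Proof.
apply: polyfun_sub; first by apply: polyfun_mul; exact: polyfun_dot.
by apply: polyfun_exp; exact: polyfun_dot.
Qed.

Let pL s1 s2 : polyfun C s1 -> polyfun C s2 ->
  rpolyfun C (fun z => lift_slopes A1 A2 (X z) (Y z) (s1 z) (s2 z)).
Proof.
move=> h1 h2; apply: rpolyfun_add; apply: rpolyfun_scale => //;
  by apply: polyfun_sub; apply: polyfun_mul => //; exact: polyfun_dot.
Qed.

Let pRot : rpolyfun C (fun z => rotating f A1 A2 (X z) (Y z)).
Proof.
apply: pL; last by apply: polyfun_add; [have [] := pF hX|have [] := pF hY].
by apply: polyfun_opp; apply: polyfun_add; [have [] := pF hX|have [] := pF hY].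
Qed.

Let pCor : rpolyfun C (fun z => correction f P d A1 A2 (X z) (Y z) (t z)).
Proof.
have [x1 x2] := pF hX; have [y1 y2] := pF hY.
have pR : rpolyfun C (fun z => radial P (X z) (Y z)).
  by apply: rpolyfun_add; exact: pE.
apply: rpolyfun_add; first exact: rpolyfun_scale.
apply: pL; apply: polyfun_sub; try exact: polyfun_dot.
  apply: polyfun_mul; first exact: polyfun_cst.
  apply: polyfun_sub; first exact: polyfun_add.
  by apply: polyfun_mul => //; exact: polyfun_sub.
apply: polyfun_mul; first exact: polyfun_cst.
apply: polyfun_add; first exact: polyfun_add.
by apply: polyfun_mul => //; exact: polyfun_sub.
Qed.

Lemma polyfun_rot_dot : polyfun C (fun z => rot_dot f A1 A2 (X z) (Y z)).
Proof. by apply: polyfun_dot => //; apply: rpolyfun_add. Qed.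

Lemma polyfun_cor_dot :
  polyfun C (fun z => cor_dot f P d A1 A2 (X z) (Y z) (t z)).
Proof. by apply: polyfun_dot => //; apply: rpolyfun_add. Qed.

Lemma polyfun_field_den :
  polyfun C (fun z => field_den f P d A1 A2 (X z) (Y z) (t z)).
Proof. by apply: polyfun_mul => //; exact: polyfun_cor_dot. Qed.

Lemma polyfun_field_num :
  rpolyfun C (fun z => field_num f P d A1 A2 (X z) (Y z) (t z)).
Proof.
by apply: rpolyfun_sub; apply: rpolyfun_scale => //;
  [exact: polyfun_cor_dot|exact: polyfun_rot_dot].
Qed.

End FieldPolyfun.

(** * Rotating the argument of a mixed polynomial along spheres *)

Lemma euclidean_sphere_compact (R : realType) n (rho : R) :
  compact (@euclidean_sphere R n rho).
Proof.
have cF : continuous (fun x : 'rV[R]_n => \sum_i x 0 i ^+ 2).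
  move=> x; apply: (@polyfun1_continuous _ _ (fun x : 'rV[R]_n => \sum_i x 0 i ^+ 2)).
  by apply: polyfun_sum => i; apply: polyfun_exp; apply: polyfun_gen; exists i.
apply: bounded_closed_compact.
  exists `|rho|; split; first exact: num_real.
  move=> M rhoM x xS /=; apply: norm_rV_le => [|i].
    by rewrite (le_trans _ (ltW rhoM)).
  apply: le_trans (ltW rhoM).
  rewrite -ler_sqr ?nnegrE // !real_normK ?num_real //.
  rewrite -[leRHS]xS (bigD1 i) //= lerDl sumr_ge0 // => j _; exact: sqr_ge0.
rewrite (_ : euclidean_sphere _ = (fun x : 'rV[R]_n => \sum_i x 0 i ^+ 2) @^-1` [set rho ^+ 2]) //.
apply: closed_comp; first by move=> x _; exact: cF.
exact: closed_eq.
Qed.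

Section Rotation.
Variables (R : realType) (f : mixed R) (P : nat * nat) (d : nat).
Hypothesis P0 : positive_weight P.
Hypothesis fP : radially_homogeneous P d f.
Hypothesis f_reg : forall z, z != (0, 0) -> ~ crit f z.

(** For y = x and t = 0 the Gram determinant is not zero because [x] is not
critical, and <x + y, correction> is a positive multiple of it, namely
4 gram <x, E x> with E the Euler field.  So the denominator of the step is
invertible on the sphere.  The open condition [G] says that |t s| < 1, which makes
the real factor of [field_step_eval] positive. *)
Lemma rotation_family rho : 0 < rho ->
  let K := @euclidean_sphere R 4 rho in
  exists r (Y : 'rV[R]_4 -> R -> 'rV[R]_4), [/\ 0 < r,
    forall x t, K x -> `|t| < r -> K (Y x t),
    forall x t, K x -> `|t| < r -> exists2 s : R, 0 < s &
      (evalR f (Y x t) * (1 -i* t) = s%:C * (evalR f x * (1 +i* t)))%C,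
    forall x t, K x -> `|t| < r -> Y (Y x t) (- t) = x &
    forall (V : normedModType R) (U : set V) (a : V -> 'rV[R]_4) (t : V -> R),
      open U -> (forall k i, Ck_on k U (fun p => a p 0 i)) ->
      (forall k, Ck_on k U t) ->
      (forall p, U p -> exists2 x0, K x0 & `|a p - x0| < r) ->
      (forall p, U p -> `|t p| < r) ->
      forall k i, Ck_on k U (fun p => Y (a p) (t p) 0 i)].
Proof.
move=> rho0 K.
have [A1 [A2 [hA sA eA dA]]] := real_slopes f.
pose q z := field_den f P d A1 A2 (@xpart R 4 z) (ypart z) (tpart z).
pose N z := field_num f P d A1 A2 (@xpart R 4 z) (ypart z) (tpart z).
pose G z := (tpart z * (rot_dot f A1 A2 (@xpart R 4 z) (ypart z) * d%:R)) ^+ 2 <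
  cor_dot f P d A1 A2 (xpart z) (ypart z) (tpart z) ^+ 2.
have hx : rpolyfun (@coords R _) (@xpart R 4) by exact: polyfun_xpart.
have hy : rpolyfun (@coords R _) (@ypart R 4) by exact: polyfun_ypart.
have ht := @polyfun_tpart R 4.
have hq : polyfun (@coords R _) q by exact: polyfun_field_den.
have hN : forall i, polyfun (@coords R _) (fun z => N z 0 i).
  exact: polyfun_field_num.
have K0 x : K x -> toC2 x != (0, 0).
  move=> Kx; apply/eqP => -[x0 x1 x2 x3]; move: Kx; rewrite /K /euclidean_sphere /=.
  rewrite big_ord4 /= -/iu -/iv -/iub -/ivb in x0 x1 x2 x3 *.
  rewrite x0 x1 x2 x3 !expr0n /= !addr0 => /esym/eqP.
  by rewrite sqrf_eq0 gt_eqF.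
have g0 x : K x -> gram A1 A2 x x != 0.
  move=> Kx; apply/eqP => g0; apply: (f_reg (K0 _ Kx)); apply/critP.
  apply: gram_eq0; rewrite -[RHS]g0 /gram /dot.
  pose p := real_partials (evalR (wirtinger iu f) x) (evalR (wirtinger iub f) x)
          (evalR (wirtinger iv f) x) (evalR (wirtinger ivb f) x).
  have e1 i : complex.Re (p i) = A1 (x, x) 0 i by rewrite /p -dA.
  have e2 i : complex.Im (p i) = A2 (x, x) 0 i by rewrite /p -dA.
  rewrite -/p.
  by congr (_ * _ - _ ^+ 2); apply: eq_bigr => i _; rewrite ?e1 ?e2 ?expr2.
have eu x : dot (A1 (x, x)) (euler_field P x) = d%:R * complex.Re (evalR f x) /\
            dot (A2 (x, x)) (euler_field P x) = d%:R * complex.Im (evalR f x).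
  by rewrite !(dotC _ (euler_field P x)); exact: euler_evalR.
have cor_diag x : cor_dot f P d A1 A2 x x 0 =
    gram A1 A2 x x * (4 * dot x (euler_field P x)).
  have [u1 u2] := eu x.
  rewrite /cor_dot /correction /radial /mean1 /mean2 !mul0r subr0 addr0.
  rewrite !(dotDr _ _ (A1 _)) !(dotDr _ _ (A2 _)) u1 u2.
  rewrite -!mulrDr !subrr /lift_slopes !mulr0 !subrr !scale0r !addr0.
  by rewrite dotZr !dotE; ring.
have c0 x : K x -> cor_dot f P d A1 A2 x x 0 != 0.
  move=> Kx; rewrite cor_diag mulf_neq0 ?g0 // mulf_neq0 // gt_eqF //.
  rewrite /dot lt_neqAle sumr_ge0 ?andbT; last first.
    by move=> i _; rewrite mxE mulrCA mulr_ge0 // -expr2 sqr_ge0.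
  apply/eqP => /esym e0.
  have xi i : x 0 i = 0.
    have h : \sum_i x 0 i * euler_field P x 0 i == 0 by apply/eqP.
    rewrite psumr_eq0 in h; last first.
      by move=> j _; rewrite mxE mulrCA mulr_ge0 // -expr2 sqr_ge0.
    move/allP: h => /(_ i); rewrite mem_index_enum => /(_ isT) /=.
    rewrite mxE !mulf_eq0 orbA orbAC orbb orbC pnatr_eq0 eqn0Ngt.
    have -> : (0 < wt P i)%N by rewrite /wt; case: P0; case: ifP.
    by move=> /= /eqP.
  by have := K0 x Kx; rewrite /toC2 !xi eqxx.
have qK x : K x -> q (xty x 0 x) != 0.
  by move=> Kx; rewrite /q xpartE ypartE tpartE mulf_neq0 ?g0 ?c0.
have nearG x : K x -> \forall z \near xty x 0 x, G z.
  move=> Kx.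
  pose h z := cor_dot f P d A1 A2 (@xpart R 4 z) (ypart z) (tpart z) ^+ 2 -
    (tpart z * (rot_dot f A1 A2 (@xpart R 4 z) (ypart z) * d%:R)) ^+ 2.
  have hh : polyfun (@coords R _) h.
    apply: polyfun_sub; apply: polyfun_exp; first exact: polyfun_cor_dot.
    apply: polyfun_mul => //; apply: polyfun_mul; last exact: polyfun_cst.
    exact: polyfun_rot_dot.
  have FF : Filter (nbhs (xty x 0 x)) by exact: nbhs_filter.
  have h0 : 0 < h (xty x 0 x).
    rewrite /h xpartE ypartE tpartE mul0r expr0n subr0 exprn_even_gt0 //=.
    exact: c0.
  have := @cvgr_gt _ _ _ FF h _ (@polyfun1_continuous _ _ _ hh (xty x 0 x)) _ h0.
  by apply: filterS => z; rewrite /h /G subr_gt0.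
have [r [Y [r0 hY1 hY2 hY3]]] := near_identity_family hq hN
  (@euclidean_sphere_compact R 4 rho) qK nearG.
have Kself x : K x -> exists2 x0, K x0 & `|x - x0| < r.
  by move=> Kx; exists x => //; rewrite subrr normr0.
have step x t : K x -> `|t| < r ->
   field_den f P d A1 A2 x (Y x t) t *: (Y x t - x) =
   t *: field_num f P d A1 A2 x (Y x t) t /\
   field_den f P d A1 A2 x (Y x t) t != 0.
  move=> Kx htr; have [+ + _] := hY1 x t (Kself _ Kx) htr.
  rewrite /displacement /q /N xpartE ypartE tpartE => e ->; split => //.
  by apply/eqP; rewrite -subr_eq0; apply/eqP.
have KY x t : K x -> `|t| < r -> K (Y x t).
  move=> Kx htr; have [e q0] := step x t Kx htr.
  have [e1 _ _] := field_step eA q0 e.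
  have sq z : dot z z = \sum_(i < 4) z 0 i ^+ 2 :> R.
    by apply: eq_bigr => i _; rewrite expr2.
  by move: e1 Kx; rewrite !sq /K /euclidean_sphere /= => ->.
exists r, Y; split => //.
- move=> x t Kx htr; have [e q0] := step x t Kx htr.
  have := field_step_eval eA q0 e.
  have [_ _] := hY1 x t (Kself _ Kx) htr.
  rewrite /G xpartE ypartE tpartE.
  set s := slack _ _ _ _ _ _ _ _ => hG es.
  have c1 : cor_dot f P d A1 A2 x (Y x t) t != 0.
    by move: q0; rewrite /field_den mulf_eq0 negb_or => /andP[].
  have ts : (t * s) ^+ 2 < 1.
    have -> : t * s = - (t * (rot_dot f A1 A2 x (Y x t) * d%:R) /
        cor_dot f P d A1 A2 x (Y x t) t).
      by rewrite /s /slack; field.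
    by rewrite sqrrN expr_div_n ltr_pdivrMr ?mul1r // exprn_even_gt0.
  have [s1 s2] : 0 < 1 - t * s /\ 0 < 1 + t * s by nra.
  exists ((1 + t * s) / (1 - t * s)); first by rewrite divr_gt0.
  have n0 : ((1 - t * s)%:C != 0 :> R[i])%C.
    by rewrite (_ : 0 = 0%:C)%C // (inj_eq (@complexI R)) gt_eqF.
  apply: (mulIf n0); rewrite -mulrA es rmorphM fmorphV.
  by rewrite mulrA [RHS]mulrAC mulfVK // mulrC.
- move=> x t Kx htr; apply: hY2 => //; first exact: KY.
  have [e _] := step x t Kx htr.
  have [e1 e2] := field_sym f P d sA x (Y x t) t.
  rewrite /displacement /q /N xpartE ypartE tpartE e1 e2.
  by rewrite -[x - _]opprB scalerN e scaleNr opprK addNr.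
Qed.

End Rotation.

(** * The strong Milnor condition *)

Section Angles.
Variable R : realType.
Implicit Types (b c : 'rV[R]_2) (t : R).

Definition cos_angle b c : R := b 0 0 * c 0 0 + b 0 1 * c 0 1.
Definition sin_angle b c : R := b 0 0 * c 0 1 - b 0 1 * c 0 0.
(** On the unit circle this is the tangent of half the angle from [b] to [c], a
rational function of [c] that is defined except at the antipode of [b]. *)
Definition half_tan b c : R := sin_angle b c / (1 + cos_angle b c).

(** The rotation by twice the arctangent of [t], that is, the multiplication by
(1 + i t) / (1 - i t). *)
Definition rotate t b : 'rV[R]_2 := \row_i
  if i == 0 then ((1 - t ^+ 2) * b 0 0 - 2 * t * b 0 1) / (1 + t ^+ 2)
  else ((1 - t ^+ 2) * b 0 1 + 2 * t * b 0 0) / (1 + t ^+ 2).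

Lemma sqrp1_neq0 t : 1 + t ^+ 2 != 0.
Proof. by rewrite gt_eqF // ltr_pwDl // sqr_ge0. Qed.

Lemma rV2_ext b c : b 0 0 = c 0 0 -> b 0 1 = c 0 1 -> b = c.
Proof.
move=> h0 h1; apply/rowP => -[[|[|//]] lt2].
  by rewrite (_ : Ordinal lt2 = 0) //; apply: val_inj.
by rewrite (_ : Ordinal lt2 = 1) //; apply: val_inj.
Qed.

Lemma half_tanC b c : half_tan c b = - half_tan b c.
Proof.
have es : sin_angle c b = - sin_angle b c by rewrite /sin_angle; ring.
have ec : cos_angle c b = cos_angle b c by rewrite /cos_angle; ring.
by rewrite /half_tan es ec mulNr.
Qed.

Lemma circleE b : euclidean_sphere 1 b <-> b 0 0 ^+ 2 + b 0 1 ^+ 2 = 1.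
Proof.
rewrite /euclidean_sphere /= big_ord_recl big_ord1 expr1n.
by rewrite (_ : lift ord0 ord0 = 1) //; apply: val_inj.
Qed.

Lemma rotate_half_tan b c : euclidean_sphere 1 b -> euclidean_sphere 1 c ->
  0 < 1 + cos_angle b c -> rotate (half_tan b c) b = c.
Proof.
move=> /circleE hb /circleE hc c0.
have cs : sin_angle b c ^+ 2 = 1 - cos_angle b c ^+ 2.
  rewrite -[1]mulr1 -{1}hb -hc /sin_angle /cos_angle; ring.
have n0 : 1 + cos_angle b c != 0 by rewrite gt_eqF.
have e1 : 1 + half_tan b c ^+ 2 = 2 / (1 + cos_angle b c).
  by rewrite /half_tan expr_div_n cs; field.
have e2 : (1 - half_tan b c ^+ 2) / (1 + half_tan b c ^+ 2) = cos_angle b c.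
  by rewrite e1 /half_tan expr_div_n cs; field.
have e3 : 2 * half_tan b c / (1 + half_tan b c ^+ 2) = sin_angle b c.
  by rewrite e1 /half_tan; field.
have r0 u v : ((1 - half_tan b c ^+ 2) * u - 2 * half_tan b c * v) /
    (1 + half_tan b c ^+ 2) = cos_angle b c * u - sin_angle b c * v.
  by rewrite -e2 -e3; ring.
have r1 u v : ((1 - half_tan b c ^+ 2) * v + 2 * half_tan b c * u) /
    (1 + half_tan b c ^+ 2) = cos_angle b c * v + sin_angle b c * u.
  by rewrite -e2 -e3; ring.
apply: rV2_ext; rewrite !mxE /= ?r0 ?r1 /cos_angle /sin_angle.
  transitivity (c 0 0 * (b 0 0 ^+ 2 + b 0 1 ^+ 2)); last by rewrite hb mulr1.
  by ring.
transitivity (c 0 1 * (b 0 0 ^+ 2 + b 0 1 ^+ 2)); last by rewrite hb mulr1.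
by ring.
Qed.

End Angles.

Section MilnorMap.
Variables (R : realType) (f : mixed R).
Implicit Types x y : 'rV[R]_4.

Let F1 x := complex.Re (evalR f x).
Let F2 x := complex.Im (evalR f x).
Let nrm x := Num.sqrt (F1 x ^+ 2 + F2 x ^+ 2).

Lemma milnor_mapE x : milnor_map f x 0 0 = F1 x / nrm x /\
                      milnor_map f x 0 1 = F2 x / nrm x.
Proof.
rewrite /milnor_map -/(evalR f x) /ofC !mxE /= /nrm /F1 /F2.
case: (evalR f x) => a b; rewrite normc_def -fmorphV.
by rewrite cReM cImM /= !mulr0 subr0 add0r.
Qed.

Lemma evalR_neq0 x : evalR f x != 0 <-> 0 < F1 x ^+ 2 + F2 x ^+ 2.
Proof.
rewrite lt0r addr_ge0 ?sqr_ge0 // andbT paddr_eq0 ?sqr_ge0 //.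
by rewrite !sqrf_eq0 /F1 /F2; case: (evalR f x) => a b; rewrite eq_complex.
Qed.

Lemma milnor_map_circle x : evalR f x != 0 -> euclidean_sphere 1 (milnor_map f x).
Proof.
move=> /evalR_neq0 h; apply/circleE; have [-> ->] := milnor_mapE x.
have n0 : nrm x != 0 by rewrite gt_eqF // sqrtr_gt0.
have e : nrm x ^+ 2 = F1 x ^+ 2 + F2 x ^+ 2 by rewrite sqr_sqrtr // ltW.
by rewrite !expr_div_n -mulrDl -e mulfV // sqrf_eq0.
Qed.

Lemma milnor_map_rotate x y t s : 0 < s -> evalR f x != 0 ->
  (evalR f y * (1 -i* t) = s%:C * (evalR f x * (1 +i* t)))%C ->
  evalR f y != 0 /\ milnor_map f y = rotate t (milnor_map f x).
Proof.
move=> s0 fx e; have q0 := sqrp1_neq0 t.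
have e1 : F1 y = s * ((1 - t ^+ 2) * F1 x - 2 * t * F2 x) / (1 + t ^+ 2).
  move: e => /eqP; rewrite eq_complex => /andP[/eqP e1 /eqP e2]; move: e1 e2.
  rewrite !ReImE /= -/(F1 x) -/(F1 y) -/(F2 x) -/(F2 y) => e1 e2.
  apply: (mulIf q0); rewrite mulfVK //.
  transitivity ((F1 y * 1 - F2 y * - t) - t * (F1 y * - t + F2 y * 1)); first by ring.
  by rewrite e1 e2; ring.
have e2 : F2 y = s * ((1 - t ^+ 2) * F2 x + 2 * t * F1 x) / (1 + t ^+ 2).
  move: e => /eqP; rewrite eq_complex => /andP[/eqP e1' /eqP e2]; move: e1' e2.
  rewrite !ReImE /= -/(F1 x) -/(F1 y) -/(F2 x) -/(F2 y) => e1' e2.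
  apply: (mulIf q0); rewrite mulfVK //.
  transitivity (t * (F1 y * 1 - F2 y * - t) + (F1 y * - t + F2 y * 1)); first by ring.
  by rewrite e1' e2; ring.
have e3 : F1 y ^+ 2 + F2 y ^+ 2 = s ^+ 2 * (F1 x ^+ 2 + F2 x ^+ 2).
  by rewrite e1 e2; field.
move: (fx) => /evalR_neq0 nx.
have ny : 0 < F1 y ^+ 2 + F2 y ^+ 2 by rewrite e3 mulr_gt0 ?exprn_gt0.
split; first exact/evalR_neq0.
have en : nrm y = s * nrm x.
  by rewrite /nrm e3 sqrtrM ?sqr_ge0 // sqrtr_sqr gtr0_norm.
have n0 : nrm x != 0 by rewrite gt_eqF // sqrtr_gt0.
have [mx0 mx1] := milnor_mapE x; have [my0 my1] := milnor_mapE y.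
have s1 : s != 0 by rewrite gt_eqF.
have algebra (a b n : R) : n != 0 ->
    s * ((1 - t ^+ 2) * a - 2 * t * b) / (1 + t ^+ 2) / (s * n) =
    ((1 - t ^+ 2) * (a / n) - 2 * t * (b / n)) / (1 + t ^+ 2).
  by move=> n1; field; rewrite q0 n1 s1.
apply: rV2_ext.
  by rewrite my0 en e1 (algebra _ _ _ n0) -mx0 -mx1 [RHS]mxE.
have -> : milnor_map f y 0 1 = s * ((1 - t ^+ 2) * F2 x - 2 * t * - F1 x) /
    (1 + t ^+ 2) / (s * nrm x) by rewrite my1 en e2 mulrN opprK.
by rewrite (algebra _ _ _ n0) mulNr mulrN opprK -mx0 -mx1 [RHS]mxE.
Qed.

Lemma Ck_on_coord n (U : set 'rV[R]_n) k i : Ck_on k U (fun x : 'rV[R]_n => x 0 i).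
Proof.
apply: Ck_on_linear; last exact: coord_continuous.
by move=> a u v; rewrite !mxE.
Qed.

Lemma Ck_on_coords k n (U : set 'rV[R]_n) (g : 'rV[R]_n -> R) :
  open U -> polyfun (@coords R n) g -> Ck_on k U g.
Proof.
move=> oU; apply: Ck_on_polyfun => // _ [i ->]; exact: Ck_on_coord.
Qed.

Lemma polyfun_F : polyfun (@coords R 4) F1 /\ polyfun (@coords R 4) F2.
Proof.
apply: (@cpolyfun_evalR _ _ _ id) => j; apply: polyfun_gen; by exists j.
Qed.

Lemma open_evalR_neq0 : open [set x | evalR f x != 0].
Proof.
have [p1 p2] := polyfun_F.
have -> : [set x | evalR f x != 0] =
    (fun x => F1 x ^+ 2 + F2 x ^+ 2) @^-1` [set r | 0 < r].
  by apply/seteqP; split => x /= /evalR_neq0.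
apply: open_comp; last exact: open_gt.
move=> x _; apply: polyfun1_continuous.
by apply: polyfun_add; exact: polyfun_exp.
Qed.

Lemma milnor_map_Ck k i :
  Ck_on k [set x | evalR f x != 0] (fun x => milnor_map f x 0 i).
Proof.
have [p1 p2] := polyfun_F; have oU := open_evalR_neq0.
have Cn : Ck_on k [set x | evalR f x != 0] (fun x => (nrm x)^-1).
  have h x : evalR f x != 0 -> 0 < F1 x ^+ 2 + F2 x ^+ 2 by move=> /evalR_neq0.
  apply: Ck_on_inv => // [x /h hx|]; first by rewrite gt_eqF // sqrtr_gt0.
  apply: Ck_on_sqrt => //; apply: Ck_on_coords => //.
  by apply: polyfun_add; exact: polyfun_exp.
have [i0|i1] : i = 0 \/ i = 1.
  by case: i => [[|[|//]] lt2]; [left|right]; apply: val_inj.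
- have -> : (fun x => milnor_map f x 0 i) = fun x => F1 x * (nrm x)^-1.
    by apply/funext => x; rewrite i0; have [] := milnor_mapE x.
  by apply: Ck_on_mul => //; exact: Ck_on_coords.
- have -> : (fun x => milnor_map f x 0 i) = fun x => F2 x * (nrm x)^-1.
    by apply/funext => x; rewrite i1; have [] := milnor_mapE x.
  by apply: Ck_on_mul => //; exact: Ck_on_coords.
Qed.

End MilnorMap.

Lemma Ck_on_half_tan (R : realType) (V : normedModType R) k (U : set V)
    (b : 'rV[R]_2) (g : V -> 'rV[R]_2) : open U ->
  (forall i, Ck_on k U (fun x => g x 0 i)) ->
  (forall x, U x -> 0 < 1 + cos_angle b (g x)) ->
  Ck_on k U (fun x => half_tan b (g x)).
Proof.
move=> oU hg c0.
have cst (c : R) : Ck_on k U (fun=> c) by exact: Ck_on_cst.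
have lin (c c' : R) i j : Ck_on k U (fun x => c * g x 0 i + c' * g x 0 j).
  by apply: Ck_on_add => //; exact: Ck_on_mul.
apply: Ck_on_mul => //.
  apply: Ck_on_ext (lin (b 0 0) (- b 0 1) 1 0) => // x _.
  by rewrite mulNr.
apply: Ck_on_inv => // [x Ux|]; first by rewrite gt_eqF ?c0.
by apply: Ck_on_add => //; exact: lin.
Qed.

Section Fibration.
Variables (R : realType) (f : mixed R) (P : nat * nat) (d : nat).
Hypothesis P0 : positive_weight P.
Hypothesis fP : radially_homogeneous P d f.
Hypothesis f_reg : forall z, z != (0, 0) -> ~ crit f z.

(** Over the points whose half angle tangent from [b] is less than the uniform time
[r], each point is moved into the fibre over [b] by the motion in time minus
that tangent.  By reversibility the inverse is the motion in the opposite time,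
and both are smooth. *)
Lemma strong_milnor_of_regular : strong_milnor f.
Proof.
exists 1 => // rho /andP[rho0 _].
set K := @euclidean_sphere R 4 rho.
have [r [Y [r0 KY eY invY CkY]]] := rotation_family P0 fP f_reg rho0.
rewrite -/K in KY eY invY CkY.
pose p := milnor_map f; pose U0 := [set x : 'rV[R]_4 | evalR f x != 0].
have oU0 : open U0 := @open_evalR_neq0 _ f.
have EP x : (K `\` (@toC2 R @^-1` zeros f)) x <-> K x /\ evalR f x != 0.
  by split=> [[Kx /eqP fx]|[Kx /eqP fx]]; split.
have circ x : evalR f x != 0 -> euclidean_sphere 1 (p x) by exact: milnor_map_circle.
split=> [x /EP[_ /circ]//|b bB].
pose Oset : set 'rV[R]_2 := [set b' | 0 < 1 + cos_angle b b' /\ `|half_tan b b'| < r].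
have pcos : polyfun (@coords R 2) (fun b' => 1 + cos_angle b b').
  apply: polyfun_add; first exact: polyfun_cst.
  apply: polyfun_add; apply: polyfun_mul; try exact: polyfun_cst;
    by apply: polyfun_gen; eexists.
have oC : open [set b' : 'rV[R]_2 | 0 < 1 + cos_angle b b'].
  apply: (@open_comp _ _ (fun b' => 1 + cos_angle b b') [set r | 0 < r]).
    by move=> x _; exact: polyfun1_continuous.
  exact: open_gt.
have CkT k : Ck_on k [set b' : 'rV[R]_2 | 0 < 1 + cos_angle b b'] (half_tan b).
  by apply: (Ck_on_half_tan (g := id)) => // i; exact: Ck_on_coord.
have oO : open Oset.
  rewrite openE => b' [h1 h2].
  have c := Ck_on_continuous (CkT 0%N) h1.
  have n1 : \forall x \near b', 0 < 1 + cos_angle b x.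
    exact: (open_nbhs_nbhs (conj oC h1)).
  have FF : Filter (nbhs b') by exact: nbhs_filter.
  have n2 : \forall x \near b', `|half_tan b x| < r.
    exact: (@cvgr_norm_lt _ _ _ _ FF _ _ c _ h2).
  by apply: filterS2 n1 n2 => x; split.
have bb : cos_angle b b = 1 /\ half_tan b b = 0.
  split; first by rewrite /cos_angle -!expr2; apply/circleE.
  by rewrite /half_tan /sin_angle (mulrC (b 0 0)) subrr mul0r.
exists Oset; split => //.
  by have [b1 b2] := bb; split; rewrite ?b1 ?b2 ?normr0 // addr_gt0.
(* Smoothness on the sphere means extendability to an open set of R^4, and [Y]
   is smooth in a neighbourhood of the sphere. *)
pose N : set 'rV[R]_4 := [set x | exists2 x0, K x0 & `|x - x0| < r].
have oN : open N.
  rewrite openE => x [x0 Kx0 hx].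
  have FF : Filter (nbhs x) by exact: nbhs_filter.
  have c : (fun y : 'rV[R]_4 => y - x0) @ x --> x - x0.
    by apply: cvgB; [exact: cvg_id|exact: cvg_cst].
  have := @cvgr_norm_lt _ _ _ _ FF _ _ c _ hx.
  by apply: filterS => y hy; exists x0.
have KN x : K x -> N x by move=> Kx; exists x; rewrite ?subrr ?normr0.
pose phi (x : 'rV[R]_4) : 'rV[R]_2 * 'rV[R]_4 := (p x, Y x (- half_tan b (p x))).
pose psi (w : 'rV[R]_2 * 'rV[R]_4) : 'rV[R]_4 := Y w.2 (half_tan b w.1).
have rot x t : K x -> evalR f x != 0 -> `|t| < r ->
    [/\ K (Y x t), evalR f (Y x t) != 0 & p (Y x t) = rotate t (p x)].
  move=> Kx fx ht; have [s s0 e] := eY x t Kx ht.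
  by have [? ?] := milnor_map_rotate s0 fx e; split => //; exact: KY.
have phiB x : K x -> evalR f x != 0 -> Oset (p x) ->
    [/\ K (phi x).2, evalR f (phi x).2 != 0, p (phi x).2 = b & psi (phi x) = x].
  move=> Kx fx [q1 q2].
  have ht : `|- half_tan b (p x)| < r by rewrite normrN.
  have [k1 k2 k3] := rot x _ Kx fx ht; split => //.
    rewrite /= k3 -half_tanC rotate_half_tan //; first exact: circ.
    by rewrite /cos_angle (mulrC (p x 0 0)) (mulrC (p x 0 1)).
  by rewrite /psi /phi /= -[X in Y _ X]opprK invY.
have psiB b' y : euclidean_sphere 1 b' -> Oset b' -> K y -> evalR f y != 0 ->
    p y = b ->
    [/\ K (psi (b', y)), evalR f (psi (b', y)) != 0, p (psi (b', y)) = b' &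
        phi (psi (b', y)) = (b', y)].
  move=> Bb' [q1 q2] Ky fy py.
  have [k1 k2] := rot y _ Ky fy q2; rewrite py rotate_half_tan // => k3.
  split => //; rewrite /phi /psi /= k3; congr (_, _); exact: invY.
exists phi, psi; split; last by [].
split.
- move=> x [/EP[Kx fx] Ox].
  exists (U0 `&` (N `&` p @^-1` Oset)), phi.
  have cp y : U0 y -> {for y, continuous p}.
    move=> Uy; have FF : Filter (nbhs y) by exact: nbhs_filter.
    apply: (@coord_cvg_rV _ _ (nbhs y) FF) => i.
    exact: (Ck_on_continuous (@milnor_map_Ck _ f 0%N i)).
  have oU : open (U0 `&` (N `&` p @^-1` Oset)).
    rewrite openE => y [Uy [Ny Oy]].
    have n1 : \forall y' \near y, U0 y' by exact: open_nbhs_nbhs.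
    have n2 : \forall y' \near y, N y' by exact: open_nbhs_nbhs.
    have n3 : \forall y' \near y, Oset (p y').
      exact: (cp y Uy Oset (open_nbhs_nbhs (conj oO Oy))).
    by apply: filterS3 n1 n2 n3 => y'; split.
  have Cp k i : Ck_on k (U0 `&` (N `&` p @^-1` Oset)) (fun x => p x 0 i).
    by apply: Ck_on_sub (@milnor_map_Ck _ f k i) => y [].
  split => //; first by split => //; split => //; exact: KN.
  move=> k; apply: Ck_on_pair => //; apply: Ck_on_rV => // i.
  apply: CkY => //.
  + by move=> k' j; exact: Ck_on_coord.
  + move=> k'.
    have C1 := @Ck_on_cst _ _ R k' (U0 `&` (N `&` p @^-1` Oset)) (-1).
    have C2 : Ck_on k' (U0 `&` (N `&` p @^-1` Oset)) (fun x => half_tan b (p x)).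
      by apply: Ck_on_half_tan => // y [_ [_ []]].
    by apply: Ck_on_ext (Ck_on_mul oU C1 C2) => // y _; rewrite mulN1r.
  + by move=> y [_ []].
  + by move=> y [_ [_ [_]]]; rewrite normrN.
- move=> [b' y] [[/= Bb' Ob'] [/EP[Ky fy] py]].
  pose U : set ('rV[R]_2 * 'rV[R]_4) := [set w | Oset w.1 /\ N w.2].
  have oU : open U.
    rewrite openE => w [Ow Nw].
    have n1 : \forall w' \near w, Oset w'.1.
      have c : fst @ w --> w.1 by exact: cvg_fst.
      exact: (c Oset (open_nbhs_nbhs (conj oO Ow))).
    have n2 : \forall w' \near w, N w'.2.
      have c : snd @ w --> w.2 by exact: cvg_snd.
      exact: (c N (open_nbhs_nbhs (conj oN Nw))).
    by apply: filterS2 n1 n2 => w'; split.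
  exists U, psi; split => //; first by split => //; exact: KN.
  move=> k; apply: Ck_on_rV => // i; apply: CkY => //.
  + move=> k' j; apply: Ck_on_linear => [a u v|w]; first by rewrite !mxE.
    apply: (@continuous_comp _ _ _ snd (fun z : 'rV[R]_4 => z 0 j)).
      exact: cvg_snd.
    exact: coord_continuous.
  + move=> k'; apply: Ck_on_half_tan => // [j|w [[]]//].
    apply: Ck_on_linear => [a u v|w]; first by rewrite !mxE.
    apply: (@continuous_comp _ _ _ fst (fun z : 'rV[R]_2 => z 0 j)).
      exact: cvg_fst.
    exact: coord_continuous.
  + by move=> w [].
  + by move=> w [[]].
- by move=> x [/EP[Kx fx] Ox]; have [k1 k2 k3 k4] := phiB x Kx fx Ox;
    split; [split; [split; [exact: circ|]|split; [apply/EP|]]|].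
- move=> [b' y] [[/= Bb' Ob'] [/EP[Ky fy] py]].
  have [k1 k2 k3 k4] := psiB b' y Bb' Ob' Ky fy py.
  by split; [split; [apply/EP|rewrite /= -/p k3]|].
Qed.

End Fibration.

(** * Regularity from the topological conditions *)

Section Scaling.
Variables (R : realType) (f : mixed R) (P : nat * nat) (d : nat).
Hypothesis P0 : positive_weight P.
Hypothesis fP : radially_homogeneous P d f.

(** Differentiation along the i-th variable lowers the radial degree by this weight. *)
Definition cwt (i : 'I_4) : nat := if (i == iu) || (i == iub) then P.1 else P.2.

Lemma rdeg_add (m : multinom 4) i : rdeg P (mnm_add m (mnm1 i)) = (rdeg P m + cwt i)%N.
Proof.
rewrite /rdeg /cwt !mnmDE !mnmE.
by case: i => [[|[|[|[|//]]]] lt4] /=; ring.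
Qed.

Lemma wirtinger_homogeneous i :
  radially_homogeneous P (d - cwt i) (wirtinger i f).
Proof.
move=> m hm; have : mnm_add m (mnm1 i) \in msupp f.
  move: hm; rewrite !mcoeff_msupp /wirtinger mcoeff_deriv.
  by apply: contraNneq => ->; rewrite mul0rn.
by move=> /fP; rewrite rdeg_add => <-; rewrite addnK.
Qed.

Lemma crit_cscale t z : crit f z -> crit f (cscale P t z).
Proof.
move=> /critP; set g := (fun i => mixed_eval (wirtinger i f) z) => cz.
apply/critP.
have -> : (fun i => mixed_eval (wirtinger i f) (cscale P t z)) =
    fun i => ((t ^+ (d - cwt i))%:C * g i)%C.
  by apply/funext => i; exact: (mixed_eval_cscale t z (@wirtinger_homogeneous i)).
clearbody g; case: cz => e1 e2 e3.
rewrite /crit_eqs /cwt /= !conj_real_mul; split.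
- by rewrite mulrACA e1 mulrACA.
- by rewrite mulrACA e2 mulrACA.
- by rewrite mulrACA e3 mulrACA.
Qed.

Lemma zeros_cscale t z : zeros f z -> zeros f (cscale P t z).
Proof. by rewrite /zeros /= (mixed_eval_cscale _ _ fP) => ->; rewrite mulr0. Qed.

Lemma cscale0 z : cscale P 0 z = (0, 0) :> R[i] * R[i].
Proof.
case: P0 => p1 p2; rewrite /cscale !expr0n.
by rewrite !(gtn_eqF p1, gtn_eqF p2) !mul0r.
Qed.

Lemma toC2_surj (z : R[i] * R[i]) : exists x : 'rV[R]_4, toC2 x = z.
Proof.
case: z => -[a b] [c e].
by exists (\row_i tnth [tuple a; b; c; e] i); rewrite /toC2 !mxE.
Qed.

Lemma toC2_eq0 (x : 'rV[R]_4) : toC2 x = (0, 0) -> x = 0.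
Proof.
move=> [x0 x1 x2 x3]; apply/rowP => i; rewrite mxE.
case: i => [[|[|[|[|//]]]] lt4];
  [rewrite -[RHS]x0|rewrite -[RHS]x1|rewrite -[RHS]x2|rewrite -[RHS]x3];
  by congr (x _ _); apply: val_inj.
Qed.

(** The orbit of [x] tends to the origin with [t]. *)
Lemma near_rscale (x : 'rV[R]_4) (Q : 'rV[R]_4 -> Prop) :
  (\forall y \near (0 : 'rV[R]_4), Q y) -> exists2 t, 0 < t & Q (rscale P t x).
Proof.
move=> nQ.
have r0 : rscale P 0 x = 0.
  by apply: toC2_eq0; rewrite toC2_rscale cscale0.
have c : {for (0 : R), continuous (fun t => rscale P t x)}.
  have FF : Filter (nbhs (0 : R)) by exact: nbhs_filter.
  apply: (@coord_cvg_rV _ _ _ FF) => i.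
  apply: (@polyfun_continuous _ _ [set id]) => [g /= ->|]; first exact: cvg_id.
  have -> : (fun t => rscale P t x 0 i) = fun t => t ^+ wt P i * x 0 i.
    by apply/funext => t; rewrite mxE.
  apply: polyfun_mul; last exact: polyfun_cst.
  by apply: polyfun_exp; exact: polyfun_gen.
have nt : \forall t \near (0 : R), Q (rscale P t x).
  by apply: c; rewrite r0.
have [e e0 h] := near_norm nt.
exists (e / 2); first by rewrite divr_gt0.
by apply: h; rewrite subr0 gtr0_norm ?divr_gt0 // ltr_pdivrMr // ltr_pMr // ltr1n.
Qed.

(** Scaling brings any point of [S] into [U] without leaving [S]. *)
Lemma isolated_cone (S : set (R[i] * R[i])) :
  (forall t z, S z -> S (cscale P t z)) ->
  (exists2 U : set 'rV[R]_4, open U & U `&` (@toC2 R @^-1` S) = [set 0]) ->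
  forall z, S z -> z = (0, 0).
Proof.
move=> hS [U oU eU] z Sz; have [x ex] := toC2_surj z.
have U0 : U 0 by have : [set (0 : 'rV[R]_4)] 0 by []; rewrite -eU => -[].
have [t t0 Ut] := near_rscale x (open_nbhs_nbhs (conj oU U0)).
have : (U `&` (@toC2 R @^-1` S)) (rscale P t x).
  by split => //=; rewrite toC2_rscale ex; exact: hS.
rewrite eU /= => /rowP xt0.
rewrite -ex; have -> : x = 0; last first.
  by rewrite /toC2 !mxE.
apply/rowP => i; have := xt0 i; rewrite !mxE => /eqP.
by rewrite mulf_eq0 expf_eq0 (gt_eqF t0) andbF => /eqP.
Qed.

Lemma regular_of_isolated : isolated_singularity f ->
  forall z, z != (0, 0) -> ~ crit f z.
Proof.
move=> iso z /eqP z0 cz; apply: z0; apply: isolated_cone (cz) => //.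
  by move=> t z'; exact: crit_cscale.
by apply: iso; rewrite -(cscale0 z); exact: crit_cscale.
Qed.

Lemma regular_on_zeros : weakly_isolated_singularity f ->
  forall z, z != (0, 0) -> crit f z -> ~ zeros f z.
Proof.
move=> iso z /eqP z0 cz fz; apply: z0.
apply: (@isolated_cone (zeros f `&` crit f)) => //.
  by move=> t z' [? ?]; split; [exact: zeros_cscale|exact: crit_cscale].
by apply: iso; rewrite -(cscale0 z); exact: crit_cscale.
Qed.

End Scaling.

(** Besides s1 = s2 = s3 = 0 one has a conj(c) = conj(b) d; together these are all the
2 x 2 minors of the Jacobian matrix. *)
Lemma crit_minors (R : realType) (a b c d : R[i]) :
  a * conjc d = conjc b * c -> a * conjc a = b * conjc b ->
  c * conjc c = d * conjc d -> forall i j,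
  let p := real_partials a b c d in
  complex.Re (p i) * complex.Im (p j) = complex.Re (p j) * complex.Im (p i).
Proof.
move=> e1 e2 e3.
have e4 : a * conjc c = conjc b * d.
  have [d0|d0] := eqVneq d 0.
    move: e3; rewrite d0 mul0r => /eqP; rewrite mulf_eq0 conjc_eq0 orbb => /eqP ->.
    by rewrite conjc0 !mulr0.
  have d0' : conjc d != 0 by rewrite conjc_eq0.
  apply: (mulIf d0'); rewrite mulrAC e1 -mulrA e3 !mulrA.
  by [].
move: e1 e2 e3 e4.
case: a b c d => [a1 a2] [b1 b2] [c1 c2] [d1 d2] /=.
move=> /eqP; rewrite eq_complex => /andP[/eqP + /eqP +] /eqP.
rewrite eq_complex => + + /andP[/eqP + _] /eqP.
rewrite eq_complex => + + + /andP[/eqP + _] /eqP.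
rewrite eq_complex => + + + + /andP[/eqP + /eqP +].
rewrite !ReImE /= => h1 h2 h3 h4 h5 h6 i j.
have algebra : [/\ (a1 + b1) * (a1 - b1) = - (a2 - b2) * (a2 + b2),
  (a1 + b1) * (c2 + d2) = (c1 + d1) * (a2 + b2),
  (a1 + b1) * (c1 - d1) = - (c2 - d2) * (a2 + b2),
  - (a2 - b2) * (c2 + d2) = (c1 + d1) * (a1 - b1) &
  - (a2 - b2) * (c1 - d1) = - (c2 - d2) * (a1 - b1)] /\
  (c1 + d1) * (c1 - d1) = - (c2 - d2) * (c2 + d2).
  by split; [split|]; lra.
move: algebra => [[k1 k2 k3 k4 k5] k6].
have q0 : complex.Re (real_partials (a1 +i* a2) (b1 +i* b2) (c1 +i* c2) (d1 +i* d2) iu)%C = a1 + b1 by [].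
by case: i => [[|[|[|[|//]]]] lt4]; case: j => [[|[|[|[|//]]]] lt4'];
  rewrite /real_partials /tnth /= ?ReImE /= ?mul0r ?mul1r ?sub0r ?add0r ?addr0; lra.
Qed.

(** The mean value theorem, with the derivative bounded near [w0] by continuity. *)
Lemma C1_lipschitz_line (R : realType) (V : normedModType R) (U : set V)
    (G : V -> R) (w0 v : V) : open U -> Ck_on 1 U G -> U w0 ->
  exists2 C, 0 <= C & exists2 e, 0 < e & forall w s, `|w - w0| < e -> 0 <= s < e ->
    `|G (s *: v + w) - G w| <= C * s.
Proof.
move=> oU [cG /(_ v) [dG [cD _]]] Uw0.
pose C := `|'D_v G w0| + 1.
have FF : Filter (nbhs w0) by exact: nbhs_filter.
have n1 : \forall w \near w0, U w by exact: open_nbhs_nbhs.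
have n2 : \forall w \near w0, `|'D_v G w| < C.
  by apply: (@cvgr_norm_lt _ _ _ _ FF _ _ (cD _ Uw0)); rewrite /C ltrDl.
have n3 : \forall w \near w0, U w /\ `|'D_v G w| < C by exact: filterS2 n1 n2.
have [r r0 hr] := near_norm n3.
have v1 : 0 < 1 + `|v| by rewrite ltr_pwDl.
pose e := r / (2 * (1 + `|v|)).
have e0 : 0 < e by rewrite divr_gt0 // mulr_gt0.
exists C; first by rewrite addr_ge0.
exists e => // w s hw /andP[s0 se].
have in_ball tau : 0 <= tau <= s -> `|(tau *: v + w) - w0| < r.
  move=> /andP[t0 ts]; rewrite -addrA (le_lt_trans (ler_normD _ _)) // normrZ.
  rewrite ger0_norm //.
  have er : e * (1 + `|v|) = r / 2.
    by rewrite /e; field; rewrite gt_eqF.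
  have : tau * `|v| <= e * `|v| by rewrite ler_wpM2r // (le_trans ts) // ltW.
  have : 0 <= e * `|v| by rewrite mulr_ge0 // ltW.
  nra.
have [->|sn0] := eqVneq s 0; first by rewrite scale0r add0r subrr normr0 mulr0.
have {sn0} s0' : 0 < s by rewrite lt_neqAle eq_sym sn0.
pose g tau := G (tau *: v + w).
have dg tau : 0 <= tau <= s -> is_derive tau 1 g ('D_v G (tau *: v + w)).
  move=> /in_ball/hr[Ut _].
  have e1 : h^-1 *: (g (h *: 1 + tau) - g tau) @[h --> (0 : R)^'] -->
      'D_v G (tau *: v + w).
    have h0 : h^-1 *: (G (h *: v + (tau *: v + w)) - G (tau *: v + w))
        @[h --> (0 : R)^'] --> 'D_v G (tau *: v + w) by exact: (dG _ Ut).
    apply: cvg_trans h0; apply: near_eq_cvg; near=> h.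
    by rewrite /g addrA -scalerDl /GRing.scale /= mulr1.
  by apply: DeriveDef; [apply/cvg_ex; eexists; exact: e1|apply/cvg_lim => //; exact: e1].
have [c cs ec] : exists2 c, c \in `[0, s]%R & g s - g 0 = 'D_v G (c *: v + w) * (s - 0).
  apply: MVT_segment => [|tau|]; first exact: ltW.
    by rewrite in_itv /= => /andP[/ltW t0 /ltW ts]; apply: dg; rewrite t0.
  apply: derivable_within_continuous => tau; rewrite in_itv /= => /dg[].
  by [].
have := ec; rewrite /g scale0r add0r subr0 => ->.
rewrite normrM (ger0_norm (ltW s0')) ler_wpM2r ?(ltW s0') // ltW //.
by apply: (hr _ (in_ball _ _)).2; move: cs; rewrite in_itv.
Unshelve. all: by end_near. Qed.

Lemma Ck_on_entry (R : realType) (V : normedModType R) k (U : set V) n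
    (g : V -> 'rV[R]_n) i : open U ->
  Ck_on k U g -> Ck_on k U (fun x => g x 0 i).
Proof.
move=> oU.
have ce (h : V -> 'rV[R]_n) x : {for x, continuous h} ->
    {for x, continuous (fun x => h x 0 i)}.
  move=> ch; apply: (@continuous_comp _ _ _ h (fun z : 'rV[R]_n => z 0 i)) => //.
  exact: coord_continuous.
elim: k g => [|k IH] g [cg Dg]; first by split => // x /cg/ce.
split=> [x /cg/ce//|v]; have [dg Dg'] := Dg v.
split=> [x /dg/derivable_mxP h|]; first exact: h.
apply: Ck_on_ext (IH _ Dg') => // x Ux.
by rewrite derive_mx ?mxE //; exact: dg.
Qed.

Lemma C1_lipschitz_rV (R : realType) (V : normedModType R) (U : set V) n
    (G : V -> 'rV[R]_n) (w0 v : V) : open U -> Ck_on 1 U G -> U w0 ->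
  exists2 C, 0 <= C & exists2 e, 0 < e & forall w s, `|w - w0| < e -> 0 <= s < e ->
    `|G (s *: v + w) - G w| <= C * s.
Proof.
move=> oU hG Uw0.
pose Q j C e := 0 < e -> forall w s, `|w - w0| < e -> 0 <= s < e ->
    `|G (s *: v + w) 0 j - G w 0 j| <= C * s.
have h j : exists C, 0 <= C /\ \forall e \near (0 : R)^'+, Q j C e.
  have [C C0 [e e0 hC]] := C1_lipschitz_line v oU (Ck_on_entry j oU hG) Uw0.
  exists C; split => //; near=> e' => e'0 w s hw /andP[s0 se].
  have ee : e' <= e by near: e'; exact: nbhs_right_le.
  by apply: hC; [exact: lt_le_trans ee|rewrite s0 (lt_le_trans se)].
pose C j := sval (cid (h j)).
have C0 j : 0 <= C j by rewrite /C; case: cid => ? [].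
have hC j : \forall e \near (0 : R)^'+, Q j (C j) e.
  by rewrite /C; case: cid => ? [].
exists (\sum_j C j); first exact: sumr_ge0.
have : \forall e \near (0 : R)^'+, forall j, Q j (C j) e.
  exact: filter_forall.
move=> nC; near (0 : R)^'+ => e.
have e0 : 0 < e by near: e; exact: nbhs_right_gt.
exists e => // w s hw hs; have s0 : 0 <= s by case/andP: hs.
apply: norm_rV_le => [|j]; first by rewrite mulr_ge0 // sumr_ge0.
have hj : forall j, Q j (C j) e by near: e.
rewrite !mxE (le_trans (hj j e0 w s hw hs)) // ler_wpM2r //.
by rewrite (bigD1 j) //= lerDl sumr_ge0.
Unshelve. all: by end_near. Qed.

Lemma dot_minors (R : realType) n (E a b : 'rV[R]_n) j :
  (forall i j, a 0 i * b 0 j = a 0 j * b 0 i) ->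
  dot E a * b 0 j = dot E b * a 0 j.
Proof.
move=> h; rewrite /dot !mulr_suml; apply: eq_bigr => i _.
by rewrite -!mulrA (h i j) [b 0 i * _]mulrC.
Qed.

Section MilnorRegular.
Variables (R : realType) (f : mixed R) (P : nat * nat) (d : nat).
Hypothesis P0 : positive_weight P.
Hypothesis fP : radially_homogeneous P d f.
Hypothesis f0 : mixed_eval f (0, 0) = 0.

Let F1 x := complex.Re (evalR f x).
Let F2 x := complex.Im (evalR f x).

Lemma degree_neq0 z : mixed_eval f z != 0 -> d != 0%N.
Proof.
apply: contraNneq => d0; have := mixed_eval_cscale 0 z fP.
by rewrite (cscale0 P0) f0 d0 expr0 mul1r => <-.
Qed.

(** A small rotation moves [b] by O(t) along the tangent and by O(t^2) along the
radius.  For t > 0 both displacements are nonnegative multiples of fixed directions, as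
[C1_lipschitz_rV] requires. *)
Lemma rotate_decomp (b : 'rV[R]_2) t :
  rotate t b = (2 * t / (1 + t ^+ 2)) *: (\row_i if i == 0 then - b 0 1 else b 0 0)
    + ((2 * t ^+ 2 / (1 + t ^+ 2)) *: (- b) + b).
Proof.
have q0 := sqrp1_neq0 t.
by apply: rV2_ext; rewrite !mxE /=; field.
Qed.

Lemma rotate_coefs (t : R) : 0 < t <= 1 ->
  [/\ 0 <= 2 * t ^+ 2 / (1 + t ^+ 2) <= 2 * t, 0 <= 2 * t / (1 + t ^+ 2) <= 2 * t &
      t <= 2 * t / (1 + t ^+ 2)].
Proof.
move=> /andP[t0 t1]; have q0 : 0 < 1 + t ^+ 2 by rewrite ltr_pwDl // sqr_ge0.
split.
- apply/andP; split; first by rewrite divr_ge0 ?(ltW q0) // mulr_ge0 // sqr_ge0.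
  by rewrite ler_pdivrMr //; nra.
- apply/andP; split; first by rewrite divr_ge0 ?(ltW q0) // mulr_ge0 // ltW.
  by rewrite ler_pdivrMr //; nra.
- by rewrite ler_pdivlMr //; nra.
Qed.

Lemma rotate_circle (b : 'rV[R]_2) t :
  euclidean_sphere 1 b -> euclidean_sphere 1 (rotate t b).
Proof.
move=> /circleE hb; apply/circleE; rewrite !mxE /=; have q0 := sqrp1_neq0 t.
transitivity (b 0 0 ^+ 2 + b 0 1 ^+ 2); last exact: hb.
by field.
Qed.

(** The differential has rank at most one, and by Euler's identity its image
contains d f(x); so f(x) times the conjugate of any increment of [f] is real to
first order. *)
Lemma crit_argument_slope (A1 A2 : 'rV[R]_4 * 'rV[R]_4 -> 'rV[R]_4) x :
  (forall i, polyfun (@coords2 R 4) (fun z => A1 z 0 i) /\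
             polyfun (@coords2 R 4) (fun z => A2 z 0 i)) ->
  (forall x y, evalR f y - evalR f x =
        (dot (y - x) (A1 (x, y)) +i* dot (y - x) (A2 (x, y)))%C) ->
  (forall x i, (A1 (x, x) 0 i +i* A2 (x, x) 0 i)%C =
        real_partials (evalR (wirtinger iu f) x) (evalR (wirtinger iub f) x)
          (evalR (wirtinger iv f) x) (evalR (wirtinger ivb f) x) i) ->
  crit f (toC2 x) -> d != 0%N -> F1 x *: A2 (x, x) - F2 x *: A1 (x, x) = 0.
Proof.
move=> hA eA dA /critP[c1 c2 c3] d0.
have minors i j : A1 (x, x) 0 i * A2 (x, x) 0 j = A1 (x, x) 0 j * A2 (x, x) 0 i.
  have h := dA x; rewrite /evalR in h.
  by have := crit_minors c1 c2 c3 i j; cbv zeta beta; rewrite -!h.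
have [u1 u2] := euler_evalR x hA eA fP.
have dR : d%:R != 0 :> R by rewrite pnatr_eq0.
have := dot_minors (euler_field P x) _ minors; rewrite u1 u2 => e.
apply/rowP => j; apply: (mulfI dR); rewrite !mxE mulr0 mulrBr.
by apply/eqP; rewrite subr_eq0 !mulrA e.
Qed.

(** The left-hand side is |f(x)| |f(y)| times the sine of the angle between the
values, and the angle is twice the arctangent of [t]. *)
Lemma milnor_map_sine x y t :
  evalR f x != 0 -> milnor_map f y = rotate t (milnor_map f x) ->
  evalR f y != 0 ->
  F1 x * F2 y - F2 x * F1 y =
    Num.sqrt (F1 x ^+ 2 + F2 x ^+ 2) * Num.sqrt (F1 y ^+ 2 + F2 y ^+ 2) *
    (2 * t / (1 + t ^+ 2)).
Proof.
move=> fx e fy.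
set nx := Num.sqrt (F1 x ^+ 2 + F2 x ^+ 2); set ny := Num.sqrt (F1 y ^+ 2 + F2 y ^+ 2).
have [x0 x1] := milnor_mapE f x; have [y0 y1] := milnor_mapE f y.
have hx := milnor_map_circle fx; move/circleE: hx => hx.
have nx0 : nx != 0 by rewrite gt_eqF // sqrtr_gt0; apply/evalR_neq0.
have ny0 : ny != 0 by rewrite gt_eqF // sqrtr_gt0; apply/evalR_neq0.
move: e hx; move: (milnor_map f x) (milnor_map f y) x0 x1 y0 y1 => b c.
rewrite -/(F1 x) -/(F2 x) -/(F1 y) -/(F2 y) -/nx -/ny => x0 x1 y0 y1 e hx.
clearbody nx ny; move: (F1 x) (F2 x) (F1 y) (F2 y) x0 x1 y0 y1.
move=> a1 a2 c1 c2 x0 x1 y0 y1.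
have -> : a1 = nx * b 0 0 by rewrite x0 mulrC mulfVK.
have -> : a2 = nx * b 0 1 by rewrite x1 mulrC mulfVK.
have -> : c1 = ny * c 0 0 by rewrite y0 mulrC mulfVK.
have -> : c2 = ny * c 0 1 by rewrite y1 mulrC mulfVK.
rewrite e !mxE /=.
transitivity (nx * ny * (2 * t / (1 + t ^+ 2)) * (b 0 0 ^+ 2 + b 0 1 ^+ 2)).
  have q0 := sqrp1_neq0 t.
  by field.
by rewrite hx mulr1.
Qed.

Lemma dot_le n (u v : 'rV[R]_n) : `|dot u v| <= n%:R * (`|u| * `|v|).
Proof.
rewrite (le_trans (ler_norm_sum _ _ _)) //.
apply: (@le_trans _ _ (\sum_(i < n) `|u| * `|v|)); last first.
  by rewrite sumr_const card_ord mulr_natl.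
by apply: ler_sum => i _; rewrite normrM ler_pM // norm_rV_coord.
Qed.

(** The trivialization carries the rotated argument back to a point [y] of the
sphere with |y - x| = O(t).  By [milnor_map_sine] the product |f(x)| |f(y)| sin is at
least of order t.  It is also the scalar product of y - x with a vector [B y] that
is small near [x], since it vanishes at [x] by [crit_argument_slope]; hence it is
o(t). *)
Lemma regular_of_strong_milnor : weakly_isolated_singularity f ->
  strong_milnor f -> forall z, z != (0, 0) -> ~ crit f z.
Proof.
move=> wis [rho1 rho10 milnor] z z0 cz.
have fz : mixed_eval f z != 0.
  by apply/eqP => fz; apply: (regular_on_zeros P0 fP wis z0 cz).
have d0 := degree_neq0 fz.
have [x1 ex1] := toC2_surj z.
pose sq (x : 'rV[R]_4) := \sum_i x 0 i ^+ 2.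
have psq : polyfun (@coords R 4) sq.
  by apply: polyfun_sum => i; apply: polyfun_exp; apply: polyfun_gen; exists i.
have [t1 t10 small] : exists2 t, 0 < t & sq (rscale P t x1) < rho1 ^+ 2.
  have FF : Filter (nbhs (0 : 'rV[R]_4)) by exact: nbhs_filter.
  apply: (@near_rscale _ _ P0 x1 (fun y => sq y < rho1 ^+ 2)).
  apply: (@cvgr_lt _ _ _ FF sq _ (@polyfun1_continuous _ _ _ psq 0)).
  by rewrite /sq big1 ?exprn_gt0 // => i _; rewrite mxE expr0n.
set x := rscale P t1 x1 in small.
have cx : crit f (toC2 x).
  by rewrite toC2_rscale ex1; apply: (crit_cscale fP).
have fx : evalR f x != 0.
  rewrite /evalR toC2_rscale ex1 (mixed_eval_cscale _ _ fP) mulf_neq0 //.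
  by rewrite (_ : 0 = 0%:C)%C // (inj_eq (@complexI R)) expf_neq0 // gt_eqF.
have sqx : 0 < sq x.
  rewrite lt_neqAle sumr_ge0 ?andbT; last by move=> i _; exact: sqr_ge0.
  apply/eqP => /esym s0; move/eqP: fx; apply.
  have -> : x = 0.
    apply/rowP => i; rewrite [RHS]mxE.
    have h : \sum_i x 0 i ^+ 2 == 0 by apply/eqP.
    rewrite psumr_eq0 in h; last by move=> j _; exact: sqr_ge0.
    move/allP: h => /(_ i); rewrite mem_index_enum => /(_ isT) /=.
    by rewrite sqrf_eq0 => /eqP.
  have -> : evalR f 0 = mixed_eval f (0, 0).
    by rewrite /evalR; congr mixed_eval; rewrite /toC2 !mxE.
  exact: f0.
pose rho := Num.sqrt (sq x).
have rho0 : 0 < rho <= rho1.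
  apply/andP; split; first by rewrite sqrtr_gt0.
  by rewrite -ler_sqr ?nnegrE ?sqrtr_ge0 ?(ltW rho10) // sqr_sqrtr ltW.
have Kx : euclidean_sphere rho x by rewrite /euclidean_sphere /= sqr_sqrtr // ltW.
have Ex (y : 'rV[R]_4) : (euclidean_sphere rho `\` (@toC2 R @^-1` zeros f)) y <->
    euclidean_sphere rho y /\ evalR f y != 0.
  by split=> [[Ky /eqP fy]|[Ky /eqP fy]]; split.
pose b := milnor_map f x.
have bB : euclidean_sphere 1 b by exact: milnor_map_circle.
have [_ /(_ b bB)[Nb [opN Nbb [phi [psi [[sphi spsi hphi hpsi] pr1]]]]]] := milnor rho rho0.
have Ax : (euclidean_sphere rho `\` (@toC2 R @^-1` zeros f)) x by apply/Ex.
have [phix psix] := hphi x (conj Ax Nbb).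
have phi1 : (phi x).1 = b by exact: pr1.
pose y2 := (phi x).2.
have phixE : phi x = (b, y2) by rewrite -phi1 /y2; case: (phi x).
rewrite phixE in phix psix.
have [U [G [oU Ub CG eG]]] := spsi _ phix.
pose b' : 'rV[R]_2 := \row_i if i == 0 then - b 0 1 else b 0 0.
pose v1 : 'rV[R]_2 * 'rV[R]_4 := (- b, 0).
pose v2 : 'rV[R]_2 * 'rV[R]_4 := (b', 0).
pose w0 : 'rV[R]_2 * 'rV[R]_4 := (b, y2).
have [C1 C10 [e1 e10 L1]] := C1_lipschitz_rV v1 oU (CG 1%N) Ub.
have [C2 C20 [e2 e20 L2]] := C1_lipschitz_rV v2 oU (CG 1%N) Ub.
have Gw0 : G w0 = x by rewrite eG.
pose al t : R := 2 * t ^+ 2 / (1 + t ^+ 2).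
pose be t : R := 2 * t / (1 + t ^+ 2).
pose w t := be t *: v2 + (al t *: v1 + w0).
have wE t : w t = (rotate t b, y2).
  by rewrite /w rotate_decomp /= /GRing.add /= /add_pair /= !scaler0 !add0r.
have [A1 [A2 [hA sA eA dA]]] := real_slopes f.
have Bx0 := crit_argument_slope hA eA dA cx d0.
pose B y := F1 x *: A2 (x, y) - F2 x *: A1 (x, y).
pose nrm y := Num.sqrt (F1 y ^+ 2 + F2 y ^+ 2).
have nx0 : 0 < nrm x by rewrite sqrtr_gt0; apply/evalR_neq0.
pose C := 2 * (C1 + C2).
have C0 : 0 <= C by rewrite mulr_ge0 // addr_ge0.
(* With |B y| < eta the scalar product is at most 4 C t eta, the factor 4 coming from
   the sup norm, while the sine yields at least t |f(x)|^2 / 2. *)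
pose eta := nrm x ^+ 2 / (8 * (C + 1)).
have eta0 : 0 < eta by rewrite divr_gt0 ?exprn_gt0 // mulr_gt0 // ltr_pwDr.
have FFx : Filter (nbhs x) by exact: nbhs_filter.
have rA (A : 'rV[R]_4 * 'rV[R]_4 -> 'rV[R]_4) :
    (forall i, polyfun (@coords2 R 4) (fun z => A z 0 i)) ->
    rpolyfun (@coords R 4) (fun y => A (x, y)).
  move=> h i; apply: (polyfun_subst (h := fun y => (x, y)) _ (h i)) => _ [j [->|->]].
    exact: polyfun_cst.
  by apply: polyfun_gen; exists j.
have rB : rpolyfun (@coords R 4) B.
  by apply: rpolyfun_sub; apply: rpolyfun_scale; try exact: polyfun_cst;
    apply: rA => i; have [] := hA i.
have nearB : \forall y \near x, `|B y| < eta.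
  have n1 : \forall y \near x, forall j, `|B y 0 j| < eta.
    apply: (@filter_forall _ _ _ _ FFx) => j.
    apply: (@cvgr_norm_lt _ _ _ _ FFx _ _ (@polyfun1_continuous _ _ _ (rB j) x)).
    by rewrite /B Bx0 mxE normr0.
  by apply: filterS n1 => y; exact: norm_rV_lt.
have nearn : \forall y \near x, nrm x / 2 < nrm y.
  have [p1 p2] := polyfun_F f.
  have pn : polyfun (@coords R 4) (fun y => F1 y ^+ 2 + F2 y ^+ 2).
    by apply: polyfun_add; exact: polyfun_exp.
  have h : (nrm x / 2) ^+ 2 < F1 x ^+ 2 + F2 x ^+ 2.
    rewrite -[ltRHS]sqr_sqrtr ?addr_ge0 ?sqr_ge0 // -/(nrm x).
    by rewrite ltr_sqr ?nnegrE ?divr_ge0 ?(ltW nx0) // ltr_pdivrMr // ltr_pMr // ltr1n.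
  have := @cvgr_gt _ _ _ FFx _ _ (@polyfun1_continuous _ _ _ pn x) _ h.
  apply: filterS => y hy.
  have n2 : 0 <= nrm x / 2 by rewrite divr_ge0 // ltW.
  rewrite -(ger0_norm n2) -sqrtr_sqr ltr_sqrt //.
  by apply: le_lt_trans hy; exact: sqr_ge0.
have [dl dl0 hdl] : exists2 r, 0 < r & forall y, `|y - x| < r ->
    `|B y| < eta /\ nrm x / 2 < nrm y.
  have FF : Filter (nbhs x) by exact: nbhs_filter.
  by apply: near_norm; apply: filterS2 nearB nearn => y; split.
have [eU eU0 heU] : exists2 r, 0 < r & forall w, `|w - w0| < r -> U w /\ Nb w.1.
  have FF : Filter (nbhs w0) by exact: nbhs_filter.
  have n1 : \forall w \near w0, U w by exact: open_nbhs_nbhs.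
  have n2 : \forall w \near w0, Nb w.1.
    have c : fst @ w0 --> w0.1 by exact: cvg_fst.
    exact: (c Nb (open_nbhs_nbhs (conj opN Nbb))).
  by apply: near_norm; apply: filterS2 n1 n2 => y; split.
pose V := `|v1| + `|v2| + 1.
have V0 : 0 < V by rewrite /V ltr_pwDr // addr_ge0.
have [t [t0 t_1 te tV tdl]] : exists t, [/\ 0 < t, t <= 1, 2 * t < Num.min e1 e2,
    2 * t * V < Num.min eU e2 & t * (C + 1) < dl].
  near (0 : R)^'+ => t; exists t; split.
  - by near: t; exact: nbhs_right_gt.
  - by near: t; exact: nbhs_right_le.
  - rewrite -ltr_pdivlMl //; near: t; apply: nbhs_right_lt.
    by rewrite mulr_gt0 ?invr_gt0 // lt_min e10.
  - rewrite -ltr_pdivlMr // -ltr_pdivlMl //; near: t; apply: nbhs_right_lt.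
    by rewrite mulr_gt0 ?invr_gt0 // divr_gt0 // lt_min eU0.
  - rewrite -ltr_pdivlMr ?ltr_pwDr //; near: t; apply: nbhs_right_lt.
    by rewrite divr_gt0 // ltr_pwDr.
move: te; rewrite lt_min => /andP[te1 te2].
have t01 : 0 < t <= 1 by rewrite t0.
have [/andP[al0 al2] /andP[be0 be2] bet] := rotate_coefs t01.
move: tV; rewrite lt_min => /andP[tVU tVe].
have hb : be t * `|v2| <= 2 * t * `|v2| by rewrite ler_wpM2r.
have ha : al t * `|v1| <= 2 * t * `|v1| by rewrite ler_wpM2r.
have VE : 2 * t * V = 2 * t * `|v1| + 2 * t * `|v2| + 2 * t by rewrite /V; ring.
have v2t : 0 <= 2 * t * `|v2| by rewrite !mulr_ge0 // ltW.
have wU : `|w t - w0| < eU.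
  rewrite /w addrA addrK (le_lt_trans (ler_normD _ _)) //.
  rewrite (normrZ (be t) v2) (normrZ (al t) v1) (ger0_norm be0) (ger0_norm al0).
  by apply: le_lt_trans tVU; rewrite VE addrC -addrA lerD // (le_trans hb) // lerDl mulr_ge0 // ltW.
have [Uw Ow] := heU _ wU; rewrite wE /= in Uw Ow.
have Bw : ((@euclidean_sphere R 2 1 `&` Nb) `*`
   ((euclidean_sphere rho `\` (@toC2 R @^-1` zeros f)) `&`
     (milnor_map f @^-1` [set b]))) (rotate t b, y2).
  by case: phix => _ ?; split => //; split => //; exact: rotate_circle.
pose y := psi (rotate t b, y2).
have [[Ey Oy] phiy] := hpsi _ Bw; rewrite -/y in Ey Oy phiy.
have py : milnor_map f y = rotate t b by rewrite -(pr1 y Ey Oy) phiy.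
have [Ky fy] := (Ex y).1 Ey.
have yG : y = G (w t) by rewrite wE eG.
have yx : `|y - x| <= C * t.
  have h1 := L1 w0 (al t); have h2 := L2 (al t *: v1 + w0) (be t).
  rewrite yG -Gw0 /w -(subrKA (G (al t *: v1 + w0))).
  apply: le_trans (ler_normD _ _) _.
  have {}h1 : `|G (al t *: v1 + w0) - G w0| <= C1 * al t.
    by apply: h1; rewrite ?subrr ?normr0 // al0 (le_lt_trans al2).
  have {}h2 : `|G (be t *: v2 + (al t *: v1 + w0)) - G (al t *: v1 + w0)| <= C2 * be t.
    apply: h2; last by rewrite be0 (le_lt_trans be2).
    rewrite addrK (normrZ (al t) v1) (ger0_norm al0).
    by apply: le_lt_trans tVe; rewrite VE -addrA (le_trans ha) // lerDl addr_ge0 // mulr_ge0 // ltW.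
  have c1 : C1 * al t <= C1 * (2 * t) by rewrite ler_wpM2l.
  have c2 : C2 * be t <= C2 * (2 * t) by rewrite ler_wpM2l.
  have -> : C * t = C2 * (2 * t) + C1 * (2 * t) by rewrite /C; ring.
  by rewrite lerD // ?(le_trans h2 c2) ?(le_trans h1 c1).
have [By ny] : `|B y| < eta /\ nrm x / 2 < nrm y.
  by apply: hdl; apply: le_lt_trans yx _; apply: le_lt_trans tdl; rewrite mulrC ler_pM2l // lerDl.
have := milnor_map_sine fx py fy; rewrite -/(nrm x) -/(nrm y) -/(be t) => sine.
have slope : F1 x * F2 y - F2 x * F1 y = dot (y - x) (B y).
  have r1 : dot (y - x) (A1 (x, y)) = F1 y - F1 x.
    by have /(congr1 (@complex.Re R)) := eA x y; rewrite /= cReD cReN => <-.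
  have r2 : dot (y - x) (A2 (x, y)) = F2 y - F2 x.
    by have /(congr1 (@complex.Im R)) := eA x y; rewrite /= cImD cImN => <-.
  by rewrite /B dotBr !dotZr r1 r2; ring.
have := dot_le (y - x) (B y); rewrite -slope sine.
have C8 : eta * (8 * (C + 1)) = nrm x ^+ 2.
  by rewrite /eta mulfVK // gt_eqF // mulr_gt0 // ltr_pwDr.
rewrite ger0_norm; last first.
  by rewrite mulr_ge0 // mulr_ge0 ?sqrtr_ge0.
apply/negP; rewrite -ltNge.
apply: (@le_lt_trans _ _ (4 * (C * t * eta))).
  by rewrite ler_wpM2l // ler_pM // ltW.
apply: (@lt_le_trans _ _ (nrm x * (nrm x / 2) * t)).
  have -> : nrm x * (nrm x / 2) * t = 4 * ((C + 1) * t * eta).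
    by rewrite mulrA -expr2 -C8; field.
  by rewrite ltr_pM2l // ltr_pM2r // ltr_pM2r // ltrDl.
by rewrite ler_pM ?mulr_ge0 ?(ltW nx0) ?(ltW t0) ?divr_ge0 ?(ltW nx0) // ler_wpM2l ?(ltW nx0) // ltW.
Unshelve. all: by end_near. Qed.

End MilnorRegular.

(** * Face functions of radially homogeneous polynomials *)

Section Support.
Variable R : realType.
Implicit Types (f g h : mixed R) (m : multinom 4) (P Q : nat * nat).
Implicit Types p : pred (multinom 4).

(** [face_part] and [restrict_to] are both of this form. *)
Definition mfilter (p : pred (multinom 4)) f : mixed R :=
  \sum_(m <- msupp f | p m) mcoeff m f *: mpolyX R[i] m.

Lemma mcoeff_mfilter p f m : mcoeff m (mfilter p f) = if p m then mcoeff m f else 0.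
Proof.
rewrite /mfilter raddf_sum /=.
have [mf|mf] := boolP (m \in msupp f); last first.
  rewrite big_seq_cond big1 => [|m' /andP[m'f _]].
    by rewrite (memN_msupp_eq0 mf); case: ifP.
  rewrite mcoeffZ mcoeffX; have [e|] := eqVneq m' m; last by rewrite mulr0.
  by rewrite -e m'f in mf.
rewrite big_mkcond (bigD1_seq m) //= ?msupp_uniq // mcoeffZ mcoeffX eqxx mulr1.
rewrite big1 ?addr0 // => m' /negbTE m'm; case: ifP => // _.
by rewrite mcoeffZ mcoeffX m'm mulr0.
Qed.

Lemma mfilter_id p f : (forall m, m \in msupp f -> p m) -> mfilter p f = f.
Proof.
move=> h; apply/mpolyP => m; rewrite mcoeff_mfilter; case: ifP => // /negP pm.
by apply/esym/memN_msupp_eq0/negP => /h.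
Qed.

Lemma mem_mfilter p f m : (m \in msupp (mfilter p f)) = p m && (m \in msupp f).
Proof. by rewrite !mcoeff_msupp mcoeff_mfilter; case: (p m); rewrite ?eqxx. Qed.

Lemma face_part_id_rdeg P f m m' : f = face_part P f ->
  m \in msupp f -> m' \in msupp f -> rdeg P m = rdeg P m'.
Proof.
move=> e; have h m1 m2 : m1 \in msupp f -> m2 \in msupp f -> (rdeg P m1 <= rdeg P m2)%N.
  by rewrite {1}e -/(mfilter _ f) mem_mfilter => /andP[/allP + _]; exact.
by move=> mf m'f; apply/eqP; rewrite eqn_leq !h.
Qed.

Lemma homog_of_radial f : radially_weighted_homogeneous f ->
  exists P d, positive_weight P /\ radially_homogeneous P d f.
Proof.
case=> P P0 e; exists P.
case E : (msupp f) => [|m0 s].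
  by exists 0%N; split => // m; rewrite E.
exists (rdeg P m0); split => // m mf.
by apply: face_part_id_rdeg e mf _; rewrite E mem_head.
Qed.

Lemma face_part_homog P d f : radially_homogeneous P d f -> face_part P f = f.
Proof.
move=> hf; apply: mfilter_id => m hm; apply/allP => m' hm'.
by rewrite (hf _ hm) (hf _ hm').
Qed.

Lemma homogD P d f g : radially_homogeneous P d f -> radially_homogeneous P d g ->
  radially_homogeneous P d (f + g).
Proof.
by move=> hf hg m /msuppD_le; rewrite mem_cat => /orP[/hf|/hg].
Qed.

Lemma homogN P d f : radially_homogeneous P d f -> radially_homogeneous P d (- f).
Proof. by move=> hf m; rewrite mcoeff_msupp mcoeffN oppr_eq0 -mcoeff_msupp => /hf. Qed.

Lemma homogB P d f g : radially_homogeneous P d f -> radially_homogeneous P d g ->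
  radially_homogeneous P d (f - g).
Proof. by move=> hf /homogN; exact: homogD. Qed.

Lemma homogZ P d f c : radially_homogeneous P d f -> radially_homogeneous P d (c *: f).
Proof. by move=> hf m /msuppZ_le/hf. Qed.

Lemma homog0 P d : radially_homogeneous P d (0 : mixed R).
Proof. by move=> m; rewrite mcoeff_msupp mcoeff0 eqxx. Qed.

Lemma homog_sum P d (I : eqType) (r : seq I) (F : I -> mixed R) :
  (forall i, i \in r -> radially_homogeneous P d (F i)) ->
  radially_homogeneous P d (\sum_(i <- r) F i).
Proof.
move=> hF; rewrite big_seq; apply: (big_ind (radially_homogeneous P d)) => //.
- exact: homog0.
- by move=> f g; exact: homogD.
Qed.

Lemma rdegD P m m' : rdeg P (mnm_add m m') = (rdeg P m + rdeg P m')%N.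
Proof. by rewrite /rdeg !mnmDE; ring. Qed.

Lemma homogM P d d' f g : radially_homogeneous P d f -> radially_homogeneous P d' g ->
  radially_homogeneous P (d + d') (f * g).
Proof.
move=> hf hg m /msuppM_le/allpairsP[[m1 m2] /= [h1 h2 ->]].
by rewrite rdegD (hf _ h1) (hg _ h2).
Qed.

Lemma homog1 P : radially_homogeneous P 0 (1 : mixed R).
Proof.
move=> m; rewrite mcoeff_msupp mcoeff1; have [->|_] := eqVneq m mnm0.
  by rewrite /rdeg !mnm0E !muln0.
by rewrite eqxx.
Qed.

Lemma homogX P d f k : radially_homogeneous P d f ->
  radially_homogeneous P (k * d) (f ^+ k).
Proof.
move=> hf; elim: k => [|k IH]; first by rewrite expr0 mul0n; exact: homog1.
by rewrite exprS mulSn; exact: homogM.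
Qed.

Lemma homog_var P i : radially_homogeneous P (cwt P i) (mixedX R i).
Proof.
move=> m; rewrite /mixedX => /mem_msuppXP <-.
by rewrite /rdeg /cwt !mnmE; case: i => [[|[|[|[|//]]]] lt4] /=; ring.
Qed.

Lemma homog_mconj P d f : radially_homogeneous P d f ->
  radially_homogeneous P d (mconj f).
Proof.
move=> hf; rewrite /mconj comp_mpolyE; apply: homog_sum => m hm.
have {}hm : m \in msupp f.
  move: hm; rewrite !mcoeff_msupp mcoeff_map_mpoly.
  by apply: contraNneq => ->; rewrite raddf0.
apply: homogZ; rewrite -(hf m hm) big_ord4 /=.
have -> : rdeg P m = (m iu * cwt P iub + (m iv * cwt P ivb +
    (m iub * cwt P iu + m ivb * cwt P iv)))%N.
  by rewrite /rdeg /cwt /=; ring.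
by do 3?[apply: homogM]; apply: homogX; exact: homog_var.
Qed.

Section Criticals.
Variables (f : mixed R) (P : nat * nat) (d : nat).
Hypothesis fP : radially_homogeneous P d f.

Lemma crit_s1_homog : radially_homogeneous P ((d - P.1) + (d - P.2)) (crit_s1 f).
Proof.
have h := @wirtinger_homogeneous _ _ _ _ fP.
apply: homogB; apply: homogM.
- exact: (h iu).
- exact: homog_mconj (h ivb).
- exact: homog_mconj (h iub).
- exact: (h iv).
Qed.

Lemma crit_s2_homog : radially_homogeneous P ((d - P.1) + (d - P.1)) (crit_s2 f).
Proof.
have h := @wirtinger_homogeneous _ _ _ _ fP.
apply: homogB; apply: homogM.
- exact: (h iu).
- exact: homog_mconj (h iu).
- exact: (h iub).
- exact: homog_mconj (h iub).
Qed.

Lemma crit_s3_homog : radially_homogeneous P ((d - P.2) + (d - P.2)) (crit_s3 f).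
Proof.
have h := @wirtinger_homogeneous _ _ _ _ fP.
apply: homogB; apply: homogM.
- exact: (h iv).
- exact: homog_mconj (h iv).
- exact: (h ivb).
- exact: homog_mconj (h ivb).
Qed.

End Criticals.

(** [udeg] and [vdeg] are the coordinates of the exponent of a monomial in the
Newton diagram. *)
Definition udeg m : nat := m iu + m iub.
Definition vdeg m : nat := m iv + m ivb.

Lemma at_u0E h : at_u0 h = mfilter (fun m => udeg m == 0%N) h.
Proof.
rewrite /at_u0 comp_mpolyE /mfilter big_mkcond [RHS]big_mkcond /=.
apply: eq_bigr => m _; rewrite big_ord4 /= /tnth /= !expr0n /udeg addn_eq0.
have [m0|] := eqVneq (m iu) 0%N; last by rewrite mul0r scaler0.
have [m2|] := eqVneq (m iub) 0%N; last by rewrite mul0r mulr0 mulr0 scaler0.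
by rewrite !mul1r [mpolyX _ m]mpolyXE_id big_ord4 /= m0 m2 !expr0 !mul1r.
Qed.

Lemma at_v0E h : at_v0 h = mfilter (fun m => vdeg m == 0%N) h.
Proof.
rewrite /at_v0 comp_mpolyE /mfilter big_mkcond [RHS]big_mkcond /=.
apply: eq_bigr => m _; rewrite big_ord4 /= /tnth /= !expr0n /vdeg addn_eq0.
have [m0|] := eqVneq (m iv) 0%N; last by rewrite mul0r mulr0 scaler0.
have [m2|] := eqVneq (m ivb) 0%N; last by rewrite !mulr0 scaler0.
by rewrite mul1r mulr1 [mpolyX _ m]mpolyXE_id big_ord4 /= m0 m2 !expr0 mul1r mulr1.
Qed.

Lemma mixed_eval_at_u0 h (z : R[i] * R[i]) :
  mixed_eval (at_u0 h) z = mixed_eval h (0, z.2).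
Proof.
rewrite /mixed_eval /at_u0 comp_mpoly_meval; apply: meval_eq => i.
by case: i => [[|[|[|[|//]]]] lt4]; rewrite /tnth /= /mixedX ?meval0 ?oppr0 ?mevalXU.
Qed.

Lemma mixed_eval_at_v0 h (z : R[i] * R[i]) :
  mixed_eval (at_v0 h) z = mixed_eval h (z.1, 0).
Proof.
rewrite /mixed_eval /at_v0 comp_mpoly_meval; apply: meval_eq => i.
by case: i => [[|[|[|[|//]]]] lt4]; rewrite /tnth /= /mixedX ?meval0 ?oppr0 ?mevalXU.
Qed.

(** The remaining monomials contain only v and vbar, so one degree fixes the other
for all weights. *)
Lemma at_u0_homog P d h Q : positive_weight P -> radially_homogeneous P d h ->
  radially_homogeneous Q (Q.2 * (d %/ P.2)) (at_u0 h).
Proof.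
move=> [_ p2] hh m; rewrite at_u0E mem_mfilter => /andP[/eqP um /hh <-].
by rewrite /rdeg -/(udeg m) -/(vdeg m) um !muln0 !add0n mulKn.
Qed.

Lemma at_v0_homog P d h Q : positive_weight P -> radially_homogeneous P d h ->
  radially_homogeneous Q (Q.1 * (d %/ P.1)) (at_v0 h).
Proof.
move=> [p1 _] hh m; rewrite at_v0E mem_mfilter => /andP[/eqP vm /hh <-].
by rewrite /rdeg -/(udeg m) -/(vdeg m) vm !muln0 !addn0 mulKn.
Qed.

(** On monomials of the same P-degree, the Q-degree is an increasing function of
the degree in u.  So the face function consists of the monomials of least degree in u.
If that degree is zero it is h(0, v); otherwise h(0, v) is zero. *)
Lemma face_part_at_u0 P d h Q z : positive_weight P -> radially_homogeneous P d h ->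
  (P.1 * Q.2 < Q.1 * P.2)%N -> mixed_eval (face_part Q h) z = 0 ->
  mixed_eval (at_u0 h) z = 0.
Proof.
move=> [p1 p2] hh PQ.
have [/hasP[m0 m0h /eqP u0]|] := boolP (has (fun m => udeg m == 0%N) (msupp h)).
  suff -> : face_part Q h = at_u0 h by [].
  rewrite at_u0E; apply/mpolyP => m; rewrite !mcoeff_mfilter.
  have [mh|mh] := boolP (m \in msupp h); last first.
    by rewrite (memN_msupp_eq0 mh); case: ifP; case: ifP.
  have comp m' : m' \in msupp h -> (P.2 * rdeg Q m' = P.2 * rdeg Q m0 +
      (Q.1 * P.2 - P.1 * Q.2) * udeg m')%N.
    move=> /hh e'; have e0 := hh _ m0h; move: e0 e'; rewrite /rdeg.
    rewrite -!/(udeg _) -!/(vdeg _) u0 => e0 e'; nia.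
  congr (if _ then _ else _); apply/allP/eqP => [hm|um m' m'h].
    have := hm _ m0h; rewrite -(leq_pmul2l p2) (comp _ mh) (comp _ m0h) u0; nia.
  rewrite -(leq_pmul2l p2) (comp _ mh) (comp _ m'h) um; nia.
move=> none _; rewrite at_u0E.
have -> : mfilter (fun m => udeg m == 0%N) h = 0; last by rewrite /mixed_eval meval0.
apply/mpolyP => m; rewrite mcoeff_mfilter mcoeff0; case: ifP => // um.
by apply/memN_msupp_eq0; apply: contra none => mh; apply/hasP; exists m.
Qed.

Lemma face_part_at_v0 P d h Q z : positive_weight P -> radially_homogeneous P d h ->
  (Q.1 * P.2 < P.1 * Q.2)%N -> mixed_eval (face_part Q h) z = 0 ->
  mixed_eval (at_v0 h) z = 0.
Proof.
move=> [p1 p2] hh PQ.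
have [/hasP[m0 m0h /eqP u0]|] := boolP (has (fun m => vdeg m == 0%N) (msupp h)).
  suff -> : face_part Q h = at_v0 h by [].
  rewrite at_v0E; apply/mpolyP => m; rewrite !mcoeff_mfilter.
  have [mh|mh] := boolP (m \in msupp h); last first.
    by rewrite (memN_msupp_eq0 mh); case: ifP; case: ifP.
  have comp m' : m' \in msupp h -> (P.1 * rdeg Q m' = P.1 * rdeg Q m0 +
      (P.1 * Q.2 - Q.1 * P.2) * vdeg m')%N.
    move=> /hh e'; have e0 := hh _ m0h; move: e0 e'; rewrite /rdeg.
    rewrite -!/(udeg _) -!/(vdeg _) u0 => e0 e'; nia.
  congr (if _ then _ else _); apply/allP/eqP => [hm|um m' m'h].
    have := hm _ m0h; rewrite -(leq_pmul2l p1) (comp _ mh) (comp _ m0h) u0; nia.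
  rewrite -(leq_pmul2l p1) (comp _ mh) (comp _ m'h) um; nia.
move=> none _; rewrite at_v0E.
have -> : mfilter (fun m => vdeg m == 0%N) h = 0; last by rewrite /mixed_eval meval0.
apply/mpolyP => m; rewrite mcoeff_mfilter mcoeff0; case: ifP => // um.
by apply/memN_msupp_eq0; apply: contra none => mh; apply/hasP; exists m.
Qed.

Lemma face_part_proportional P d h Q : positive_weight P -> radially_homogeneous P d h ->
  (P.1 * Q.2 = Q.1 * P.2)%N -> face_part Q h = h.
Proof.
move=> [p1 p2] hh PQ; apply: mfilter_id => m mh; apply/allP => m' m'h.
have e1 := hh _ mh; have e2 := hh _ m'h; move: e1 e2; rewrite /rdeg => e1 e2.
by rewrite -(leq_pmul2l p1); nia.
Qed.

Lemma zeros_face_at_u0 P d h Q (z : R[i] * R[i]) :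
  positive_weight P -> radially_homogeneous P d h ->
  zeros (face_part Q (at_u0 h)) z <-> zeros h (0, z.2).
Proof.
by move=> P0 hh; rewrite /zeros /= (face_part_homog (at_u0_homog Q P0 hh)) mixed_eval_at_u0.
Qed.

Lemma zeros_face_at_v0 P d h Q (z : R[i] * R[i]) :
  positive_weight P -> radially_homogeneous P d h ->
  zeros (face_part Q (at_v0 h)) z <-> zeros h (z.1, 0).
Proof.
by move=> P0 hh; rewrite /zeros /= (face_part_homog (at_v0_homog Q P0 hh)) mixed_eval_at_v0.
Qed.

Lemma zeros_face_lt P d h Q z : positive_weight P -> radially_homogeneous P d h ->
  (P.1 * Q.2 < Q.1 * P.2)%N -> zeros (face_part Q h) z -> zeros h (0, z.2).
Proof.
by move=> P0 hh PQ /(face_part_at_u0 P0 hh PQ); rewrite mixed_eval_at_u0.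
Qed.

Lemma zeros_face_gt P d h Q z : positive_weight P -> radially_homogeneous P d h ->
  (Q.1 * P.2 < P.1 * Q.2)%N -> zeros (face_part Q h) z -> zeros h (z.1, 0).
Proof.
by move=> P0 hh PQ /(face_part_at_v0 P0 hh PQ); rewrite mixed_eval_at_v0.
Qed.

Lemma zeros_face_eq P d h Q z : positive_weight P -> radially_homogeneous P d h ->
  (P.1 * Q.2 = Q.1 * P.2)%N -> zeros (face_part Q h) z <-> zeros h z.
Proof. by move=> P0 hh PQ; rewrite (face_part_proportional P0 hh PQ). Qed.

Section SPND.
Variables (f : mixed R) (P : nat * nat) (d : nat).
Hypothesis P0 : positive_weight P.
Hypothesis fP : radially_homogeneous P d f.

Let h1 := crit_s1_homog fP.
Let h2 := crit_s2_homog fP.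
Let h3 := crit_s3_homog fP.

Lemma spnd_of_regular : (forall z, z != (0, 0) -> ~ crit f z) -> SPND f.
Proof.
move=> reg Q Q0; split=> z [z1 z2] [[e1 e2] e3].
- move: e1 e2 e3 => /(zeros_face_at_u0 _ _ P0 h1) e1.
  move=> /(zeros_face_at_u0 _ _ P0 h2) e2 /(zeros_face_at_u0 _ _ P0 h3) e3.
  by case: (reg (0, z.2) _ (conj (conj e1 e2) e3)); apply/eqP => -[] /eqP; apply/negP.
- move: e1 e2 e3 => /(zeros_face_at_v0 _ _ P0 h1) e1.
  move=> /(zeros_face_at_v0 _ _ P0 h2) e2 /(zeros_face_at_v0 _ _ P0 h3) e3.
  by case: (reg (z.1, 0) _ (conj (conj e1 e2) e3)); apply/eqP => -[] /eqP; apply/negP.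
move: e1 e2 e3; have [PQ|PQ|PQ] := ltngtP (P.1 * Q.2)%N (Q.1 * P.2)%N.
- move=> /(zeros_face_lt P0 h1 PQ) e1 /(zeros_face_lt P0 h2 PQ) e2.
  move=> /(zeros_face_lt P0 h3 PQ) e3.
  by case: (reg (0, z.2) _ (conj (conj e1 e2) e3)); apply/eqP => -[] /eqP; apply/negP.
- move=> /(zeros_face_gt P0 h1 PQ) e1 /(zeros_face_gt P0 h2 PQ) e2.
  move=> /(zeros_face_gt P0 h3 PQ) e3.
  by case: (reg (z.1, 0) _ (conj (conj e1 e2) e3)); apply/eqP => -[] /eqP; apply/negP.
- move=> /(zeros_face_eq _ P0 h1 PQ) e1 /(zeros_face_eq _ P0 h2 PQ) e2.
  move=> /(zeros_face_eq _ P0 h3 PQ) e3.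
  by case: (reg z _ (conj (conj e1 e2) e3)); apply/eqP => ze; rewrite ze eqxx in z1.
Qed.

(** A point on an axis is excluded by the conditions on h(0, v) and h(u, 0): these
do not depend on the other coordinate, which may be set to 1. *)
Lemma regular_of_spnd : SPND f -> forall z, z != (0, 0) -> ~ crit f z.
Proof.
move=> /(_ P P0)[s1 s2 s3] [z1 z2] z0 [[e1 e2] e3].
have [zu|zu] := eqVneq z1 0.
  have zv : z2 != 0 by apply: contra_neq z0 => ->; rewrite zu.
  rewrite zu in e1 e2 e3.
  case: (s1 (1, z2)); first by split => //=; exact: oner_neq0.
  split; first split.
  - exact: ((zeros_face_at_u0 P (1, z2) P0 h1).2 e1).
  - exact: ((zeros_face_at_u0 P (1, z2) P0 h2).2 e2).
  - exact: ((zeros_face_at_u0 P (1, z2) P0 h3).2 e3).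
have [zv|zv] := eqVneq z2 0.
  rewrite zv in e1 e2 e3.
  case: (s2 (z1, 1)); first by split => //=; exact: oner_neq0.
  split; first split.
  - exact: ((zeros_face_at_v0 P (z1, 1) P0 h1).2 e1).
  - exact: ((zeros_face_at_v0 P (z1, 1) P0 h2).2 e2).
  - exact: ((zeros_face_at_v0 P (z1, 1) P0 h3).2 e3).
case: (s3 (z1, z2)); first by split.
split; first split.
- exact: ((zeros_face_eq (z1, z2) P0 h1 erefl).2 e1).
- exact: ((zeros_face_eq (z1, z2) P0 h2 erefl).2 e2).
- exact: ((zeros_face_eq (z1, z2) P0 h3 erefl).2 e3).
Qed.

End SPND.
End Support.

(** * The Newton polyhedron of a radially homogeneous polynomial *)

Section Newton.
Variable R : realType.
Implicit Types (f : mixed R) (m : multinom 4) (P Q : nat * nat) (x y v : 'rV[R]_2).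

Lemma convex_segments (A : set 'rV[R]_2) : @convex_set R 'rV[R]_2 A <->
  forall x y t, 0 <= t <= 1 -> A x -> A y -> A (t *: x + (1 - t) *: y).
Proof.
split=> [cA x y t /andP[t0 t1] /mem_set Ax /mem_set Ay|cA x y t /set_mem Ax /set_mem Ay].
  exact: set_mem (cA x y (Itv01 t0 t1) Ax Ay).
by apply/mem_set/(cA x y t%:num) => //; rewrite ge0 le1.
Qed.

Lemma minimal_monomial f (g : multinom 4 -> nat) : f != 0 ->
  exists2 m0, m0 \in msupp f & forall m, m \in msupp f -> (g m0 <= g m)%N.
Proof.
move=> f0.
have ex : exists n, has (fun m => g m == n) (msupp f).
  exists (g (mlead f)); apply/hasP; exists (mlead f) => //.
  by rewrite mlead_supp.
case: (ex_minnP ex) => n /hasP[m0 m0f /eqP gm0] min.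
by exists m0 => // m mf; rewrite gm0; apply: min; apply/hasP; exists m.
Qed.

Lemma sum2E (a x : 'rV[R]_2) : \sum_i a 0 i * x 0 i = a 0 0 * x 0 0 + a 0 1 * x 0 1.
Proof.
rewrite big_ord_recl big_ord1; congr (_ + a 0 _ * x 0 _); exact: val_inj.
Qed.

Lemma expo0 m : expo R m 0 0 = (udeg m)%:R. Proof. by rewrite mxE. Qed.
Lemma expo1 m : expo R m 0 1 = (vdeg m)%:R. Proof. by rewrite mxE. Qed.

Lemma convex_quadrant (c0 c1 c q1 q2 : R) : @convex_set R 'rV[R]_2
  [set x : 'rV[R]_2 | [/\ c0 <= x 0 0, c1 <= x 0 1 & c <= q1 * x 0 0 + q2 * x 0 1]].
Proof.
apply/convex_segments => y z t /andP[t0 t1] [y0 y1 yd] [z0 z1 zd].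
have t1' : 0 <= 1 - t by rewrite subr_ge0.
have comb (k a b : R) : k <= a -> k <= b -> k <= t * a + (1 - t) * b.
  move=> ka kb; rewrite -[leLHS](_ : t * k + (1 - t) * k = k); last by ring.
  by rewrite lerD // ler_wpM2l.
split; rewrite !mxE; [exact: comb|exact: comb|].
rewrite (_ : _ + _ = t * (q1 * y 0 0 + q2 * y 0 1) +
  (1 - t) * (q1 * z 0 0 + q2 * z 0 1)); last by ring.
exact: comb.
Qed.

(** For two points on a line of negative slope, the quadrant with the least
abscissa and the least ordinate of the two cuts the line in the segment that
they span. *)
Lemma segment_line (q1 q2 c : R) (a b x : 'rV[R]_2) : 0 < q1 -> 0 < q2 ->
  q1 * a 0 0 + q2 * a 0 1 = c -> q1 * b 0 0 + q2 * b 0 1 = c ->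
  a 0 0 <= b 0 0 -> b 0 1 <= a 0 1 -> a 0 0 <= x 0 0 -> b 0 1 <= x 0 1 ->
  q1 * x 0 0 + q2 * x 0 1 = c ->
  exists2 t, 0 <= t <= 1 & x = t *: a + (1 - t) *: b.
Proof.
move=> q10 q20 lA lB a0 b0 xa xb ex.
have x0b : x 0 0 <= b 0 0 by have h := ler_wpM2l (ltW q20) xb; rewrite -(ler_pM2l q10); lra.
have x1a : x 0 1 <= a 0 1 by have h := ler_wpM2l (ltW q10) xa; rewrite -(ler_pM2l q20); lra.
have [ab|ab] := eqVneq (a 0 0) (b 0 0).
  have ab1 : a 0 1 = b 0 1.
    by apply: (mulfI (lt0r_neq0 q20)); apply: (addrI (q1 * a 0 0)); rewrite lA {1}ab lB.
  exists 1; first by rewrite ler01 lexx.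
  by rewrite scale1r subrr scale0r addr0; apply: rV2_ext; lra.
have D0 : 0 < b 0 0 - a 0 0 by rewrite subr_gt0 lt_neqAle ab.
pose t := (b 0 0 - x 0 0) / (b 0 0 - a 0 0).
have e0 : x 0 0 = t * a 0 0 + (1 - t) * b 0 0.
  by rewrite /t; field; rewrite gt_eqF.
exists t.
  rewrite /t ler_pdivlMr // ler_pdivrMr // mul0r mul1r.
  by apply/andP; split; lra.
apply: rV2_ext; rewrite !mxE -?e0 //.
apply: (mulfI (lt0r_neq0 q20)); apply: (addrI (q1 * x 0 0)); rewrite ex {1}e0.
rewrite -[LHS](_ : t * c + (1 - t) * c = c); last by ring.
by rewrite -{1}lA -lB; ring.
Qed.

(** Write q1 (r1 x1 + r2 x2) = r1 (q1 x1 + q2 x2) + (r2 q1 - r1 q2) x2: on the half-plane above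
the line and above the ordinate [e2] both terms are least at [e] only. *)
Lemma corner (q1 q2 r1 r2 e1 e2 x1 x2 : R) : 0 < q1 -> 0 < q2 -> 0 < r1 ->
  r1 * q2 < r2 * q1 -> e2 <= x2 -> q1 * e1 + q2 * e2 <= q1 * x1 + q2 * x2 ->
  r1 * x1 + r2 * x2 <= r1 * e1 + r2 * e2 -> x1 = e1 /\ x2 = e2.
Proof.
move=> q10 q20 r10 slope x2e line low.
have k1 : 0 <= (r2 * q1 - r1 * q2) * (x2 - e2) by rewrite mulr_ge0 ?subr_ge0 // ltW.
have k2 : 0 <= r1 * (q1 * x1 + q2 * x2 - (q1 * e1 + q2 * e2)).
  by rewrite mulr_ge0 ?subr_ge0 // ltW.
have k3 : 0 <= q1 * (r1 * e1 + r2 * e2 - (r1 * x1 + r2 * x2)).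
  by rewrite mulr_ge0 ?subr_ge0 // ltW.
have e2E : x2 = e2.
  have : (r2 * q1 - r1 * q2) * (x2 - e2) = 0 by lra.
  by move/eqP; rewrite mulf_eq0 !subr_eq0 (gt_eqF slope) => /eqP.
split=> //; rewrite e2E in k2 k3.
have : (r1 * q1) * (x1 - e1) = 0 by lra.
by move/eqP; rewrite mulf_eq0 (gt_eqF (mulr_gt0 r10 q10)) subr_eq0 => /eqP.
Qed.

Lemma newton_convex f x y t : 0 <= t <= 1 ->
  newton_polyhedron f x -> newton_polyhedron f y ->
  newton_polyhedron f (t *: x + (1 - t) *: y).
Proof.
move=> t01 Nx Ny A [cA gA]; apply: (convex_segments A).1 => //.
- exact: Nx.
- exact: Ny.
Qed.

Lemma newton_expo f m : m \in msupp f -> newton_polyhedron f (expo R m).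
Proof. by move=> mf; apply: sub_gen_smallest; exists m. Qed.

(** The points [x] such that x + v belongs to the polyhedron form a convex set that
contains the generators. *)
Lemma newton_up f x v : (forall i, 0 <= v 0 i) -> newton_polyhedron f x ->
  newton_polyhedron f (x + v).
Proof.
move=> v0 Nx.
apply: (@smallest_sub _ _ _ [set y | newton_polyhedron f (y + v)] _ _ _ Nx).
  apply/convex_segments => y z t t01 Ny Nz /=.
  rewrite (_ : _ + v = t *: (y + v) + (1 - t) *: (z + v)); first exact: newton_convex.
  by rewrite !scalerDr addrACA -scalerDl addrC [t + _]addrC subrK scale1r addrC.
move=> y [m mf my]; apply: sub_gen_smallest; exists m => // i.
by rewrite [leRHS]mxE ler_wpDr.
Qed.

Variables (f : mixed R) (P : nat * nat) (d : nat) (mA mB : multinom 4).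
Hypothesis P0 : positive_weight P.
Hypothesis fP : radially_homogeneous P d f.
Hypotheses (mAf : mA \in msupp f) (mBf : mB \in msupp f).
Hypothesis minA : forall m, m \in msupp f -> (udeg mA <= udeg m)%N.
Hypothesis minB : forall m, m \in msupp f -> (vdeg mB <= vdeg m)%N.

Let p1 : R := P.1%:R.
Let p2 : R := P.2%:R.
Let p10 : 0 < p1. Proof. by rewrite ltr0n; case: P0. Qed.
Let p20 : 0 < p2. Proof. by rewrite ltr0n; case: P0. Qed.

Lemma expo_line m : m \in msupp f ->
  p1 * expo R m 0 0 + p2 * expo R m 0 1 = d%:R.
Proof. by move=> /fP <-; rewrite expo0 expo1 -!natrM -natrD. Qed.

Lemma newton_bounds x : newton_polyhedron f x ->
  [/\ expo R mA 0 0 <= x 0 0, expo R mB 0 1 <= x 0 1 & d%:R <= p1 * x 0 0 + p2 * x 0 1].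
Proof.
move: x; apply: (@smallest_sub _ _ _ [set x : 'rV[R]_2 | [/\ expo R mA 0 0 <= x 0 0,
  expo R mB 0 1 <= x 0 1 & d%:R <= p1 * x 0 0 + p2 * x 0 1]]).
  exact: convex_quadrant.
move=> y [m mf my]; split.
- by apply: le_trans (my 0); rewrite !expo0 ler_nat minA.
- by apply: le_trans (my 1); rewrite !expo1 ler_nat minB.
- by rewrite -(expo_line mf) lerD // ler_wpM2l // ltW.
Qed.

(** The face with inner normal [P].  It is a 1-face or, if all the exponents coincide,
a vertex. *)
Definition edge : set 'rV[R]_2 :=
  [set x | newton_polyhedron f x /\ p1 * x 0 0 + p2 * x 0 1 = d%:R].

Lemma edge_expo m : m \in msupp f -> edge (expo R m).
Proof. by move=> mf; split; [exact: newton_expo|exact: expo_line]. Qed.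

Lemma edge_segment :
  edge = (fun t : R => t *: expo R mA + (1 - t) *: expo R mB) @` `[0, 1].
Proof.
have a0 : expo R mA 0 0 <= expo R mB 0 0 by rewrite !expo0 ler_nat minA.
have b0 : expo R mB 0 1 <= expo R mA 0 1 by rewrite !expo1 ler_nat minB.
have lA := expo_line mAf; have lB := expo_line mBf.
apply/seteqP; split=> [x [Nx ex]|_ [t t01 <-]].
  have [xa xb _] := newton_bounds Nx.
  have [t t01 ->] := segment_line p10 p20 lA lB a0 b0 xa xb ex.
  by exists t; rewrite //= in_itv.
have t01' : 0 <= t <= 1 by move: t01; rewrite /= in_itv.
split; first by apply: newton_convex => //; exact: newton_expo.
move: (expo R mA) (expo R mB) lA lB {a0 b0} => a b lA lB.
rewrite !mxE -[RHS](_ : t * d%:R + (1 - t) * d%:R = d%:R); last by ring.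
by rewrite -{1}lA -lB; ring.
Qed.

Lemma edge_compact : compact edge.
Proof.
rewrite edge_segment; apply: continuous_compact; last exact: segment_compact.
apply: continuous_subspaceT => t; apply: cvgD; apply: cvgZr_tmp.
  exact: cvg_id.
by apply: cvgB; try exact: cvg_cst; exact: cvg_id.
Qed.

Lemma compact_edge : compact_face f edge.
Proof.
split; last exact: edge_compact.
split; first by exists (expo R mA); exact: edge_expo.
have [w w0 w1] : exists2 w : 'rV[R]_2, w 0 0 = p1 & w 0 1 = p2.
  by exists (\row_i if i == 0 then p1 else p2); rewrite mxE.
exists w; first by apply: contraTneq p10 => we; rewrite -w0 we mxE ltxx.
rewrite /edge; apply/seteqP; split=> x [Nx ex]; split=> //.
  by move=> y Ny; rewrite !sum2E w0 w1 ex; case: (newton_bounds Ny).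
have := ex _ (newton_expo mAf); rewrite !sum2E w0 w1 (expo_line mAf).
by have [_ _ h] := newton_bounds Nx => h'; apply/eqP; rewrite eq_le h h'.
Qed.

(** A linear form that attains its minimum on a compact set of points has positive
coefficients, because the polyhedron contains the half-lines along the axes from
each of its points.  If the form is proportional to [P] its face is the edge;
otherwise it is minimal at one end of the edge only, by [corner]. *)
Lemma compact_face_cases F : compact_face f F ->
  [\/ F = edge, F = [set expo R mA] | F = [set expo R mB]].
Proof.
move=> [[[x0 Fx0] [a _ eF]] cF].
have apos i : 0 < a 0 i.
  rewrite ltNge; apply/negP => ai.
  have [M [_ hM]] := compact_bounded cF.
  have Fup t : 0 <= t -> F (x0 + t *: delta_mx 0 i).
    move=> t0; move: Fx0; rewrite eF => -[Nx0 mx0]; split.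
      apply: newton_up => // j; rewrite !mxE; case: eqP; case: eqP; rewrite /= ?mulr1 ?mulr0 //.
    move=> y /mx0; apply: le_trans.
    under eq_bigr do rewrite mxE mulrDr.
    rewrite big_split /= gerDl (bigD1 i) //= big1 => [|j ji].
      by rewrite !mxE !eqxx mulr1 addr0 mulr_le0_ge0.
    by rewrite !mxE (negbTE ji) andbF !mulr0.
  pose t := `|M| + 2 + `|x0 0 i|.
  have t0 : 0 <= t by rewrite /t !addr_ge0.
  have M1 : M < `|M| + 1 by rewrite ltr_pwDr ?ler_norm.
  have := hM _ M1 _ (Fup t t0).
  apply/negP; rewrite -ltNge; apply: lt_le_trans (norm_rV_coord _ i).
  rewrite !mxE !eqxx mulr1; apply: lt_le_trans (ler_norm _).
  by have := ler_norm (- x0 0 i); rewrite normrN /t; lra.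
have a0 := apos 0; have a1 := apos 1.
have minF x y : F x -> newton_polyhedron f y ->
    a 0 0 * x 0 0 + a 0 1 * x 0 1 <= a 0 0 * y 0 0 + a 0 1 * y 0 1.
  by rewrite eF => -[_ h] /h; rewrite !sum2E.
have FN x : F x -> newton_polyhedron f x by rewrite eF => -[].
have NA := newton_expo mAf; have NB := newton_expo mBf.
have lA := expo_line mAf; have lB := expo_line mBf.
have single e : newton_polyhedron f e -> (forall x, F x -> x = e) -> F = [set e].
  move=> _ Fe; apply/seteqP; split=> [x /Fe ->//|_ ->].
  by rewrite -(Fe _ Fx0).
have [slope|slope|slope] := ltgtP (a 0 0 * p2) (a 0 1 * p1).
- apply: Or33; apply: (single _ NB) => x Fx.
  have [_ xb xd] := newton_bounds (FN _ Fx).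
  rewrite -lB in xd.
  have [e0 e1] := corner p10 p20 a0 slope xb xd (minF _ _ Fx NB).
  exact: rV2_ext.
- apply: Or32; apply: (single _ NA) => x Fx.
  have [xa _ xd] := newton_bounds (FN _ Fx).
  have := minF _ _ Fx NA; rewrite -lA in xd.
  rewrite addrC [leRHS]addrC in xd => h; rewrite addrC [leRHS]addrC in h.
  have [e1 e0] := corner p20 p10 a1 slope xa xd h.
  exact: rV2_ext.
apply: Or31; have prop (y : 'rV[R]_2) : p2 * (a 0 0 * y 0 0 + a 0 1 * y 0 1) =
    a 0 1 * (p1 * y 0 0 + p2 * y 0 1).
  by rewrite !mulrDr !mulrA [p2 * _]mulrC slope; ring.
apply/seteqP; split=> [x Fx|x [Nx ex]].
  split; first exact: FN.
  have [_ _ xd] := newton_bounds (FN _ Fx); apply/le_anti; rewrite xd andbT.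
  by have := minF _ _ Fx NA; rewrite -(ler_pM2l p20) !prop lA ler_pM2l.
rewrite eF; split=> // y Ny; rewrite !sum2E -(ler_pM2l p20) !prop ler_pM2l // ex.
by have [] := newton_bounds Ny.
Qed.

Lemma compact_face_expo F : compact_face f F -> F `<=` edge.
Proof.
case/compact_face_cases => -> //; first by move=> _ ->; exact: edge_expo.
by move=> _ ->; exact: edge_expo.
Qed.

Lemma one_face_edge F : one_face f F -> F = edge.
Proof.
by move=> [/compact_face_cases[//|->|->] [x [y [-> ->]]]]; rewrite eqxx.
Qed.

Lemma newton_boundary_edge : newton_boundary f = edge.
Proof.
apply/seteqP; split=> [x [F /compact_face_expo FE /FE //]|x ex].
by exists edge => //; exact: compact_edge.
Qed.

Lemma restrict_to_edge : restrict_to f edge = f.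
Proof. by apply: mfilter_id => m mf; apply/asboolP; exact: edge_expo. Qed.

Lemma edge_one_face : ~ single_vertex f -> one_face f edge /\ expo R mA <> expo R mB.
Proof.
rewrite /single_vertex newton_boundary_edge => nv.
have AB : expo R mA != expo R mB.
  apply/eqP => AB; apply: nv; exists (expo R mA); rewrite edge_segment -AB.
  apply/seteqP; split=> [_ [t _ <-]|_ ->] /=; first by rewrite -scalerDl addrC subrK scale1r.
  exists 1; first by rewrite /= in_itv /= ler01 lexx.
  by rewrite scale1r subrr scale0r addr0.
split; last exact/eqP.
split; first exact: compact_edge.
by exists (expo R mA), (expo R mB); split => //; exact: edge_expo.
Qed.

Lemma one_face_weight_P : ~ single_vertex f -> one_face_weight f P.
Proof.
move=> /edge_one_face[oe _]; split=> //; exists edge => //.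
by rewrite restrict_to_edge (face_part_homog fP).
Qed.

(** The face function of such a weight is [f], so both ends of the edge have the same
Q-degree. *)
Lemma one_face_weight_proportional Q : ~ single_vertex f -> one_face_weight f Q ->
  (Q.1 * P.2 = P.1 * Q.2)%N.
Proof.
move=> /edge_one_face[_ AB] [[q1 q2] [F /one_face_edge ->]].
rewrite restrict_to_edge => /esym/face_part_id_rdeg/(_ mAf mBf).
have := fP mAf; rewrite -(fP mBf) /rdeg -/(udeg mA) -/(udeg mB) -/(vdeg mA) -/(vdeg mB).
move=> eP eQ.
have uAB := minA mBf; have vAB := minB mAf.
have : udeg mA != udeg mB.
  apply/eqP => uE; apply: AB; apply: rV2_ext; rewrite ?expo0 ?expo1 ?uE //.
  by have [_ p2'] := P0; congr (_%:R); apply/eqP; rewrite -(eqn_pmul2l p2'); apply/eqP; lia.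
have [k uB] : exists k, udeg mB = (udeg mA + k)%N by exists (udeg mB - udeg mA)%N; lia.
have [l vA] : exists l, vdeg mA = (vdeg mB + l)%N by exists (vdeg mA - vdeg mB)%N; lia.
rewrite uB vA in eP eQ *; rewrite -[X in X != _]addn0 eqn_add2l eq_sym => k0.
have kl : (P.1 * k = P.2 * l)%N by lia.
have kl' : (Q.1 * k = Q.2 * l)%N by lia.
have k1 : (0 < k)%N by rewrite lt0n.
apply/eqP; rewrite -(eqn_pmul2r k1); apply/eqP.
by rewrite mulnAC kl' mulnAC [RHS]mulnAC kl; ring.
Qed.

Lemma sind_of_regular : (forall z, z != (0, 0) -> ~ crit f z) -> SIND f.
Proof.
move=> reg; split=> [_|nv].
  by rewrite newton_boundary_edge restrict_to_edge.
have nz (z : R[i] * R[i]) : z.1 != 0 \/ z.2 != 0 -> z != (0, 0).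
  by move=> h; apply/eqP => ze; move: h; rewrite ze eqxx => -[].
have face Q : one_face_weight f Q -> face_part Q f = f.
  by move=> [_ [F /one_face_edge ->]] ->; exact: restrict_to_edge.
split=> [Q [/face -> _] z z2|Q [/face -> _] z z1|F hF z [z1 _]].
- by apply/reg/nz; right.
- by apply/reg/nz; left.
have -> : F = edge.
  case: hF => [/one_face_edge//|[_ [F1 [F2 [/one_face_edge -> /one_face_edge -> _ _]]]]].
  by [].
by rewrite restrict_to_edge; apply/reg/nz; left.
Qed.

(** Up to multiples [P] is the only weight of a 1-face, hence it is both the first and
the last one.  The two conditions on these weights exclude the critical points with
v <> 0 and those with u <> 0. *)
Lemma regular_of_sind : SIND f -> forall z, z != (0, 0) -> ~ crit f z.
Proof.
move=> [sv nsv] z z0; have [/sv h|nv] := pselect (single_vertex f).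
  by move: h; rewrite newton_boundary_edge restrict_to_edge; apply.
have [first last _] := nsv nv; have oP := one_face_weight_P nv.
have fE := face_part_homog fP.
have [z1|z1] := eqVneq z.1 0.
  have z2 : z.2 != 0 by apply: contra_neq z0 => z2; rewrite [z]surjective_pairing z1 z2.
  rewrite -fE; apply: first z2; split=> // Q oQ.
  by rewrite (one_face_weight_proportional nv oQ).
rewrite -fE; apply: last z1; split=> // Q oQ.
by rewrite (one_face_weight_proportional nv oQ).
Qed.
End Newton.

(** * The equivalences *)

Section Cone.
Variables (R : realType) (f : mixed R).
Hypothesis f_at0 : mixed_eval f (0, 0) = 0.
Hypothesis f_reg : forall z, z != (0, 0) -> ~ crit f z.

Lemma toC2_0 : toC2 (0 : 'rV[R]_4) = (0, 0).
Proof. by rewrite /toC2 !mxE. Qed.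

Lemma isolated_of_regular : isolated_singularity f.
Proof.
move=> c0; exists setT; first exact: openT.
rewrite setTI; apply/seteqP; split=> [x cx|_ ->] /=; last by rewrite toC2_0.
by apply: toC2_eq0; apply/eqP/negP => /negP/f_reg; exact.
Qed.

Lemma weakly_isolated_of_regular : weakly_isolated_singularity f.
Proof.
move=> /isolated_of_regular[U oU eU]; exists U => //.
rewrite preimage_setI setIA [U `&` _]setIC -setIA eU; apply/setIidr => _ ->.
by rewrite /preimage /= toC2_0.
Qed.

End Cone.

Theorem proposition1p5 (R : realType) (f : mixed R)
    (f_neq0 : f != 0) (f_at0 : mixed_eval f (0, 0) = 0)
    (f_homog : radially_weighted_homogeneous f) :
  [<-> weakly_isolated_singularity f /\ strong_milnor f;
       isolated_singularity f;
       SPND f;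
       SIND f].
Proof.
have [P [d [P0 fP]]] := homog_of_radial f_homog.
have [mA mAf minA] := minimal_monomial udeg f_neq0.
have [mB mBf minB] := minimal_monomial vdeg f_neq0.
tfae.
- by move=> [wis milnor]; apply: isolated_of_regular; exact: (regular_of_strong_milnor P0 fP).
- by move=> /(regular_of_isolated P0 fP)/(spnd_of_regular P0 fP).
- move=> /(regular_of_spnd P0 fP).
  exact: (@sind_of_regular _ _ _ _ mA mB P0 fP mAf mBf minA minB).
- move=> /(@regular_of_sind _ _ _ _ mA mB P0 fP mAf mBf minA minB) reg.
  split; first exact: weakly_isolated_of_regular.
  exact: strong_milnor_of_regular P0 fP reg.
Qed.
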